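(* Let $B$ be a compact connected Riemann surface equipped with a Riemannian metric $d$, let $U$ be a finite union of disjoint closed discs in $B$, let $B_0=B\setminus U$ and $b_0\in B_0$, and fix a simple base $\alpha_1,\dots,\alpha_k$ of $\pi_1(B_0,b_0)$. Let $p\ge1$ be an integer. Then there exist $L,R>0$ with the following property. For every finite subset $S\subset B_0$ and every union $Z$ of $p$ closed discs in $B$, each of $d$-radius $R$, there exist $b\in B_0\setminus(S\cup Z)$ and piecewise smooth loops $\gamma_1,\dots,\gamma_k\subset B_0\setminus(S\cup Z)$ based at $b$ which represent respectively $\alpha_1,\dots,\alpha_k$ in $\pi_1(B_0,b_0)$ up to a single conjugation and such that for every $i=1,\dots,k$, $$\mathrm{length}_{d_{B_0\setminus(S\cup Z)}}(\gamma_i)\le L(\#S+1).$$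
   Context: A loop $\gamma\colon[0,1]\to X$ in a surface is simple if it is non-nullhomotopic and injective on $[0,1)$. A simple base of $\pi_1(B_0,b_0)$ is a canonical system of generators $\alpha_1,\dots,\alpha_k$ such that each $\alpha_i$ is represented by a simple piecewise smooth closed loop in $B_0$ based at $b_0$ (here $B_0$ is viewed as the interior of an orientable connected compact surface, possibly with boundary). A collection $\{c_{b_0b}\}_{b\in B_0}$ of smooth directed paths in $B_0$ of bounded $d$-length is fixed once and for all, $c_{b_0b}$ going from $b_0$ to $b$; a loop $\gamma$ based at $b$ represents $\alpha_i$ up to a single conjugation if the loop at $b_0$ obtained by following $c_{b_0b}$, then $\gamma$, then $c_{b_0b}^{-1}$ has class $\alpha_i$ in $\pi_1(B_0,b_0)$. A closed disc of $d$-radius $R$ is a set $\{x\in B\colon d(x,z)\le R\}$ with $z\in B$. For a complex manifold $X$, $d_X$ is the Kobayashi (pseudo-)hyperbolic metric, with infinitesimal form $\lambda_X(x,v)=\inf\frac2{R'}$ over all $R'>0$ for which there is a holomorphic map $h\colon\{z\in\mathbb{C}\colon|z|<R'\}\to X$ with $h(0)=x$, $h'(0)=v$; $\mathrm{length}_{d_X}(\gamma)=\int_0^1\lambda_X(\gamma(t),\gamma'(t))\,dt$. *)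

(* Defs.v *)
From HB Require Import structures.
From mathcomp Require Import all_boot all_order all_algebra finmap complex.
From mathcomp Require Import all_classical all_reals all_analysis.

Set Implicit Arguments.
Unset Strict Implicit.
Unset Printing Implicit Defensive.

Import Order.TTheory GRing.Theory Num.Theory.
Import numFieldNormedType.Exports.

Local Open Scope classical_set_scope.
Local Open Scope ring_scope.

(* The complex plane as a normed space over itself: a function
   f : Cplx R -> Cplx R is complex differentiable at z iff [derivable f z 1],
   and its complex derivative at z is ['D_1 f z]. *)
Notation Cplx R := ((complex R)^o).

Definition to_complex (R : realType) (z : R * R) : Cplx R :=
  Complex z.1 z.2.

(** * Smooth (C^oo) maps between normed spaces *)

Definition iter_derive (R : realType) (V W : normedModType R)
    (f : V -> W) (vs : seq V) : V -> W :=
  foldr (fun (v : V) (g : V -> W) (x : V) => 'D_v g x) f vs.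

Definition smooth_at (R : realType) (V W : normedModType R)
    (f : V -> W) (x : V) : Prop :=
  \forall y \near x, forall vs : seq V,
    {for y, continuous (iter_derive f vs)} /\
    forall v : V, derivable (iter_derive f vs) y v.

(** * Riemann surfaces *)

(* The atlas is indexed by the points of B, [chart p] being a chart around p
   with domain [chart_dom p].  This fixes an identification of the tangent space
   T_p B with the complex plane through the chart [chart p], used throughout. *)
Record riemann_surface (R : realType) (B : topologicalType) := RiemannSurface {
  chart_dom : B -> set B;
  chart : B -> B -> Cplx R;
  chart_inv : B -> Cplx R -> B;
  rs_hausdorff : hausdorff_space B;
  chart_dom_open : forall p, open (chart_dom p);
  chart_dom_self : forall p, chart_dom p p;
  chart_open : forall p, open (chart p @` chart_dom p);
  chartK : forall p x, chart_dom p x -> chart_inv p (chart p x) = x;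
  chart_continuous : forall p x, chart_dom p x -> {for x, continuous (chart p)};
  chart_inv_continuous : forall p z, (chart p @` chart_dom p) z ->
    {for z, continuous (chart_inv p)};
  transition_holomorphic : forall p q z, (chart p @` (chart_dom p `&` chart_dom q)) z ->
    derivable (chart q \o chart_inv p) z 1
}.

(** * Paths, parametrized by [0, 1]; values outside [0, 1] are irrelevant *)

Definition is_path (R : realType) (B : topologicalType) (X : set B)
    (x y : B) (gamma : R -> B) : Prop :=
  [/\ {within `[0, 1], continuous gamma}, gamma 0 = x, gamma 1 = y &
      gamma @` `[0, 1] `<=` X].

Definition is_loop (R : realType) (B : topologicalType) (X : set B)
    (x : B) (gamma : R -> B) : Prop := is_path X x x gamma.

Definition path_concat (R : realType) (B : topologicalType)
    (gamma delta : R -> B) : R -> B :=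
  fun t => if t <= 2^-1 then gamma (2 * t) else delta (2 * t - 1).

Definition path_reverse (R : realType) (B : topologicalType)
    (gamma : R -> B) : R -> B := fun t => gamma (1 - t).

(* Homotopy in X relative to the endpoints x, y. *)
Definition homotopic (R : realType) (B : topologicalType) (X : set B)
    (x y : B) (gamma delta : R -> B) : Prop :=
  exists H : R * R -> B,
    [/\ {within `[0, 1] `*` `[0, 1], continuous H},
        H @` (`[0, 1] `*` `[0, 1]) `<=` X,
        (forall t, 0 <= t <= 1 -> H (0, t) = gamma t /\ H (1, t) = delta t) &
        (forall s, 0 <= s <= 1 -> H (s, 0) = x /\ H (s, 1) = y)].

(** * The fundamental group; its elements are homotopy classes of loops *)

Definition pi1_class (R : realType) (B : topologicalType) (X : set B)
    (x : B) (gamma : R -> B) : set (R -> B) :=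
  [set delta | homotopic X x x gamma delta].

Definition pi1 (R : realType) (B : topologicalType) (X : set B) (x : B) :
    set (set (R -> B)) :=
  [set pi1_class X x gamma | gamma in [set gamma | is_loop X x gamma]].

Definition pi1_one (R : realType) (B : topologicalType) (X : set B) (x : B) :
    set (R -> B) := pi1_class X x (fun=> x).

Definition pi1_mul (R : realType) (B : topologicalType) (X : set B) (x : B)
    (a1 a2 : set (R -> B)) : set (R -> B) :=
  [set delta | exists g1 g2, [/\ a1 g1, a2 g2 &
                               homotopic X x x (path_concat g1 g2) delta]].

Definition pi1_inv (R : realType) (B : topologicalType)
    (a : set (R -> B)) : set (R -> B) := [set delta | a (path_reverse delta)].

(* A word in the letters x_0, x_1, ... and their inverses:
   (i, false) is x_i and (i, true) is the inverse of x_i. *)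
Definition word := seq (nat * bool).

Definition pi1_eval (R : realType) (B : topologicalType) (X : set B) (x : B)
    (alpha : seq (set (R -> B))) (w : word) : set (R -> B) :=
  foldr (fun l acc =>
      let a := nth (pi1_one X x) alpha l.1 in
      pi1_mul X x (if l.2 then pi1_inv a else a) acc)
    (pi1_one X x) w.

(* Equality of words in the group < x_0, x_1, ... | r >. *)
Inductive pres_eq (r : word) : word -> word -> Prop :=
| pres_refl w : pres_eq r w w
| pres_sym w1 w2 : pres_eq r w1 w2 -> pres_eq r w2 w1
| pres_trans w1 w2 w3 : pres_eq r w1 w2 -> pres_eq r w2 w3 -> pres_eq r w1 w3
| pres_cancel u v i e :
    pres_eq r (u ++ [:: (i, e); (i, ~~ e)] ++ v) (u ++ v)
| pres_relator u v : pres_eq r (u ++ r ++ v) (u ++ v).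

(* [a_1, b_1] ... [a_g, b_g] c_1 ... c_m, where a_j, b_j are the letters
   x_(2j-2), x_(2j-1) and c_j is the letter x_(2g+j-1). *)
Definition surface_relator (g m : nat) : word :=
  flatten [seq [:: (j.*2, false); (j.*2.+1, false);
                   (j.*2, true); (j.*2.+1, true)] | j <- iota 0 g] ++
  [seq (j, false) | j <- iota g.*2 m].

(* alpha generates pi_1(X, x), subject to the single defining relation
   surface_relator g m = 1. *)
Definition standard_generators (R : realType) (B : topologicalType)
    (X : set B) (x : B) (g m : nat) (alpha : seq (set (R -> B))) : Prop :=
  let valid (w : word) := all (fun l => (l.1 < size alpha)%N) w in
  [/\ size alpha = (g.*2 + m)%N,
      (forall i, (i < size alpha)%N ->
         pi1 X x (nth (pi1_one X x) alpha i)),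
      (forall a, pi1 X x a -> exists2 w, valid w & a = pi1_eval X x alpha w) &
      (forall w, valid w ->
         pi1_eval X x alpha w = pi1_one X x <->
         pres_eq (surface_relator g m) w [::])].

(* For X the interior of a compact orientable surface with m boundary
   components.  Given m, the group pi_1(X, x) determines g, which is therefore
   the genus.  When m > 0 the relation expresses the last generator through the
   others, and it is customary to omit it (leaving a free basis); both
   conventions are allowed. *)
Definition canonical_generators (R : realType) (B : topologicalType)
    (X : set B) (x : B) (m : nat) (alpha : seq (set (R -> B))) : Prop :=
  exists g : nat,
    standard_generators X x g m alpha \/
    ((0 < m)%N /\ exists c, standard_generators X x g m (rcons alpha c)).

Definition simple_loop (R : realType) (B : topologicalType) (X : set B)
    (x : B) (gamma : R -> B) : Prop :=
  [/\ is_loop X x gamma, ~ homotopic X x x gamma (fun=> x) &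
      {in `[0, 1[ &, injective gamma}].

(** * Smooth paths *)

(* On [a, b], gamma is locally the restriction of a smooth map defined on a
   neighbourhood in the real line (one-sided smoothness at a and b). *)
Definition smooth_path_on (R : realType) (B : topologicalType)
    (M : riemann_surface R B) (gamma : R -> B) (a b : R) : Prop :=
  forall t, a <= t <= b -> exists f : R -> R * R,
    smooth_at f t /\
    \forall s \near t, a <= s <= b ->
      chart_dom M (gamma t) (gamma s) /\
      chart M (gamma t) (gamma s) = to_complex (f s).

Definition piecewise_smooth (R : realType) (B : topologicalType)
    (M : riemann_surface R B) (gamma : R -> B) : Prop :=
  exists F : set R, finite_set F /\
    forall a b, 0 <= a -> a < b -> b <= 1 ->
      (forall t, F t -> ~ (a < t < b)) -> smooth_path_on M gamma a b.

(* alpha is a simple base of pi_1(X, x). *)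
Definition simple_base (R : realType) (B : topologicalType)
    (M : riemann_surface R B) (X : set B) (x : B) (m : nat)
    (alpha : seq (set (R -> B))) : Prop :=
  canonical_generators X x m alpha /\
  forall i, (i < size alpha)%N -> exists gamma,
    [/\ piecewise_smooth M gamma, simple_loop X x gamma &
        nth (pi1_one X x) alpha i = pi1_class X x gamma].

(* gamma'(t), as an element of T_(gamma t) B. *)
Definition velocity (R : realType) (B : topologicalType)
    (M : riemann_surface R B) (gamma : R -> B) (t : R) : Cplx R :=
  let f : R -> Cplx R := chart M (gamma t) \o gamma in
  Complex (derive1 (fun s => complex.Re (f s)) t)
          (derive1 (fun s => complex.Im (f s)) t).

(* Length for a Finsler (pseudo-)norm N x v, where v is in T_x B. *)
Definition path_length (R : realType) (B : topologicalType)
    (M : riemann_surface R B) (N : B -> Cplx R -> R) (gamma : R -> B) :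
    \bar R :=
  (\int[lebesgue_measure]_(t in `[0%R, 1%R])
     (N (gamma t) (velocity M gamma t))%:E)%E.

(** * Riemannian metrics *)

(* [metric x] is the inner product on T_x B.  In the last field, [D w] is the
   differential at w of the change from the chart [chart p] to the chart
   defining T_x B, so that the functions required to be smooth are the
   components of the metric in the chart [chart p]. *)
Record riemannian_metric (R : realType) (B : topologicalType)
    (M : riemann_surface R B) := RiemannianMetric {
  metric : B -> Cplx R -> Cplx R -> R;
  metric_sym : forall x u v, metric x u v = metric x v u;
  metric_linear : forall x (a : R) u v w,
    metric x (Complex a 0 * u + v) w = a * metric x u w + metric x v w;
  metric_pos : forall x v, v != 0 -> 0 < metric x v v;
  metric_smooth : forall p (u v : Cplx R) (z : R * R),
    (chart M p @` chart_dom M p) (to_complex z) ->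
    smooth_at (fun w : R * R =>
      let x := chart_inv M p (to_complex w) in
      let D : Cplx R := 'D_1 (chart M x \o chart_inv M p) (to_complex w) in
      metric x (D * u) (D * v)) z
}.

Definition metric_norm (R : realType) (B : topologicalType)
    (M : riemann_surface R B) (d : riemannian_metric M) (x : B) (v : Cplx R) :
    R := Num.sqrt (metric d x v v).

Definition metric_length (R : realType) (B : topologicalType)
    (M : riemann_surface R B) (d : riemannian_metric M) (gamma : R -> B) :
    \bar R := path_length M (metric_norm d) gamma.

Definition metric_dist (R : realType) (B : topologicalType)
    (M : riemann_surface R B) (d : riemannian_metric M) (x y : B) : \bar R :=
  ereal_inf [set metric_length d gamma | gamma in
    [set gamma | is_path [set: B] x y gamma /\ piecewise_smooth M gamma]].

Definition metric_disc (R : realType) (B : topologicalType)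
    (M : riemann_surface R B) (d : riemannian_metric M) (z : B) (r : R) :
    set B := [set x | (metric_dist d x z <= r%:E)%E].

(* An embedded closed disc, without reference to a metric. *)
Definition closed_disc (R : realType) (B : topologicalType) (D : set B) :
    Prop :=
  let E : set (Cplx R) := [set z | `|z| <= 1] in
  exists e : Cplx R -> B,
    [/\ {within E, continuous e}, {in E &, injective e} & D = e @` E].

(** * The Kobayashi metric *)

(* h restricts to a holomorphic map from the disc |z| < r to X. *)
Definition holomorphic_disc (R : realType) (B : topologicalType)
    (M : riemann_surface R B) (X : set B) (r : R) (h : Cplx R -> B) : Prop :=
  forall z : Cplx R, `|z| < Complex r 0 ->
    [/\ X (h z), {for z, continuous h} & derivable (chart M (h z) \o h) z 1].

(* The infinitesimal Kobayashi metric of an open subset X of B. *)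
Definition kobayashi (R : realType) (B : topologicalType)
    (M : riemann_surface R B) (X : set B) (x : B) (v : Cplx R) : R :=
  inf [set 2 / r | r in [set r : R | 0 < r /\
    exists h : Cplx R -> B,
      [/\ holomorphic_disc M X r h, h 0 = x & 'D_1 (chart M x \o h) 0 = v]]].

(* Main.v *)
(* The curves are built in charts out of straight segments that keep a distance
   c/(n+1), n = #S, from S and Z: an affine disc around each of their points
   bounds the Kobayashi norm there by O(n+1).  Such a clearance exists because a
   metric disc of small radius is contained in a small square of a chart, so S
   and Z are seen by a 1-Lipschitz function u as n points and p short intervals,
   and by pigeonhole some level of u in a prescribed interval has distance at
   least c/(n+1) from all of them.  Taking for u the sup-norm distance to the
   centre of a chart, or a coordinate, gives clear square frames and clear
   lines, and hence, around each point, connections from a clear frame at x to a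
   clear frame at y for x, y near that point.  Concatenating them along a fixed
   path beta from x to y yields for each choice of clear frames a curve of
   length O(n+1) which is homotopic to beta.

   It remains to choose b so that the given path c b, over which there is no
   control, can be compared with a fixed one.  The group pi_1(B_0, b_0) is
   countable, so by the Baire category theorem there are a b_1 and a
   neighbourhood of it in which the b with c b homotopic to c b_1 followed by a
   short path are dense.  The frame at b_1 avoiding S and Z can thus be moved
   slightly so as to pass through such a b, and corridors along the loops
   (c b_1)^-1 a_i (c b_1), with a_i in alpha_i, both starting and ending at b,
   represent all alpha_i up to conjugation by c b. *)
Require Import Defs.
From HB Require Import structures.
From mathcomp Require Import all_boot all_order all_algebra finmap complex.
From mathcomp Require Import all_classical all_reals all_analysis.
From mathcomp Require Import ring lra measurable_realfun.
Set Implicit Arguments.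
Unset Strict Implicit.
Unset Printing Implicit Defensive.
Import Order.TTheory GRing.Theory Num.Theory.
Import numFieldNormedType.Exports.
Import ComplexField.Normc.
Local Open Scope classical_set_scope.
Local Open Scope ring_scope.

(** * The complex plane with real radii *)

Section complex_plane.
Variable R : realType.
Notation C := (Cplx R).
Local Notation Re := (@complex.Re R).
Local Notation Im := (@complex.Im R).
Implicit Types (z w h : C) (A : set C).

(** Homotopies are taken in [B0], not in the complement of [S] and [Z], so a curve may pass an
    obstacle on either side: inside a chart square two paths with the same ends are homotopic by
    convexity, and only the length of a detour matters. [L] and [rho] precede [S] and [Z], while
    clear levels and [b] come after them; hence the constants of a corridor are uniform over all
    frames with radius in a fixed interval and all end points on them. The number of pieces depends
    on the loops alone, so doubling the speed at each concatenation costs a constant factor. Two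
    definitions account for most of the preparation. Smoothness at [t] is tested in the chart
    attached to the point at [t], and chart changes are only assumed complex differentiable: for a
    segment to be smooth, derivatives of holomorphic maps must be holomorphic, which is obtained
    from Goursat's theorem and Cauchy's formula. And distances are infima of lengths, integrals of
    speeds that are not known to be measurable: confining a small disc to a square takes a lower
    bound of the length by the displacement in a chart. *)

Definition of_complex (z : C) : R * R := (Re z, Im z).

Lemma of_complexK : cancel of_complex (@to_complex R).
Proof. by case. Qed.

Lemma to_complexK : cancel (@to_complex R) of_complex.
Proof. by case. Qed.

Lemma norm_normc z : `|z| = (normc z)%:C%C.
Proof. by []. Qed.

Lemma gt0_complex (e : R[i]) : 0 < e -> 0 < Re e /\ e = (Re e)%:C%C.
Proof. by case: e => a b; rewrite ltcE /= => /andP[/eqP -> ->]. Qed.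

(** Balls of [C] have radii in [C] itself, where being positive forces a radius to be real; from
    here on radii are taken in [R]. *)
Lemma nbhs_complexP z A :
  nbhs z A <-> exists2 e : R, 0 < e & forall w, normc (z - w) < e -> A w.
Proof.
split.
  move=> /(@nbhs_ballP (complex R) C) [e /= /gt0_complex[e0 ee] H].
  exists (Re e) => // w zw; apply: H.
  by rewrite -ball_normE /= ee norm_normc ltcR.
move=> [e e0 H]; apply/(@nbhs_ballP (complex R) C).
exists (e%:C%C) => /=; first by rewrite (ltcR 0 e).
by move=> w; rewrite -ball_normE /= norm_normc ltcR; exact: H.
Qed.

Lemma normc_ge0 z : 0 <= normc z.
Proof. by case: z => a b; rewrite /normc sqrtr_ge0. Qed.

Lemma le_Re_normc z : `|Re z| <= normc z.
Proof. by case: z => a b /=; rewrite -sqrtr_sqr ler_wsqrtr // lerDl sqr_ge0. Qed.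

Lemma le_Im_normc z : `|Im z| <= normc z.
Proof. by case: z => a b /=; rewrite -sqrtr_sqr ler_wsqrtr // lerDr sqr_ge0. Qed.

Lemma normc_le z : normc z <= `|Re z| + `|Im z|.
Proof.
case: z => a b /=; rewrite -[leRHS]ger0_norm ?addr_ge0 // -sqrtr_sqr.
rewrite ler_wsqrtr // sqrrD !real_normK ?num_real //.
by rewrite lerD2r lerDl mulrn_wge0 ?mulr_ge0.
Qed.

Lemma normcB z w : normc (z - w) = normc (w - z).
Proof. by rewrite -opprB normcN. Qed.

Lemma le_norm_of_complex z : `|of_complex z| <= normc z.
Proof. by rewrite prod_normE /= ge_max le_Re_normc le_Im_normc. Qed.

Lemma normc_to_complex (z : R * R) : normc (to_complex z) <= 2 * `|z|.
Proof.
apply: le_trans (normc_le _) _; rewrite /= mulr_natl mulr2n lerD //;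
  by rewrite prod_normE le_max lexx ?orbT.
Qed.

Lemma ReD z w : Re (z + w) = Re z + Re w.
Proof. by case: z w => [? ?] [? ?]. Qed.

Lemma ImD z w : Im (z + w) = Im z + Im w.
Proof. by case: z w => [? ?] [? ?]. Qed.

Lemma ReN z : Re (- z) = - Re z.
Proof. by case: z. Qed.

Lemma ImN z : Im (- z) = - Im z.
Proof. by case: z. Qed.

Lemma to_complexB (z w : R * R) : to_complex (z - w) = to_complex z - to_complex w.
Proof. by case: z w => [a b] [c d]. Qed.

Lemma of_complexB z w : of_complex (z - w) = of_complex z - of_complex w.
Proof. by case: z w => [a b] [c d]. Qed.

Lemma to_complex_continuous : continuous (@to_complex R).
Proof.
move=> z A /nbhs_complexP[e e0 eA].
apply/(@nbhs_ballP R (R * R)%type); exists (e / 2) => /=; first exact: divr_gt0.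
move=> w; rewrite -ball_normE /= => zw; apply: eA; rewrite -to_complexB.
by apply: le_lt_trans (normc_to_complex _) _; rewrite mulrC -ltr_pdivlMr.
Qed.

Lemma of_complex_continuous : continuous (of_complex : C -> (R * R)%type).
Proof.
move=> z A /(@nbhs_ballP R (R * R)%type)[e /= e0 eA].
apply/nbhs_complexP; exists e => // w zw; apply: eA; rewrite -ball_normE /=.
by rewrite -of_complexB (le_lt_trans (le_norm_of_complex _)).
Qed.

Lemma Re_continuous : continuous (Re : C -> R).
Proof.
move=> z A /(@nbhs_ballP R R)[e /= e0 eA].
apply/nbhs_complexP; exists e => // w zw; apply: eA; rewrite /ball /=.
by rewrite -ReN -ReD (le_lt_trans (le_Re_normc _)).
Qed.

Lemma Im_continuous : continuous (Im : C -> R).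
Proof.
move=> z A /(@nbhs_ballP R R)[e /= e0 eA].
apply/nbhs_complexP; exists e => // w zw; apply: eA; rewrite /ball /=.
by rewrite -ImN -ImD (le_lt_trans (le_Im_normc _)).
Qed.

Lemma continuous_complexP (f : C -> C) z : {for z, continuous f} <->
  forall e : R, 0 < e -> exists2 dl : R, 0 < dl &
    forall w, normc (w - z) < dl -> normc (f w - f z) < e.
Proof.
split.
  move=> fz e e0.
  have /fz/nbhs_complexP[dl dl0 H] : nbhs (f z) [set w | normc (w - f z) < e].
    by apply/nbhs_complexP; exists e => // w; rewrite normcB.
  by exists dl => // w; rewrite normcB => /H.
move=> H A /nbhs_complexP[e e0 eA]; have [dl dl0 dlH] := H _ e0.
apply/nbhs_complexP; exists dl => // w; rewrite normcB => /dlH.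
by rewrite normcB => /eA.
Qed.

(** The derivative as a linear approximation with error [o(h)]: no division, real tolerances, and
    [h = 0] is allowed. *)
Definition has_cderive (f : C -> C) z l := forall e : R, 0 < e ->
  exists2 dl : R, 0 < dl &
    forall h, normc h < dl -> normc (f (z + h) - f z - l * h) <= e * normc h.

Lemma has_cderiveP (f : C -> C) z l : has_cderive f z l <-> is_derive z 1 f l.
Proof.
split=> [H|].
  have L : h^-1 *: ((f \o shift z) (h *: (1 : C)) - f z) @[h --> (0 : C)^'] --> l.
    move=> A /nbhs_complexP[e e0 eA].
    have [dl dl0 dlH] := H _ (divr_gt0 e0 (ltr0n R 2)).
    suff : nbhs (0 : C) [set h | h != 0 -> A (h^-1 *: ((f \o shift z) (h *: (1 : C)) - f z))] by [].
    apply/nbhs_complexP; exists dl => // h; rewrite sub0r normcN => hdl h0 /=.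
    apply: eA; have -> : l - h^-1 *: (f (h *: (1:C) + z) - f z) =
       - (h^-1 * (f (z + h) - f z - l * h)).
      rewrite [h *: _]mulr1 [h + z]addrC [_ *: _]/(_ * _) mulrBr opprB mulrCA.
      by rewrite mulVf // mulr1.
    have nh : 0 < normc h.
      by rewrite lt_def normc_ge0 andbT; apply: contra h0 => /eqP/eq0_normc ->.
    rewrite normcN normcM normcV mulrC ltr_pdivrMr //.
    by apply: le_lt_trans (dlH _ hdl) _; rewrite ltr_pM2r // ltr_pdivrMr // ltr_pMr // ltrDl.
  apply: DeriveDef; first by apply/cvg_ex; exists l.
  exact: cvg_lim L.
move=> [df fl] e e0.
have L : h^-1 *: ((f \o shift z) (h *: (1 : C)) - f z) @[h --> (0 : C)^'] --> l.
  by rewrite -fl; exact: df.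
have /L : nbhs l [set w | normc (w - l) < e].
  by apply/nbhs_complexP; exists e => // w; rewrite normcB.
move=> /(nbhs_complexP (0 : C) [set h | h != 0 -> _])[dl dl0 H].
exists dl => // h hdl; have [->|h0] := eqVneq h 0.
  by rewrite addr0 subrr mulr0 subr0 normc0 mulr0.
have nh : 0 < normc h.
  by rewrite lt_def normc_ge0 andbT; apply: contra h0 => /eqP/eq0_normc ->.
have := H h; rewrite sub0r normcN => /(_ hdl h0) /=.
rewrite [h *: _]mulr1 [h + z]addrC.
have -> : h^-1 *: (f (z + h) - f z) - l = h^-1 * (f (z + h) - f z - l * h).
  by rewrite mulrBr mulrCA mulVf // mulr1.
by rewrite normcM normcV mulrC ltr_pdivrMr // => /ltW.
Qed.

Lemma derivable_has_cderive (f : C -> C) z :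
  derivable f z 1 -> has_cderive f z ('D_1 f z).
Proof. by move=> H; apply/has_cderiveP; apply: DeriveDef. Qed.

Lemma has_cderive_derivable (f : C -> C) z l : has_cderive f z l -> derivable f z 1.
Proof. by move=> /has_cderiveP[]. Qed.

Lemma has_cderive_val (f : C -> C) z l : has_cderive f z l -> 'D_1 f z = l.
Proof. by move=> /has_cderiveP[]. Qed.

Lemma has_cderive_continuous (f : C -> C) z l :
  has_cderive f z l -> {for z, continuous f}.
Proof.
move=> H; apply/continuous_complexP => e e0.
have [dl dl0 dlH] := H _ ltr01.
have K0 : 0 < normc l + 2 by rewrite ltr_wpDl ?normc_ge0.
exists (Num.min dl (e / (normc l + 2))).
  by rewrite lt_min dl0 divr_gt0.
move=> w; rewrite lt_min => /andP[/dlH]; rewrite subrKC mul1r => wl we.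
have -> : f w - f z = (f w - f z - l * (w - z)) + l * (w - z) by rewrite subrK.
have n0 := normc_ge0 (w - z).
apply: le_lt_trans (le_normcD _ _) _; rewrite normcM.
apply: (@le_lt_trans _ _ ((normc l + 1) * normc (w - z))).
  by rewrite mulrDl mul1r addrC lerD.
apply: (@le_lt_trans _ _ ((normc l + 2) * normc (w - z))).
  by rewrite ler_wpM2r // lerD2l ler1n.
by rewrite mulrC -ltr_pdivlMr.
Qed.

Lemma eq_has_cderive (f g : C -> C) z l :
  (\forall w \near z, f w = g w) -> has_cderive f z l -> has_cderive g z l.
Proof.
move=> /nbhs_complexP[e1 e10 fg] H e e0; have [dl dl0 dlH] := H _ e0.
exists (Num.min dl e1); first by rewrite lt_min dl0.
move=> h; rewrite lt_min => /andP[hd he].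
rewrite -fg; last by rewrite opprD addrA subrr sub0r normcN.
by rewrite -fg ?subrr ?normc0 //; exact: dlH.
Qed.

End complex_plane.

(** * Integrals of continuous functions over intervals *)

Section real_integral.
Variable R : realType.
Notation mu := (@lebesgue_measure R).
Implicit Types f g : R -> R.

Definition continuous_on_itv (T : topologicalType) (a b : R) (g : R -> T) :=
  forall t, a <= t <= b -> {for t, continuous g}.

Lemma continuous_on_itv_integrable a b f :
  continuous_on_itv a b f -> mu.-integrable `[a, b] (EFin \o f).
Proof.
move=> cf; apply: continuous_compact_integrable; first exact: segment_compact.
by apply: continuous_in_subspaceT => x; rewrite inE /= in_itv /=; exact: cf.
Qed.

Lemma Rintegral_itv_cst a b c : a <= b -> \int[mu]_(x in `[a, b]) c = c * (b - a).
Proof.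
move=> ab; rewrite Rintegral_cst //= lebesgue_measure_itv /= lte_fin.
by move: ab; rewrite le_eqVlt => /predU1P[->|->//]; rewrite ltxx subrr.
Qed.

Lemma Rintegral_itv_split a b c f : a <= b <= c -> continuous_on_itv a c f ->
  \int[mu]_(x in `[a, c]) f x = \int[mu]_(x in `[a, b]) f x + \int[mu]_(x in `[b, c]) f x.
Proof.
move=> /andP[ab bc] cf; apply/eqP; rewrite addrC -subr_eq; apply/eqP.
rewrite Rintegral_itvB ?bnd_simp //; last exact: continuous_on_itv_integrable.
apply: Rintegral_itv_obnd_cbnd.
apply: (integrableS _ _ _ (continuous_on_itv_integrable cf)) => //.
by apply: subset_itv; rewrite bnd_simp.
Qed.

Lemma Rintegral_itv_le a b f g : continuous_on_itv a b f -> continuous_on_itv a b g ->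
  (forall t, a <= t <= b -> f t <= g t) ->
  \int[mu]_(x in `[a, b]) f x <= \int[mu]_(x in `[a, b]) g x.
Proof.
move=> cf cg fg; apply: le_Rintegral => //; try exact: continuous_on_itv_integrable.
Qed.

Lemma Rintegral_itv_bound a b f M : a <= b -> continuous_on_itv a b f ->
  (forall t, a <= t <= b -> `|f t| <= M) ->
  `|\int[mu]_(x in `[a, b]) f x| <= M * (b - a).
Proof.
move=> ab cf fM; apply: le_trans (le_normr_Rintegral _ _) _ => //.
  exact: continuous_on_itv_integrable.
rewrite -Rintegral_itv_cst //; apply: Rintegral_itv_le => //.
  by move=> t /cf ct; apply: continuous_comp ct _; exact: norm_continuous.
by move=> t _; exact: cvg_cst.
Qed.

End real_integral.

Section complex_integral.
Variable R : realType.
Notation C := (Cplx R).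
Local Notation Re := (@complex.Re R).
Local Notation Im := (@complex.Im R).
Notation mu := (@lebesgue_measure R).
Implicit Types g : R -> C.

Definition cintegral (g : R -> C) (a b : R) : C :=
  Complex (\int[mu]_(t in `[a, b]) Re (g t))
          (\int[mu]_(t in `[a, b]) Im (g t)).

Lemma continuous_Re_comp (T : topologicalType) (g : T -> C) t :
  {for t, continuous g} -> {for t, continuous (fun s => Re (g s))}.
Proof. by move=> ct; exact: (continuous_comp ct (@Re_continuous R _)). Qed.

Lemma continuous_Im_comp (T : topologicalType) (g : T -> C) t :
  {for t, continuous g} -> {for t, continuous (fun s => Im (g s))}.
Proof. by move=> ct; exact: (continuous_comp ct (@Im_continuous R _)). Qed.

Lemma continuous_Complex (T : topologicalType) (f g : T -> R) t :
  {for t, continuous f} -> {for t, continuous g} ->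
  {for t, continuous (fun s => Complex (f s) (g s) : C)}.
Proof.
move=> cf cg; apply: (@continuous_comp _ _ _ (fun s => (f s, g s)) (@to_complex R)).
  exact: (cvg_pair cf cg).
exact: to_complex_continuous.
Qed.

Lemma integrable_Re g a b : continuous_on_itv a b g ->
  mu.-integrable `[a, b] (EFin \o (fun t => Re (g t))).
Proof.
by move=> cg; apply: continuous_on_itv_integrable => t /cg; exact: continuous_Re_comp.
Qed.

Lemma integrable_Im g a b : continuous_on_itv a b g ->
  mu.-integrable `[a, b] (EFin \o (fun t => Im (g t))).
Proof.
by move=> cg; apply: continuous_on_itv_integrable => t /cg; exact: continuous_Im_comp.
Qed.

Lemma cintegralD g1 g2 a b : continuous_on_itv a b g1 -> continuous_on_itv a b g2 ->
  cintegral (fun t => g1 t + g2 t) a b = cintegral g1 a b + cintegral g2 a b.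
Proof.
move=> c1 c2; rewrite /cintegral [RHS]/GRing.add /=.
rewrite -(RintegralD _ (integrable_Re c1) (integrable_Re c2)) //.
rewrite -(RintegralD _ (integrable_Im c1) (integrable_Im c2)) //.
by congr Complex; apply: eq_Rintegral => t _; case: (g1 t) (g2 t) => [? ?] [? ?].
Qed.

Lemma cintegralZ (k : C) g a b : continuous_on_itv a b g ->
  cintegral (fun t => k * g t) a b = k * cintegral g a b.
Proof.
move=> cg; case: k => u v; rewrite /cintegral.
have iR := continuous_on_itv_integrable (fun t tab => continuous_Re_comp (cg t tab)).
have iI := continuous_on_itv_integrable (fun t tab => continuous_Im_comp (cg t tab)).
rewrite [RHS]/GRing.mul /= -!RintegralZl //.
have iZ (f : R -> R) (c : R) : continuous_on_itv a b f ->
    mu.-integrable `[a, b] (EFin \o (fun t => c * f t)).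
  move=> cf; apply: continuous_on_itv_integrable => t /cf ct.
  by apply: cvgM; [exact: cvg_cst|exact: ct].
rewrite -RintegralB // -?RintegralD //; try (apply: iZ => t tab; first [apply: continuous_Re_comp | apply: continuous_Im_comp]; exact: cg).
by congr Complex; apply: eq_Rintegral => t _; case: (g t).
Qed.

Lemma cintegral_split g a b c : a <= b <= c -> continuous_on_itv a c g ->
  cintegral g a c = cintegral g a b + cintegral g b c.
Proof.
move=> abc cg; rewrite /cintegral [RHS]/GRing.add /=.
congr Complex; apply: Rintegral_itv_split => // t tac.
  by apply: continuous_Re_comp; exact: cg.
by apply: continuous_Im_comp; exact: cg.
Qed.

Lemma cintegral_cst (k : C) a b : a <= b -> cintegral (fun=> k) a b = k * ((b - a)%:C)%C.
Proof.
move=> ab; rewrite /cintegral !Rintegral_itv_cst //.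
by case: k => u v; rewrite [RHS]/GRing.mul /= !mulr0 subr0 add0r.
Qed.

Lemma eq_cintegral g1 g2 a b : (forall t, a <= t <= b -> g1 t = g2 t) ->
  cintegral g1 a b = cintegral g2 a b.
Proof.
move=> g12; congr Complex; apply: eq_Rintegral => t;
  by rewrite inE /= in_itv /= => /g12 ->.
Qed.

(** The factor 2 comes from estimating the real and imaginary parts separately. *)
Lemma cintegral_bound g a b M : a <= b -> continuous_on_itv a b g ->
  (forall t, a <= t <= b -> normc (g t) <= M) ->
  normc (cintegral g a b) <= 2 * M * (b - a).
Proof.
move=> ab cg gM; apply: le_trans (normc_le _) _ => /=.
rewrite -mulrA mulr_natl mulr2n lerD //; apply: Rintegral_itv_bound => // t tab.
- by apply: continuous_Re_comp; exact: cg.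
- exact: le_trans (le_Re_normc _) (gM _ tab).
- by apply: continuous_Im_comp; exact: cg.
- exact: le_trans (le_Im_normc _) (gM _ tab).
Qed.

End complex_integral.

(** * A bisection principle for rectangles *)

Section bisection.
Variable R : realType.

(** If [P] failed for the whole rectangle, it would fail for one quarter, then for a quarter of
    that, and so on; these rectangles shrink to a point, where the local hypothesis gives a
    contradiction. [P] takes the lower left corner and the two side lengths. *)
Lemma rectangle_bisection (P : R -> R -> R -> R -> Prop) (x0 y0 w0 h0 : R) :
  0 <= w0 -> 0 <= h0 ->
  (forall x y w h, 0 <= w -> 0 <= h ->
    P x y (w / 2) (h / 2) -> P (x + w / 2) y (w / 2) (h / 2) ->
    P x (y + h / 2) (w / 2) (h / 2) -> P (x + w / 2) (y + h / 2) (w / 2) (h / 2) ->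
    P x y w h) ->
  (forall u v, x0 <= u <= x0 + w0 -> y0 <= v <= y0 + h0 -> exists2 dl, 0 < dl &
    forall x y w h, 0 <= w < dl -> 0 <= h < dl ->
      x <= u <= x + w -> y <= v <= y + h -> P x y w h) ->
  P x0 y0 w0 h0.
Proof.
move=> w0_ge0 h0_ge0 Phalf Ploc; apply: contrapT => nP.
pose W n := w0 / 2 ^+ n; pose H n := h0 / 2 ^+ n.
have WS n : W n.+1 = W n / 2 by rewrite /W exprSr invfM mulrA.
have HS n : H n.+1 = H n / 2 by rewrite /H exprSr invfM mulrA.
have W_ge0 n : 0 <= W n by rewrite divr_ge0 ?exprn_ge0.
have H_ge0 n : 0 <= H n by rewrite divr_ge0 ?exprn_ge0.
pose bad n (p : R * R) := ~ P p.1 p.2 (W n) (H n).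
(* The implication stands inside the existential so that [choice] yields a function defined on all
   pairs. *)
have step (np : nat * (R * R)) : exists p', bad np.1 np.2 ->
    [/\ bad np.1.+1 p', np.2.1 <= p'.1 <= np.2.1 + W np.1.+1
      & np.2.2 <= p'.2 <= np.2.2 + H np.1.+1].
  case: np => n [x y]; have [b|nb] := pselect (bad n (x, y)); last by exists (x, y).
  apply: contrapT => /forallNP no; apply: b => /=.
  have W1 := W_ge0 n.+1; have H1 := H_ge0 n.+1.
  have good x' y' : x <= x' <= x + W n.+1 -> y <= y' <= y + H n.+1 ->
      P x' y' (W n / 2) (H n / 2).
    by move=> xx' yy'; apply: contrapT => nP'; apply: (no (x', y')) => _;
      split => //; rewrite /bad /= WS HS.
  by apply: Phalf => //; apply: good; rewrite -?WS -?HS; lra.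
have [F HF] := choice step.
pose s := fix s n := if n is n'.+1 then F (n', s n') else (x0, y0).
have sbad n : bad n (s n).
  elim: n => [|n IH]; first by rewrite /bad /= /W /H expr0 !divr1.
  by have [] := HF (n, s n) IH.
have sx n : (s n).1 <= (s n.+1).1 <= (s n).1 + W n.+1 by have [] := HF (n, s n) (sbad n).
have sy n : (s n).2 <= (s n.+1).2 <= (s n).2 + H n.+1 by have [] := HF (n, s n) (sbad n).
(* Nested intervals in one coordinate: the supremum of the left ends lies in all of them. *)
have lim (a W' : nat -> R) : (forall n, W' n.+1 = W' n / 2) -> (forall n, 0 <= W' n) ->
    (forall n, a n <= a n.+1 <= a n + W' n.+1) ->
    exists u, forall n, a n <= u <= a n + W' n.
  move=> WS' W'0 Ha.
  have mono m n : a n <= a (n + m)%N <= a n + W' n - W' (n + m)%N.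
    elim: m => [|m /andP[IH1 IH2]]; first by rewrite addn0; lra.
    rewrite addnS; have /andP[h1 h2] := Ha (n + m)%N.
    by rewrite (le_trans IH1) //=; have := WS' (n + m)%N; lra.
  have ub n : ubound (range a) (a n + W' n).
    move=> _ [m _ <-]; have [mn|/ltnW nm] := leqP m n.
      by have /andP[+ _] := mono (n - m)%N m; rewrite subnKC // => /le_trans; apply; rewrite lerDl.
    have /andP[_] := mono (m - n)%N n; rewrite subnKC // => /le_trans; apply.
    by have := W'0 m; lra.
  have hs : has_sup (range a) by split; [exists (a 0%N), 0%N|exists (a 0%N + W' 0%N)].
  exists (sup (range a)) => n; apply/andP; split.
    by apply: ub_le_sup; [case: hs|exists n].
  by apply: ge_sup; [case: hs|exact: ub].
have [u Hu] := lim (fun n => (s n).1) W WS W_ge0 sx.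
have [v Hv] := lim (fun n => (s n).2) H HS H_ge0 sy.
have [dl dl0 Hdl] : exists2 dl, 0 < dl &
    forall x y w h, 0 <= w < dl -> 0 <= h < dl ->
      x <= u <= x + w -> y <= v <= y + h -> P x y w h.
  by apply: Ploc; [have := Hu 0%N|have := Hv 0%N]; rewrite /W /H /= expr0 divr1.
have [n] : exists n, W n < dl /\ H n < dl.
  have : 2^-1 ^+ n @[n --> \oo] --> (0 : R).
    by apply: cvg_expr; rewrite ger0_norm ?invr_ge0 // invf_lt1 // ltr1n.
  have e0 : 0 < dl / (w0 + h0 + 1) by rewrite divr_gt0 // ltr_wpDl // addr_ge0.
  move=> /cvgrPdist_lt/(_ _ e0)[n _ /(_ n (leqnn n))].
  rewrite /= sub0r normrN exprVn ger0_norm ?invr_ge0 ?exprn_ge0 // => hn.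
  exists n; rewrite /W /H.
  have q0 : 0 < (2 ^+ n)^-1 :> R by rewrite invr_gt0 exprn_gt0.
  move: hn; rewrite ltr_pdivlMr ?ltr_wpDl ?addr_ge0 // => hn.
  split; apply: le_lt_trans hn; rewrite mulrC ler_pM2l //; lra.
move=> [Wn Hn]; apply: (sbad n); apply: Hdl; rewrite ?W_ge0 ?H_ge0 //.
Qed.

End bisection.

(** * Cauchy's theorem on rectangles *)

Section contour.
Variable R : realType.
Notation C := (Cplx R).
Local Notation Re := (@complex.Re R).
Local Notation Im := (@complex.Im R).
Implicit Types f g : C -> C.

Definition rectangle (x0 x1 y0 y1 : R) : set C :=
  [set z | x0 <= Re z <= x1 /\ y0 <= Im z <= y1].

Definition rectangle_boundary (x0 x1 y0 y1 : R) : set C :=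
  [set z | rectangle x0 x1 y0 y1 z /\
     ((Re z = x0 \/ Re z = x1) \/ (Im z = y0 \/ Im z = y1))].

(** The counterclockwise integral of [f(z) dz]: bottom, right, top and left, with [dz = i dt] on the
    vertical sides. *)
Definition contour f (x0 x1 y0 y1 : R) : C :=
  cintegral (fun t => f (Complex t y0)) x0 x1
  + Complex 0 1 * cintegral (fun t => f (Complex x1 t)) y0 y1
  - cintegral (fun t => f (Complex t y1)) x0 x1
  - Complex 0 1 * cintegral (fun t => f (Complex x0 t)) y0 y1.

Definition continuous_on (A : set C) f := forall z, A z -> {for z, continuous f}.

Lemma continuous_horizontal (A : set C) f y a b : continuous_on A f ->
  (forall t, a <= t <= b -> A (Complex t y)) ->
  continuous_on_itv a b (fun t => f (Complex t y)).
Proof.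
move=> cf AH t /AH /cf ct.
have h : {for t, continuous (fun t => Complex t y : C)}.
  by apply: continuous_Complex; [exact: cvg_id|exact: cvg_cst].
exact: (continuous_comp h ct).
Qed.

Lemma continuous_vertical (A : set C) f x a b : continuous_on A f ->
  (forall t, a <= t <= b -> A (Complex x t)) ->
  continuous_on_itv a b (fun t => f (Complex x t)).
Proof.
move=> cf AH t /AH /cf ct.
have h : {for t, continuous (fun t => Complex x t : C)}.
  by apply: continuous_Complex; [exact: cvg_cst|exact: cvg_id].
exact: (continuous_comp h ct).
Qed.

Lemma continuous_onS (A B : set C) f : A `<=` B -> continuous_on B f -> continuous_on A f.
Proof. by move=> AB cf z /AB /cf. Qed.

Lemma subset_rectangle (x0 x1 y0 y1 a0 a1 b0 b1 : R) :
  x0 <= a0 -> a1 <= x1 -> y0 <= b0 -> b1 <= y1 ->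
  rectangle a0 a1 b0 b1 `<=` rectangle x0 x1 y0 y1.
Proof. by move=> *; rewrite /rectangle => z /= [? ?]; split; lra. Qed.

Lemma continuous_on_boundary (x0 x1 y0 y1 : R) f :
  continuous_on (rectangle x0 x1 y0 y1) f -> continuous_on (rectangle_boundary x0 x1 y0 y1) f.
Proof. by apply: continuous_onS => z []. Qed.

Section contour_rectangle.
Variables (x0 x1 y0 y1 : R).
Hypotheses (x01 : x0 <= x1) (y01 : y0 <= y1).
Let Q := rectangle_boundary x0 x1 y0 y1.

Let Qhor y t : y = y0 \/ y = y1 -> x0 <= t <= x1 -> Q (Complex t y).
Proof. by move=> yy tt; split; [split => //=; case: yy => ->; rewrite ?lexx ?y01|right]. Qed.

Let Qver x t : x = x0 \/ x = x1 -> y0 <= t <= y1 -> Q (Complex x t).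
Proof. by move=> xx tt; split; [split => //=; case: xx => ->; rewrite ?lexx ?x01|left]. Qed.

Let hor f y : continuous_on Q f -> y = y0 \/ y = y1 ->
  continuous_on_itv x0 x1 (fun t => f (Complex t y)).
Proof. by move=> cf yy; apply: continuous_horizontal cf _ => t; exact: Qhor. Qed.

Let ver f x : continuous_on Q f -> x = x0 \/ x = x1 ->
  continuous_on_itv y0 y1 (fun t => f (Complex x t)).
Proof. by move=> cf xx; apply: continuous_vertical cf _ => t; exact: Qver. Qed.

Let bx0 : x0 = x0 \/ x0 = x1. Proof. by left. Qed.
Let bx1 : x1 = x0 \/ x1 = x1. Proof. by right. Qed.
Let by0 : y0 = y0 \/ y0 = y1. Proof. by left. Qed.
Let by1 : y1 = y0 \/ y1 = y1. Proof. by right. Qed.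

Lemma eq_contour f g : (forall z, Q z -> f z = g z) ->
  contour f x0 x1 y0 y1 = contour g x0 x1 y0 y1.
Proof.
move=> fg; rewrite /contour.
rewrite (eq_cintegral (fun t tt => fg _ (Qhor by0 tt))).
rewrite (eq_cintegral (fun t tt => fg _ (Qhor by1 tt))).
rewrite (eq_cintegral (fun t tt => fg _ (Qver bx0 tt))).
by rewrite (eq_cintegral (fun t tt => fg _ (Qver bx1 tt))).
Qed.

Lemma contourD f g : continuous_on Q f -> continuous_on Q g ->
  contour (fun z => f z + g z) x0 x1 y0 y1 = contour f x0 x1 y0 y1 + contour g x0 x1 y0 y1.
Proof.
move=> cf cg; rewrite /contour !cintegralD; try (apply: hor; tauto); try (apply: ver; tauto).
do 8 (set a := cintegral _ _ _; move: a => [? ?]).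
by apply/eqP; rewrite eq_complex /=; apply/andP; split; apply/eqP; ring.
Qed.

Lemma contourZ k f : continuous_on Q f ->
  contour (fun z => k * f z) x0 x1 y0 y1 = k * contour f x0 x1 y0 y1.
Proof.
move=> cf; rewrite /contour !cintegralZ; try (apply: hor; tauto); try (apply: ver; tauto).
by rewrite !mulrBr mulrDr !(mulrCA _ k).
Qed.

Lemma contour_bound f M : continuous_on Q f -> (forall z, Q z -> normc (f z) <= M) ->
  normc (contour f x0 x1 y0 y1) <= 4 * M * ((x1 - x0) + (y1 - y0)).
Proof.
move=> cf fM.
have h y : y = y0 \/ y = y1 -> normc (cintegral (fun t => f (Complex t y)) x0 x1) <= 2 * M * (x1 - x0).
  by move=> yy; apply: cintegral_bound => //; [exact: hor|move=> t tt; apply: fM; exact: Qhor].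
have v x : x = x0 \/ x = x1 -> normc (cintegral (fun t => f (Complex x t)) y0 y1) <= 2 * M * (y1 - y0).
  by move=> yy; apply: cintegral_bound => //; [exact: ver|move=> t tt; apply: fM; exact: Qver].
have ni : normc (Complex 0 1 : C) = 1 by rewrite /normc expr0n add0r expr1n sqrtr1.
move: (h _ by0) (h _ by1) (v _ bx0) (v _ bx1); rewrite /contour.
set a := cintegral (fun t => f (Complex t y0)) _ _; set b := cintegral (fun t => f (Complex t y1)) _ _.
set c := cintegral (fun t => f (Complex x0 t)) _ _; set e := cintegral (fun t => f (Complex x1 t)) _ _.
have := le_normcD (a + Complex 0 1 * e - b) (- (Complex 0 1 * c)).
have := le_normcD (a + Complex 0 1 * e) (- b).
have := le_normcD a (Complex 0 1 * e).
rewrite !normcN !normcM ni !mul1r; lra.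
Qed.

Lemma contour_cst k : contour (fun=> k) x0 x1 y0 y1 = 0.
Proof. by rewrite /contour [X in X - _]addrAC subrr add0r subrr. Qed.

Lemma contour_id : contour id x0 x1 y0 y1 = 0.
Proof.
have cid : continuous_on Q id by move=> z _; exact: cvg_id.
rewrite /contour.
have -> : cintegral (fun t => id (Complex t y1)) x0 x1
    = cintegral (fun t => id (Complex t y0)) x0 x1 + Complex 0 (y1 - y0) * ((x1 - x0)%:C)%C.
  rewrite -cintegral_cst // -cintegralD //; first last.
  - by move=> t _; exact: cvg_cst.
  - exact: (hor cid by0).
  by apply: eq_cintegral => t _; rewrite [RHS]/GRing.add /= addr0 addrC subrK.
have -> : cintegral (fun t => id (Complex x1 t)) y0 y1
    = cintegral (fun t => id (Complex x0 t)) y0 y1 + Complex (x1 - x0) 0 * ((y1 - y0)%:C)%C.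
  rewrite -cintegral_cst // -cintegralD //; first last.
  - by move=> t _; exact: cvg_cst.
  - exact: (ver cid bx0).
  by apply: eq_cintegral => t _; rewrite [RHS]/GRing.add /= addr0 addrC subrK.
set a := cintegral _ _ _; set b := cintegral _ _ _.
case: a b => [a1 a2] [b1 b2].
by apply/eqP; rewrite eq_complex /=; apply/andP; split; apply/eqP; ring.
Qed.

Lemma contour_split_x f x : x0 <= x <= x1 -> continuous_on Q f ->
  contour f x0 x1 y0 y1 = contour f x0 x y0 y1 + contour f x x1 y0 y1.
Proof.
move=> xx cf; rewrite /contour.
rewrite (cintegral_split xx (hor cf by0)) (cintegral_split xx (hor cf by1)).
set a := cintegral _ _ _; set b := cintegral _ _ _; set c := cintegral _ _ _.
set e := cintegral _ _ _; set g := cintegral _ _ _; set h := cintegral _ _ _; set k := cintegral _ _ _.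
by move: a b c e g h k => [? ?] [? ?] [? ?] [? ?] [? ?] [? ?] [? ?];
  apply/eqP; rewrite eq_complex /=; apply/andP; split; apply/eqP; ring.
Qed.

Lemma contour_split_y f y : y0 <= y <= y1 -> continuous_on Q f ->
  contour f x0 x1 y0 y1 = contour f x0 x1 y0 y + contour f x0 x1 y y1.
Proof.
move=> yy cf; rewrite /contour.
rewrite (cintegral_split yy (ver cf bx0)) (cintegral_split yy (ver cf bx1)).
set a := cintegral _ _ _; set b := cintegral _ _ _; set c := cintegral _ _ _.
set e := cintegral _ _ _; set g := cintegral _ _ _; set h := cintegral _ _ _; set k := cintegral _ _ _.
by move: a b c e g h k => [? ?] [? ?] [? ?] [? ?] [? ?] [? ?] [? ?];
  apply/eqP; rewrite eq_complex /=; apply/andP; split; apply/eqP; ring.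
Qed.

End contour_rectangle.
End contour.

Section goursat.
Variable R : realType.
Notation C := (Cplx R).
Local Notation Re := (@complex.Re R).
Local Notation Im := (@complex.Im R).
Implicit Types f g : C -> C.

Lemma continuous_onD (A : set C) f g : continuous_on A f -> continuous_on A g ->
  continuous_on A (fun z => f z + g z).
Proof. by move=> cf cg z Az; exact: (cvgD (cf _ Az) (cg _ Az)). Qed.

Lemma continuous_onM (A : set C) f g : continuous_on A f -> continuous_on A g ->
  continuous_on A (fun z => f z * g z).
Proof.
by move=> cf cg z Az; exact: (@cvgM (complex R) C (nbhs z) _ f g _ _ (cf _ Az) (cg _ Az)).
Qed.

Lemma continuous_on_cst (A : set C) (k : C) : continuous_on A (fun=> k).
Proof. by move=> z _; exact: (@cst_continuous C C k z). Qed.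

Lemma continuous_on_id (A : set C) : continuous_on A id.
Proof. by move=> z _; exact: cvg_id. Qed.

Lemma normc_rectangle (x x1 y y1 : R) (z w : C) :
  rectangle x x1 y y1 z -> rectangle x x1 y y1 w ->
  normc (z - w) <= (x1 - x) + (y1 - y).
Proof.
move=> zQ wQ; apply: le_trans (normc_le _) _.
case: z w zQ wQ => [a b] [c d] [/= ax ay] [/= cx cy].
by apply: lerD; rewrite ler_norml; lra.
Qed.

(** The bound [e * (w + h) ^+ 2] passes from the quarters to the whole, since each quarter has a
    quarter of it. Near a point it holds because [f] differs there from an affine function, whose
    contour vanishes, by little compared with [w + h]. *)
Lemma goursat f x0 x1 y0 y1 : x0 <= x1 -> y0 <= y1 ->
  (forall z, rectangle x0 x1 y0 y1 z -> derivable f z 1) ->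
  contour f x0 x1 y0 y1 = 0.
Proof.
move=> x01 y01 df.
have cf : continuous_on (rectangle x0 x1 y0 y1) f.
  by move=> z /df /derivable_has_cderive; exact: has_cderive_continuous.
set L := (x1 - x0) + (y1 - y0).
suff key e : 0 < e -> normc (contour f x0 x1 y0 y1) <= e * L ^+ 2.
  apply: eq0_normc; apply/eqP; rewrite eq_le normc_ge0 andbT.
  apply/ler_addgt0Pl => e e0; rewrite addr0.
  have L0 : 0 < L ^+ 2 + 1 by rewrite ltr_wpDl ?sqr_ge0.
  apply: le_trans (key _ (divr_gt0 e0 L0)) _.
  by rewrite mulrAC ler_pdivrMr // ler_pM2l // lerDl.
move=> e0.
pose P x y w h := rectangle x (x + w) y (y + h) `<=` rectangle x0 x1 y0 y1 ->
  normc (contour f x (x + w) y (y + h)) <= e * (w + h) ^+ 2.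
suff : P x0 y0 (x1 - x0) (y1 - y0) by rewrite /P !subrKC; exact.
apply: rectangle_bisection; rewrite ?subr_ge0 //.
  move=> x y w h w_ge0 h_ge0 P1 P2 P3 P4 sub.
  have cf' := continuous_onS sub cf.
  rewrite (@contour_split_x _ x (x + w) y (y + h) _ f (x + w / 2)) //; try lra; try exact: continuous_on_boundary.
  have c1 : continuous_on (rectangle x (x + w / 2) y (y + h)) f.
    by apply: continuous_onS cf'; apply: subset_rectangle; lra.
  have c2 : continuous_on (rectangle (x + w / 2) (x + w) y (y + h)) f.
    by apply: continuous_onS cf'; apply: subset_rectangle; lra.
  rewrite (@contour_split_y _ x _ y (y + h) _ f (y + h / 2)) //; try lra; try exact: continuous_on_boundary.
  rewrite (@contour_split_y _ (x + w / 2) _ y (y + h) _ f (y + h / 2)) //; try lra; try exact: continuous_on_boundary.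
  have ew : x + w = x + w / 2 + w / 2 by lra.
  have eh : y + h = y + h / 2 + h / 2 by lra.
  have s1 : rectangle x (x + w / 2) y (y + h / 2) `<=` rectangle x0 x1 y0 y1.
    by apply: subset_trans sub; apply: subset_rectangle; lra.
  have s2 : rectangle (x + w / 2) (x + w / 2 + w / 2) y (y + h / 2) `<=` rectangle x0 x1 y0 y1.
    by apply: subset_trans sub; apply: subset_rectangle; lra.
  have s3 : rectangle x (x + w / 2) (y + h / 2) (y + h / 2 + h / 2) `<=` rectangle x0 x1 y0 y1.
    by apply: subset_trans sub; apply: subset_rectangle; lra.
  have s4 : rectangle (x + w / 2) (x + w / 2 + w / 2) (y + h / 2) (y + h / 2 + h / 2) `<=` rectangle x0 x1 y0 y1.
    by apply: subset_trans sub; apply: subset_rectangle; lra.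
  move: (P1 s1) (P2 s2) (P3 s3) (P4 s4); rewrite -ew -eh.
  set c11 := contour f x (x + w / 2) y (y + h / 2).
  set c21 := contour f (x + w / 2) (x + w) y (y + h / 2).
  set c12 := contour f x (x + w / 2) (y + h / 2) (y + h).
  set c22 := contour f (x + w / 2) (x + w) (y + h / 2) (y + h).
  have -> : w / 2 + h / 2 = (w + h) / 2 by lra.
  rewrite expr_div_n => H1 H2 H3 H4.
  have := le_normcD (c11 + c12) (c21 + c22).
  have := le_normcD c11 c12; have := le_normcD c21 c22; lra.
move=> u v; rewrite !subrKC => uu vv.
have Qz : rectangle x0 x1 y0 y1 (Complex u v) by [].
have /derivable_has_cderive := df _ Qz; set l := 'D_1 f _ => Df.
(* The divisor 4 offsets the factor 4 of [contour_bound]. *)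
have e4 : 0 < e / 4 by lra.
have [dl dl0 Hdl] := Df _ e4.
exists (dl / 2); first lra.
move=> x y w h /andP[w_ge0 wdl] /andP[h_ge0 hdl] xu yv sub.
have xw : x <= x + w by lra.
have yh : y <= y + h by lra.
have cf' := continuous_onS sub cf.
pose z0 : C := Complex u v.
pose r z := f z + ((l * z0 - f z0) + (- l) * z).
have c1 : continuous_on (rectangle x (x + w) y (y + h)) (fun=> l * z0 - f z0).
  exact: continuous_on_cst.
have c2 : continuous_on (rectangle x (x + w) y (y + h)) (fun z => (- l) * z).
  by apply: continuous_onM; [exact: continuous_on_cst|exact: continuous_on_id].
have c3 := continuous_onD c1 c2.
have cr : continuous_on (rectangle x (x + w) y (y + h)) r := continuous_onD cf' c3.
have -> : contour f x (x + w) y (y + h) = contour r x (x + w) y (y + h).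
  have E1 := contourD xw yh (continuous_on_boundary cf') (continuous_on_boundary c3).
  have E2 := contourD xw yh (continuous_on_boundary c1) (continuous_on_boundary c2).
  have E3 := contourZ xw yh (- l) (continuous_on_boundary (@continuous_on_id (rectangle x (x + w) y (y + h)))).
  by rewrite /r E1 E2 E3 contour_cst contour_id // mulr0 !addr0.
apply: le_trans (contour_bound (M := e / 4 * (w + h)) xw yh (continuous_on_boundary cr) _) _; last first.
  by rewrite [x + w]addrC [y + h]addrC !addrK; lra.
have Qz0 : rectangle x (x + w) y (y + h) z0 by [].
move=> z [Qz' _]; have := normc_rectangle Qz' Qz0.
rewrite [x + w]addrC [y + h]addrC !addrK => nz.
have nzdl : normc (z - z0) < dl by lra.
have := Hdl _ nzdl; rewrite subrKC.
have -> : f z - f z0 - l * (z - z0) = r z by rewrite /r; ring.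
move=> /le_trans; apply.
by rewrite ler_pM2l.
Qed.

(* Only the subrectangle around the exceptional point contributes, and its
   contour has length O(dl). *)
Lemma goursat_exceptional f x0 x1 y0 y1 (a : C) :
  x0 < Re a < x1 -> y0 < Im a < y1 ->
  continuous_on (rectangle x0 x1 y0 y1) f ->
  (forall z, rectangle x0 x1 y0 y1 z -> z <> a -> derivable f z 1) ->
  contour f x0 x1 y0 y1 = 0.
Proof.
move: a => [u v] /= xu yv cf df.
have x01 : x0 <= x1 by lra.
have y01 : y0 <= y1 by lra.
have Qa : rectangle x0 x1 y0 y1 (Complex u v) by split => /=; lra.
have /continuous_complexP/(_ _ ltr01)[d1 d10 Hd1] := cf _ Qa.
set M := normc (f (Complex u v)) + 1.
have M0 : 0 < M by rewrite ltr_wpDl ?normc_ge0.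
apply: eq0_normc; apply/eqP; rewrite eq_le normc_ge0 andbT.
apply/ler_addgt0Pl => e e0; rewrite addr0.
(* In the square of side [2 * dl] two points differ by at most [4 * dl < d1], so [f] is bounded by
   [M], and the contour is at most [4 * M * (4 * dl) <= e]. *)
pose dl := Num.min (Num.min (Num.min (u - x0) (x1 - u)) (Num.min (v - y0) (y1 - v))) (Num.min (d1 / 5) (e / (16 * M))).
have dl0 : 0 < dl by rewrite /dl !lt_min !divr_gt0 ?mulr_gt0 //; lra.
have [dl1 dl2 dl3] : [/\ dl <= u - x0, dl <= x1 - u & dl <= v - y0].
  by rewrite /dl !ge_min !lexx ?orbT.
have [dl4 dl5 dl6] : [/\ dl <= y1 - v, dl <= d1 / 5 & dl <= e / (16 * M)].
  by rewrite /dl !ge_min !lexx ?orbT.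
have G a0 a1 b0 b1 : x0 <= a0 -> a0 <= a1 -> a1 <= x1 -> y0 <= b0 -> b0 <= b1 -> b1 <= y1 ->
    ~ rectangle a0 a1 b0 b1 (Complex u v) -> contour f a0 a1 b0 b1 = 0.
  move=> h1 h2 h3 h4 h5 h6 nQ; apply: goursat => // z Qz; apply: df.
    by apply: subset_rectangle Qz.
  by move=> za; apply: nQ; rewrite -za.
have csub a0 a1 b0 b1 : x0 <= a0 -> a1 <= x1 -> y0 <= b0 -> b1 <= y1 ->
    continuous_on (rectangle a0 a1 b0 b1) f.
  by move=> *; apply: continuous_onS cf; apply: subset_rectangle.
rewrite (@contour_split_x _ x0 x1 y0 y1 _ f (u - dl)) //; try lra; try exact: continuous_on_boundary.
rewrite (@contour_split_x _ (u - dl) x1 y0 y1 _ f (u + dl)) //; try lra; try (apply: continuous_on_boundary; apply: csub; lra).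
rewrite (@contour_split_y _ (u - dl) (u + dl) y0 y1 _ f (v - dl)) //; try lra; try (apply: continuous_on_boundary; apply: csub; lra).
rewrite (@contour_split_y _ (u - dl) (u + dl) (v - dl) y1 _ f (v + dl)) //; try lra; try (apply: continuous_on_boundary; apply: csub; lra).
rewrite (G x0 (u - dl)) //; try lra; last by rewrite /rectangle /=; lra.
rewrite (G (u + dl) x1) //; try lra; last by rewrite /rectangle /=; lra.
rewrite (G (u - dl) (u + dl) y0) //; try lra; last by rewrite /rectangle /=; lra.
rewrite (G (u - dl) (u + dl) (v + dl)) //; try lra; last by rewrite /rectangle /=; lra.
rewrite !add0r !addr0.
apply: le_trans (contour_bound (M := M) _ _ _ _) _; try lra.
- by apply: continuous_on_boundary; apply: csub; lra.
- move=> z [Qz _]; have Qa' : rectangle (u - dl) (u + dl) (v - dl) (v + dl) (Complex u v) by split => /=; lra.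
  have := normc_rectangle Qz Qa' => nz.
  have /Hd1 : normc (z - Complex u v) < d1 by lra.
  have := le_normcD (f z - f (Complex u v)) (f (Complex u v)); rewrite subrK /M; lra.
- move: dl6; rewrite ler_pdivlMr ?mulr_gt0 //; lra.
Qed.

End goursat.

Section cauchy.
Variable R : realType.
Notation C := (Cplx R).
Local Notation Re := (@complex.Re R).
Local Notation Im := (@complex.Im R).
Implicit Types f g : C -> C.

Lemma normc_real (x : R) : normc (x%:C)%C = `|x|.
Proof. by rewrite /normc /= expr0n addr0 sqrtr_sqr. Qed.

Lemma continuous_onV (A : set C) f : continuous_on A f -> (forall z, A z -> f z != 0) ->
  continuous_on A (fun z => (f z)^-1).
Proof.
by move=> cf f0 z Az; exact: (@cvgV (complex R) C (nbhs z) _ f _ (f0 _ Az) (cf _ Az)).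
Qed.

Lemma has_cderiveM f g z l k : has_cderive f z l -> has_cderive g z k ->
  has_cderive (fun w => f w * g w) z (f z * k + g z * l).
Proof.
move=> /has_cderiveP df /has_cderiveP dg; exact/has_cderiveP.
Qed.

Lemma has_cderiveV f z l : f z != 0 -> has_cderive f z l ->
  has_cderive (fun w => (f w)^-1) z (- (f z)^-2 * l).
Proof.
move=> f0 /has_cderiveP[df <-]; apply/has_cderiveP.
apply: DeriveDef; first exact: (@derivableV (complex R) C).
exact: (@deriveV (complex R) C).
Qed.

Lemma has_cderiveB f g z l k : has_cderive f z l -> has_cderive g z k ->
  has_cderive (fun w => f w - g w) z (l - k).
Proof.
move=> /has_cderiveP df /has_cderiveP dg; exact/has_cderiveP.
Qed.

Lemma has_cderive_cst (k z : C) : has_cderive (fun=> k) z 0.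
Proof. by move=> e e0; exists 1 => // h _; rewrite subrr mul0r subr0 normc0 mulr_ge0 ?normc_ge0 // ltW. Qed.

Lemma has_cderive_id (z : C) : @has_cderive R id z 1.
Proof.
move=> e e0; exists 1 => // h _.
by rewrite /= [z + h]addrC addrK mul1r subrr normc0 mulr_ge0 ?normc_ge0 // ltW.
Qed.

(** Differentiation under the integral sign: the remainder of the kernel is quadratic in [h],
    uniformly on the boundary. *)
Lemma contour_has_cderive (k k' : C -> C -> C) x0 x1 y0 y1 a (rho M : R) :
  x0 <= x1 -> y0 <= y1 -> 0 < rho ->
  (forall h, normc h < rho -> continuous_on (rectangle_boundary x0 x1 y0 y1) (fun z => k z (a + h))) ->
  continuous_on (rectangle_boundary x0 x1 y0 y1) (fun z => k' z a) ->
  (forall z h, rectangle_boundary x0 x1 y0 y1 z -> normc h < rho ->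
    normc (k z (a + h) - k z a - h * k' z a) <= M * normc h ^+ 2) ->
  has_cderive (fun a => contour (fun z => k z a) x0 x1 y0 y1) a
    (contour (fun z => k' z a) x0 x1 y0 y1).
Proof.
move=> x01 y01 rho0 ck ck' kM e e0.
set P := (x1 - x0) + (y1 - y0).
have P0 : 0 <= P by rewrite addr_ge0 // subr_ge0.
have [z Qz] : exists z, rectangle_boundary x0 x1 y0 y1 z.
  by exists (Complex x0 y0); split; [split => /=; rewrite lexx|left; left].
have M0 : 0 <= M.
  have rho2 : normc ((rho / 2)%:C)%C = rho / 2.
    by rewrite /normc /= expr0n addr0 sqrtr_sqr ger0_norm // divr_ge0 // ltW.
  have := kM z _ Qz; move=> /(_ ((rho / 2)%:C)%C); rewrite rho2 => /(_ _)/le_trans.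
  have hr : rho / 2 < rho by lra.
  have r2 : 0 < (rho / 2) ^+ 2 by rewrite exprn_gt0 // divr_gt0.
  by have := le_trans (normc_ge0 _) (kM z ((rho / 2)%:C)%C Qz _); rewrite rho2 => /(_ hr); rewrite pmulr_lge0.
have K0 : 0 < 4 * M * P + 1 by rewrite ltr_wpDl // mulr_ge0 // mulr_ge0.
exists (Num.min rho (e / (4 * M * P + 1))); first by rewrite lt_min rho0 divr_gt0.
move=> h; rewrite lt_min => /andP[hrho he].
have c0 : continuous_on (rectangle_boundary x0 x1 y0 y1) (fun z => k z a).
  by have := ck 0; rewrite addr0 normc0; apply.
have ch := ck h hrho.
pose r z := k z (a + h) + ((-1) * k z a + (- h) * k' z a).
have c1 : continuous_on (rectangle_boundary x0 x1 y0 y1) (fun z => (-1) * k z a).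
  exact: continuous_onM (@continuous_on_cst _ _ (-1)) c0.
have c2 : continuous_on (rectangle_boundary x0 x1 y0 y1) (fun z => (- h) * k' z a).
  exact: continuous_onM (@continuous_on_cst _ _ (- h)) ck'.
have c3 := continuous_onD c1 c2.
have cr := continuous_onD ch c3.
have -> : contour (fun z => k z (a + h)) x0 x1 y0 y1 - contour (fun z => k z a) x0 x1 y0 y1
     - contour (fun z => k' z a) x0 x1 y0 y1 * h = contour r x0 x1 y0 y1.
  rewrite [RHS](contourD x01 y01 ch c3) (contourD x01 y01 c1 c2).
  rewrite (@contourZ _ _ _ _ _ x01 y01 (-1) (fun z => k z a) c0).
  rewrite (@contourZ _ _ _ _ _ x01 y01 (- h) (fun z => k' z a) ck').
  by rewrite mulN1r mulNr addrA [h * _]mulrC.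
apply: le_trans (contour_bound (M := M * normc h ^+ 2) x01 y01 cr _) _.
  move=> w Qw; have := kM w h Qw hrho.
  by rewrite /r mulN1r mulNr addrA.
have nh := normc_ge0 h.
have {}he : normc h * (4 * M * P + 1) < e by rewrite -ltr_pdivlMr.
have : normc h * (normc h * (4 * M * P)) <= normc h * e.
  by rewrite ler_wpM2l //; move: he; rewrite mulrDr mulr1; lra.
by rewrite -/P expr2; lra.
Qed.

Section kernels.
Variables (x0 x1 y0 y1 rho G : R) (g : C -> C).
Hypotheses (x01 : x0 <= x1) (y01 : y0 <= y1) (rho0 : 0 < rho).
Let Q := rectangle_boundary x0 x1 y0 y1.
Hypotheses (cg : continuous_on Q g) (gG : forall z, Q z -> normc (g z) <= G).
(** The margin [2 * rho] keeps [a + h] at distance at least [rho] from the boundary as long as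
    [normc h < rho]. *)
Let inner (a : C) := rectangle (x0 + 2 * rho) (x1 - 2 * rho) (y0 + 2 * rho) (y1 - 2 * rho) a.
Let P := (x1 - x0) + (y1 - y0).

Let G0 : 0 <= G.
Proof.
have : Q (Complex x0 y0) by split; [split => /=; rewrite lexx|left; left].
by move=> /gG; exact: le_trans (normc_ge0 _).
Qed.

Let far z a h : Q z -> inner a -> normc h < rho -> rho <= normc (z - (a + h)).
Proof.
move=> [Qz bz] [ax ay] hr.
have := le_Re_normc h; have := le_Im_normc h.
have := le_Re_normc (z - (a + h)); have := le_Im_normc (z - (a + h)).
rewrite !(ReD, ImD, ReN, ImN) !ler_norml => /andP[n1 n2] /andP[n3 n4] /andP[n5 n6] /andP[n7 n8].
by case: Qz => Q1 Q2; move: bz => [[]|[]] bz; lra.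
Qed.

Let far0 z a h : Q z -> inner a -> normc h < rho -> z - (a + h) != 0.
Proof.
move=> Qz ia hr; apply/eqP => e; have := far Qz ia hr; rewrite e normc0.
by move=> /(lt_le_trans rho0); rewrite ltxx.
Qed.

Let near z a : Q z -> inner a -> normc (z - a) <= P.
Proof.
move=> [Qz _] [ax ay]; apply: normc_rectangle Qz _.
split; [move: ax|move: ay] => /andP[h1 h2]; apply/andP; split.
- by apply: le_trans h1; rewrite lerDl mulr_ge0 // ltW.
- by apply: le_trans h2 _; rewrite gerBl mulr_ge0 // ltW.
- by apply: le_trans h1; rewrite lerDl mulr_ge0 // ltW.
- by apply: le_trans h2 _; rewrite gerBl mulr_ge0 // ltW.
Qed.

Let c_inv a h : inner a -> normc h < rho -> continuous_on Q (fun z => (z - (a + h))^-1).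
Proof.
move=> ia hr; apply: continuous_onV; last by move=> z Qz; exact: far0.
by apply: continuous_onD; [exact: continuous_on_id|exact: continuous_on_cst].
Qed.

Let normc0_rho : normc (0 : C) < rho. Proof. by rewrite normc0. Qed.

Lemma cauchy_kernel1 a : inner a ->
  has_cderive (fun a => contour (fun z => g z * (z - a)^-1) x0 x1 y0 y1) a
    (contour (fun z => g z * ((z - a)^-1 * (z - a)^-1)) x0 x1 y0 y1).
Proof.
move=> ia.
apply: (@contour_has_cderive (fun z a => g z * (z - a)^-1)
  (fun z a => g z * ((z - a)^-1 * (z - a)^-1)) _ _ _ _ a rho (G * rho^-1 ^+ 3) x01 y01 rho0).
- by move=> h hr; exact: continuous_onM cg (c_inv ia hr).
- have := @c_inv a 0 ia normc0_rho; rewrite addr0 => ci.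
  exact: continuous_onM cg (continuous_onM ci ci).
move=> z h Qz hr.
have n1 := far0 Qz ia hr; have n0 := far0 Qz ia normc0_rho.
have f1 := far Qz ia hr; have f0 := far Qz ia normc0_rho.
rewrite addr0 in n0 f0.
have -> : g z * (z - (a + h))^-1 - g z * (z - a)^-1 - h * (g z * ((z - a)^-1 * (z - a)^-1))
    = g z * (h ^+ 2) * ((z - a)^-1 * (z - a)^-1 * (z - (a + h))^-1).
  by field; rewrite n0 n1.
rewrite normcM [normc (g z * _)]normcM mulrAC [normc (h ^+ 2)]normcM -expr2.
rewrite ler_wpM2r ?sqr_ge0 // ler_pM ?normc_ge0 //; first exact: gG.
rewrite !normcM !normcV !exprS expr0 mulr1 !mulrA.
by rewrite !ler_pM ?mulr_ge0 ?invr_ge0 ?normc_ge0 // lef_pV2 // posrE ?(lt_le_trans rho0).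
Qed.

(** Two derivatives of a Cauchy integral suffice: they make its first derivative differentiable, and
    higher derivatives follow by iteration. *)
Lemma cauchy_kernel2 a : inner a ->
  has_cderive (fun a => contour (fun z => g z * ((z - a)^-1 * (z - a)^-1)) x0 x1 y0 y1) a
    (contour (fun z => g z * (2 * (z - a)^-1 ^+ 3)) x0 x1 y0 y1).
Proof.
move=> ia.
apply: (@contour_has_cderive (fun z a => g z * ((z - a)^-1 * (z - a)^-1))
  (fun z a => g z * (2 * (z - a)^-1 ^+ 3)) _ _ _ _ a rho (G * ((3 * P + 2 * rho) * rho^-1 ^+ 5)) x01 y01 rho0).
- by move=> h hr; exact: continuous_onM cg (continuous_onM (c_inv ia hr) (c_inv ia hr)).
- have := @c_inv a 0 ia normc0_rho; rewrite addr0 => ci.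
  have -> : (fun z : C => g z * (2 * (z - a)^-1 ^+ 3)) =
      (fun z => g z * (2 * ((z - a)^-1 * ((z - a)^-1 * (z - a)^-1)))).
    by apply/funext => z; rewrite !exprS expr0 mulr1.
  exact: continuous_onM cg (continuous_onM (@continuous_on_cst _ _ 2) (continuous_onM ci (continuous_onM ci ci))).
move=> z h Qz hr.
have n1 := far0 Qz ia hr; have n0 := far0 Qz ia normc0_rho.
have f1 := far Qz ia hr; have f0 := far Qz ia normc0_rho.
rewrite addr0 in n0 f0.
have -> : g z * ((z - (a + h))^-1 * (z - (a + h))^-1) - g z * ((z - a)^-1 * (z - a)^-1)
       - h * (g z * (2 * (z - a)^-1 ^+ 3))
    = g z * ((3 * (z - a) - 2 * h) * ((z - a)^-1 * (z - a)^-1 * (z - a)^-1 * (z - (a + h))^-1 * (z - (a + h))^-1)) * (h ^+ 2).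
  by field; rewrite n0 n1.
have P0 : 0 <= P by rewrite addr_ge0 // subr_ge0.
rewrite normcM [X in X <= _]mulrC [X in _ <= X]mulrC.
rewrite [normc (h ^+ 2)]normcM -expr2 ler_wpM2l ?sqr_ge0 //.
rewrite normcM ler_pM ?normc_ge0 //; first exact: gG.
rewrite normcM ler_pM ?normc_ge0 //.
  apply: le_trans (le_normcD _ _) _; rewrite normcN !normcM.
  have -> : normc (3 : C) = 3.
    by rewrite -[3%:R : C](rmorph_nat (real_complex R) 3) normc_real normr_nat.
  have -> : normc (2 : C) = 2.
    by rewrite -[2%:R : C](rmorph_nat (real_complex R) 2) normc_real normr_nat.
  by have := near Qz ia; lra.
rewrite !normcM !normcV !exprS expr0 mulr1 !mulrA.
by rewrite !ler_pM ?mulr_ge0 ?invr_ge0 ?normc_ge0 // lef_pV2 // posrE ?(lt_le_trans rho0).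
Qed.

End kernels.
End cauchy.

(** * Holomorphic maps are smooth *)

Section cauchy_formula.
Variable R : realType.
Notation C := (Cplx R).
Local Notation Re := (@complex.Re R).
Local Notation Im := (@complex.Im R).
Implicit Types f g : C -> C.

Lemma sub_neq0 (z a : C) : z <> a -> z - a != 0.
Proof. by move=> za; rewrite subr_eq0; apply/eqP. Qed.

(** Filled in by the derivative at [a], the difference quotient is continuous there, so Goursat's
    theorem with one exceptional point applies to it. *)
Definition slope_at f (a z : C) : C :=
  if z == a then 'D_1 f a else (f z - f a) * (z - a)^-1.

Lemma slope_has_cderive f a z : z <> a -> derivable f z 1 ->
  exists l, has_cderive (slope_at f a) z l.
Proof.
move=> za /derivable_has_cderive df.
have d1 := has_cderiveB df (has_cderive_cst (f a) z).
have d2 := @has_cderiveV _ (fun w => w - a) _ _ (sub_neq0 za) (has_cderiveB (has_cderive_id z) (has_cderive_cst a z)).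
have d3 := has_cderiveM d1 d2.
eexists; apply: eq_has_cderive d3.
apply/nbhs_complexP; exists (normc (z - a)).
  by rewrite lt_def normc_ge0 andbT; apply/eqP => /eq0_normc/eqP; rewrite subr_eq0 => /eqP.
move=> w zw; rewrite /slope_at; case: eqP => // wa.
by move: zw; rewrite wa ltxx.
Qed.

Lemma slope_continuous f a : derivable f a 1 -> {for a, continuous (slope_at f a)}.
Proof.
move=> /derivable_has_cderive df; apply/continuous_complexP => e e0.
have [dl dl0 H] := df _ (divr_gt0 e0 (ltr0n R 2)).
exists dl => // w wd; rewrite /slope_at eqxx.
case: eqP => [_|/sub_neq0 wa]; first by rewrite subrr normc0.
have nw : 0 < normc (w - a).
  by rewrite lt_def normc_ge0 andbT; apply: contra wa => /eqP/eq0_normc ->.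
have := H _ wd; rewrite subrKC => h.
have -> : (f w - f a) * (w - a)^-1 - 'D_1 f a = (f w - f a - 'D_1 f a * (w - a)) * (w - a)^-1.
  by rewrite [in RHS]mulrBl mulfK.
rewrite normcM normcV ltr_pdivrMr //.
by apply: le_lt_trans h _; rewrite ltr_pM2r // ltr_pdivrMr // ltr_pMr // ltr1n.
Qed.

(** The contour of [slope_at f a] vanishes; splitting it gives the formula. The winding integral
    remains as a factor, to be divided by later, and the [1 *] makes it an instance of the same
    kernels with [g = 1]. *)
Lemma cauchy_formula f x0 x1 y0 y1 (a : C) :
  x0 < Re a < x1 -> y0 < Im a < y1 ->
  (forall z, rectangle x0 x1 y0 y1 z -> derivable f z 1) ->
  f a * contour (fun z => 1 * (z - a)^-1) x0 x1 y0 y1 =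
  contour (fun z => f z * (z - a)^-1) x0 x1 y0 y1.
Proof.
move=> ax ay df.
have x01 : x0 <= x1 by move: ax => /andP[h1 h2]; exact: ltW (lt_trans h1 h2).
have y01 : y0 <= y1 by move: ay => /andP[h1 h2]; exact: ltW (lt_trans h1 h2).
have Qa : rectangle x0 x1 y0 y1 a.
  by move: ax ay => /andP[h1 h2] /andP[h3 h4]; split; rewrite !ltW.
have cf : continuous_on (rectangle x0 x1 y0 y1) f.
  by move=> z /df /derivable_has_cderive; exact: has_cderive_continuous.
have Qna z : rectangle_boundary x0 x1 y0 y1 z -> z <> a.
  move=> [_ bz] za; move: bz; rewrite za.
  by move: ax ay => /andP[h1 h2] /andP[h3 h4] [[]|[]] h; move: h1 h2 h3 h4; rewrite h ltxx.
have ci : continuous_on (rectangle_boundary x0 x1 y0 y1) (fun z => (z - a)^-1).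
  apply: continuous_onV; last by move=> z /Qna/sub_neq0.
  exact: continuous_onD (@continuous_on_id _ _) (@continuous_on_cst _ _ (- a)).
have c1 := continuous_onM (continuous_on_boundary cf) ci.
have c2 := continuous_onM (@continuous_on_cst _ _ 1) ci.
have c3 := continuous_onM (@continuous_on_cst _ _ (- f a)) c2.
have : contour (slope_at f a) x0 x1 y0 y1 = 0.
  apply: (goursat_exceptional ax ay).
    move=> z Qz; have [->|za] := pselect (z = a); first exact/slope_continuous/df.
    by have [l /has_cderive_continuous] := slope_has_cderive za (df _ Qz).
  by move=> z Qz za; have [l /has_cderive_derivable] := slope_has_cderive za (df _ Qz).
have E : forall z, rectangle_boundary x0 x1 y0 y1 z ->
    slope_at f a z = f z * (z - a)^-1 + (- f a) * (1 * (z - a)^-1).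
  move=> z /Qna za; rewrite /slope_at; case: eqP => // _.
  by rewrite mul1r mulrBl mulNr.
rewrite (eq_contour x01 y01 E) (contourD x01 y01 c1 c3) (contourZ x01 y01 (- f a) c2) mulNr.
by move=> /eqP; rewrite subr_eq0 => /eqP ->.
Qed.

(** The imaginary part is at least 4: on each side, of length [2 * s], its integrand, taken with
    orientation, is at least [(2 * s)^-1]. *)
Lemma winding_neq0 (u v s : R) : 0 < s ->
  contour (fun z : C => 1 * (z - Complex u v)^-1) (u - s) (u + s) (v - s) (v + s) != 0.
Proof.
move=> s0.
have us : u - s <= u + s by lra.
have vs : v - s <= v + s by lra.
pose k (z : C) := 1 * (z - Complex u v)^-1.
have ck : continuous_on (rectangle_boundary (u - s) (u + s) (v - s) (v + s)) k.
  apply: continuous_onM; first exact: continuous_on_cst.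
  apply: continuous_onV; first exact: continuous_onD (@continuous_on_id _ _) (@continuous_on_cst _ _ _).
  move=> z [_ bz]; apply/sub_neq0 => zE; move: bz; rewrite zE /=.
  by move=> [[]|[]]; lra.
have inB t x : x = u - s \/ x = u + s -> v - s <= t <= v + s ->
    rectangle_boundary (u - s) (u + s) (v - s) (v + s) (Complex x t).
  by move=> xx tt; split; [split => //=; case: xx => ->; rewrite ?lexx ?us|left].
have inB' t y : y = v - s \/ y = v + s -> u - s <= t <= u + s ->
    rectangle_boundary (u - s) (u + s) (v - s) (v + s) (Complex t y).
  by move=> xx tt; split; [split => //=; case: xx => ->; rewrite ?lexx ?vs|right].
have bnd (x y : R) : 0 <= x ^+ 2 <= s ^+ 2 -> y ^+ 2 = s ^+ 2 -> (2 * s)^-1 <= s / (x ^+ 2 + y ^+ 2).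
  move=> /andP[x0 xs] ->.
  have p : 0 < x ^+ 2 + s ^+ 2 by rewrite ltr_wpDl // exprn_gt0.
  rewrite ler_pdivlMr // mulrC ler_pdivrMr ?mulr_gt0 //; nra.
have sq t w : w - s <= t <= w + s -> 0 <= (t - w) ^+ 2 <= s ^+ 2.
  by move=> /andP[h1 h2]; rewrite sqr_ge0 /=; nra.
have kIm (x y : R) : Im (k (Complex x y)) = - (y - v) / ((x - u) ^+ 2 + (y - v) ^+ 2).
  by rewrite /k mul1r /GRing.inv /= mulNr.
have kRe (x y : R) : Re (k (Complex x y)) = (x - u) / ((x - u) ^+ 2 + (y - v) ^+ 2).
  by rewrite /k mul1r.
have I1 (F : R -> R) w : continuous_on_itv (w - s) (w + s) F ->
    (forall t, w - s <= t <= w + s -> (2 * s)^-1 <= F t) ->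
    1 <= \int[@lebesgue_measure R]_(t in `[w - s, w + s]) F t.
  move=> cF FH.
  have -> : 1 = \int[@lebesgue_measure R]_(t in `[w - s, w + s]) ((2 * s)^-1).
    rewrite Rintegral_itv_cst; last lra.
    have -> : w + s - (w - s) = 2 * s by lra.
    by rewrite mulVf // mulf_neq0 // lt0r_neq0.
  by apply: Rintegral_itv_le => // t _; exact: cvg_cst.
have I2 (F : R -> R) w : continuous_on_itv (w - s) (w + s) F ->
    (forall t, w - s <= t <= w + s -> F t <= - (2 * s)^-1) ->
    \int[@lebesgue_measure R]_(t in `[w - s, w + s]) F t <= -1.
  move=> cF FH.
  have -> : -1 = \int[@lebesgue_measure R]_(t in `[w - s, w + s]) (- (2 * s)^-1).
    rewrite Rintegral_itv_cst; last lra.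
    have -> : w + s - (w - s) = 2 * s by lra.
    by rewrite mulNr mulVf // mulf_neq0 // lt0r_neq0.
  by apply: Rintegral_itv_le => // t _; exact: cvg_cst.
apply/eqP => /(congr1 (Im)); rewrite /contour -/k.
have ImiM (z : C) : Im (Complex 0 1 * z) = Re z.
  by case: z => a b; rewrite [LHS]/= mul0r mul1r add0r.
rewrite !(ImD, ImN, ImiM) [RHS]/=.
have H1 : 1 <= Im (cintegral (fun t => k (Complex t (v - s))) (u - s) (u + s)).
  apply: I1 => [t tt|t tt].
    have ch := continuous_horizontal ck (fun t => @inB' t (v - s) (or_introl erefl)).
    exact: continuous_Im_comp (ch _ tt).
  rewrite kIm; have -> : - (v - s - v) = s by lra.
  by apply: bnd; [exact: sq|have -> : v - s - v = - s by [lra]; rewrite sqrrN].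
have H2 : 1 <= Re (cintegral (fun t => k (Complex (u + s) t)) (v - s) (v + s)).
  apply: I1 => [t tt|t tt].
    have ch := continuous_vertical ck (fun t => @inB t (u + s) (or_intror erefl)).
    exact: continuous_Re_comp (ch _ tt).
  rewrite kRe addrAC subrr add0r addrC.
  by apply: bnd; [exact: sq|].
have H3 : Im (cintegral (fun t => k (Complex t (v + s))) (u - s) (u + s)) <= -1.
  apply: I2 => [t tt|t tt].
    have ch := continuous_horizontal ck (fun t => @inB' t (v + s) (or_intror erefl)).
    exact: continuous_Im_comp (ch _ tt).
  rewrite kIm addrAC subrr add0r mulNr lerN2.
  by apply: bnd; [exact: sq|].
have H4 : Re (cintegral (fun t => k (Complex (u - s) t)) (v - s) (v + s)) <= -1.
  apply: I2 => [t tt|t tt].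
    have ch := continuous_vertical ck (fun t => @inB t (u - s) (or_introl erefl)).
    exact: continuous_Re_comp (ch _ tt).
  rewrite kRe; have -> : u - s - u = - s by lra.
  rewrite mulNr lerN2 addrC.
  by apply: bnd; [exact: sq|rewrite sqrrN].
by move=> E; lra.
Qed.

End cauchy_formula.

Section derive_holomorphic.
Variable R : realType.
Notation C := (Cplx R).
Local Notation Re := (@complex.Re R).
Local Notation Im := (@complex.Im R).
Implicit Types f g : C -> C.

(** By Cauchy's formula [f] is, near [z0], the quotient [N1 / W1] of two Cauchy integrals over a
    fixed square. Both are twice differentiable, so the derivative [F] of the quotient is
    differentiable. *)
Lemma derive_holomorphic f (z0 : C) :
  (\forall z \near z0, derivable f z 1) -> derivable (fun z => 'D_1 f z) z0 1.
Proof.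
move=> /nbhs_complexP[e e0 df].
have dfc z : normc (z0 - z) < e -> has_cderive f z ('D_1 f z).
  by move=> /df; exact: derivable_has_cderive.
have [d1 d10 H1] : exists2 dl : R, 0 < dl &
    forall w, normc (w - z0) < dl -> normc (f w - f z0) < 1.
  have : {for z0, continuous f}.
    by apply: has_cderive_continuous (dfc z0 _); rewrite subrr normc0.
  by move=> /continuous_complexP; exact.
pose s := Num.min e d1 / 4; pose rho := s / 4.
have m0 : 0 < Num.min e d1 by rewrite lt_min e0.
have s0 : 0 < s by rewrite divr_gt0.
have rho0 : 0 < rho by rewrite divr_gt0.
set u := Re z0; set v := Im z0.
have us : u - s <= u + s by lra.
have vs : v - s <= v + s by lra.
have Qball z : rectangle (u - s) (u + s) (v - s) (v + s) z -> normc (z0 - z) < Num.min e d1.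
  move=> [h1 h2]; apply: le_lt_trans (normc_le _) _.
  rewrite !(ReD, ImD, ReN, ImN) -/u -/v.
  have a1 : `|u - Re z| <= s by rewrite ler_norml; lra.
  have a2 : `|v - Im z| <= s by rewrite ler_norml; lra.
  by rewrite /s in a1 a2 *; lra.
have Qe z : rectangle (u - s) (u + s) (v - s) (v + s) z -> normc (z0 - z) < e.
  by move=> /Qball; rewrite lt_min => /andP[].
have cf : continuous_on (rectangle (u - s) (u + s) (v - s) (v + s)) f.
  by move=> z /Qe/dfc; exact: has_cderive_continuous.
have fG z : rectangle_boundary (u - s) (u + s) (v - s) (v + s) z -> normc (f z) <= normc (f z0) + 1.
  move=> [/Qball]; rewrite lt_min normcB => /andP[_ /H1 h] _.
  have := le_normcD (f z - f z0) (f z0); rewrite subrK => /le_trans; apply.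
  by rewrite addrC lerD2l ltW.
have oneG z : rectangle_boundary (u - s) (u + s) (v - s) (v + s) z -> normc (1 : C) <= 1.
  by rewrite normc1.
pose N1 a := contour (fun z => f z * (z - a)^-1) (u - s) (u + s) (v - s) (v + s).
pose N2 a := contour (fun z => f z * ((z - a)^-1 * (z - a)^-1)) (u - s) (u + s) (v - s) (v + s).
pose W1 a := contour (fun z => 1 * (z - a)^-1) (u - s) (u + s) (v - s) (v + s).
pose W2 a := contour (fun z => 1 * ((z - a)^-1 * (z - a)^-1)) (u - s) (u + s) (v - s) (v + s).
pose inner (a : C) := rectangle (u - s + 2 * rho) (u + s - 2 * rho) (v - s + 2 * rho) (v + s - 2 * rho) a.
have c1 := @continuous_on_cst R (rectangle_boundary (u - s) (u + s) (v - s) (v + s)) 1.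
have dN1 a : inner a -> has_cderive N1 a (N2 a).
  exact: (cauchy_kernel1 us vs rho0 (continuous_on_boundary cf) fG).
have dN2 a : inner a -> exists l, has_cderive N2 a l.
  move=> ia; eexists.
  exact: (cauchy_kernel2 us vs rho0 (continuous_on_boundary cf) fG ia).
have dW1 a : inner a -> has_cderive W1 a (W2 a).
  exact: (cauchy_kernel1 us vs rho0 c1 oneG).
have dW2 a : inner a -> exists l, has_cderive W2 a l.
  by move=> ia; eexists; exact: (cauchy_kernel2 us vs rho0 c1 oneG ia).
have near_inner a : normc (z0 - a) < s / 2 -> inner a.
  move=> h; have := le_Re_normc (z0 - a); have := le_Im_normc (z0 - a).
  rewrite !(ReD, ImD, ReN, ImN) -/u -/v !ler_norml => /andP[h1 h2] /andP[h3 h4].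
  by split; apply/andP; split; rewrite /rho; lra.
have i0 : inner z0 by apply: near_inner; rewrite subrr normc0 divr_gt0.
have W0 : W1 z0 != 0.
  by rewrite /W1; have := winding_neq0 u v s0; rewrite -[Complex u v]/(to_complex (of_complex z0)) of_complexK.
have [d2 d20 H2] : exists2 dl : R, 0 < dl & forall a, normc (a - z0) < dl -> W1 a != 0.
  have n0 : 0 < normc (W1 z0).
    by rewrite lt_def normc_ge0 andbT; apply: contra W0 => /eqP/eq0_normc ->.
  have /continuous_complexP/(_ _ n0)[dl dl0 H] := has_cderive_continuous (dW1 _ i0).
  exists dl => // a /H; apply: contraTneq => ->.
  by rewrite sub0r normcN ltxx.
have fE a : inner a -> W1 a != 0 -> f a = N1 a * (W1 a)^-1.
  move=> [ia1 ia2] Wa.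
  have ia3 : u - s < Re a < u + s by rewrite /rho in ia1; lra.
  have ia4 : v - s < Im a < v + s by rewrite /rho in ia2; lra.
  by rewrite /N1 -(cauchy_formula ia3 ia4 (fun z Qz => df _ (Qe _ Qz))) mulfK.
pose F a := N1 a * (- (W1 a)^-2 * W2 a) + (W1 a)^-1 * N2 a.
pose r := Num.min (s / 2) d2.
have r0 : 0 < r by rewrite lt_min divr_gt0.
have rin a : normc (z0 - a) < r -> inner a /\ W1 a != 0.
  by rewrite lt_min => /andP[/near_inner ia]; rewrite normcB => /H2.
have DfE a : normc (z0 - a) < r / 2 -> 'D_1 f a = F a.
  move=> ar; have ar' : normc (z0 - a) < r by lra.
  have [ia Wa] := rin _ ar'.
  have dF := has_cderiveM (dN1 _ ia) (has_cderiveV Wa (dW1 _ ia)).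
  apply: has_cderive_val; apply: eq_has_cderive dF.
  apply/nbhs_complexP; exists (r / 2); first by rewrite divr_gt0.
  move=> w aw; have [|iw Ww] := rin w; last by rewrite -fE.
  by have := le_normcD (z0 - a) (a - w); rewrite addrA subrK; lra.
have [l2 dN2'] := dN2 _ i0; have [k2 dW2'] := dW2 _ i0.
have dV := has_cderiveV W0 (dW1 _ i0).
have dVV : exists l, has_cderive (fun a => - (W1 a)^-2) z0 l.
  have := has_cderiveM (has_cderive_cst (-1) z0) (has_cderiveM dV dV).
  set l := (X in has_cderive _ _ X) => H; exists l.
  apply: eq_has_cderive H; apply/nbhs_complexP; exists 1 => // a _.
  by rewrite mulN1r -exprVn expr2.
have [l3 dVV'] := dVV.
have := has_cderiveM (dN1 _ i0) (has_cderiveM dVV' dW2').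
set m1 := (X in has_cderive _ _ X) => D1.
have := has_cderiveM dV dN2'.
set m2 := (X in has_cderive _ _ X) => D2.
have DF : has_cderive F z0 (m1 + m2).
  have := has_cderiveB D1 (has_cderiveM (has_cderive_cst (-1) z0) D2).
  rewrite mulr0 addr0 mulN1r opprK; apply: eq_has_cderive.
  by apply/nbhs_complexP; exists 1 => // a _; rewrite mulN1r opprK.
apply: has_cderive_derivable (m1 + m2) _; apply: eq_has_cderive DF.
apply/nbhs_complexP; exists (r / 2); first by rewrite divr_gt0.
by move=> w /DfE.
Qed.

End derive_holomorphic.

Section smooth_curves.
Variable R : realType.
Notation C := (Cplx R).
Local Notation Re := (@complex.Re R).
Local Notation Im := (@complex.Im R).

Definition cderive (f : C -> C) : C -> C := fun z => 'D_1 f z.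

Lemma affine_is_derive (g : C -> C) (a v l : C) (y w : R) :
  has_cderive g (a + (y%:C)%C * v) l ->
  is_derive y w (fun s : R => of_complex (g (a + (s%:C)%C * v)) : (R * R)%type)
    (of_complex (l * ((w%:C)%C * v))).
Proof.
move=> Dg; set F := (fun s : R => _); set u := (w%:C)%C * v; set z := a + (y%:C)%C * v.
have L : h^-1 *: ((F \o shift y) (h *: w) - F y) @[h --> 0^'] --> of_complex (l * u).
  move=> A /(@nbhs_ballP R (R * R)%type)[e /= e0 eA].
  have K0 : 0 < normc u + 1 by rewrite ltr_wpDl ?normc_ge0.
  have [dl dl0 H] := Dg _ (divr_gt0 e0 K0).
  suff : nbhs (0 : R) [set h | h != 0 -> A (h^-1 *: ((F \o shift y) (h *: w) - F y))] by [].
  apply/nbhs_ballP; exists (dl / (normc u + 1)); first exact: divr_gt0.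
  move=> h; rewrite /ball /= sub0r normrN ltr_pdivlMr // => hd h0.
  have nh : 0 < `|h| by rewrite normr_gt0.
  have nhu : normc ((h%:C)%C * u) < dl.
    rewrite normcM normc_real; apply: le_lt_trans hd.
    by rewrite ler_pM2l // lerDl.
  apply: eA; rewrite -ball_normE /=.
  have -> : of_complex (l * u) - h^-1 *: (F (h *: w + y) - F y) =
      - (h^-1 *: of_complex (g (z + (h%:C)%C * u) - g z - l * ((h%:C)%C * u))).
    have -> : F (h *: w + y) = of_complex (g (z + (h%:C)%C * u)).
      rewrite /F /z /u; congr (of_complex (g _)).
      by rewrite [h *: w]/(h * w) rmorphD rmorphM /=; ring.
    rewrite /F -/z [of_complex (_ - l * _)]of_complexB of_complexB [in RHS]scalerBr opprB.
    congr (_ - _); move: (l) (u) => [l1 l2] [u1 u2]; rewrite /of_complex /=.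
    by congr (_, _); rewrite /GRing.scale /=; field.
  rewrite normrN normrZ normfV mulrC ltr_pdivrMr //.
  apply: le_lt_trans (le_norm_of_complex _) _; apply: le_lt_trans (H _ nhu) _.
  rewrite [normc (_ * u)]normcM normc_real mulrCA [ltRHS]mulrC ltr_pM2l //.
  by rewrite mulrAC ltr_pdivrMr // ltr_pM2l // ltrDl.
by apply: DeriveDef; [apply/cvg_ex; exists (of_complex (l * u))|exact: cvg_lim L].
Qed.

Lemma is_derive_continuous (W : normedModType R) (f : R -> W) (y : R) (l : W) :
  is_derive y 1 f l -> {for y, continuous f}.
Proof.
by move=> [/derivable1_diffP df _]; exact: differentiable_continuous.
Qed.

Lemma iter_derive_holomorphic (f : C -> C) (A : set C) n : open A ->
  (forall z, A z -> derivable f z 1) ->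
  forall z, A z -> derivable (iter n cderive f) z 1.
Proof.
move=> oA df; elim: n => [|n IH]; first exact: df.
move=> z Az; apply: (@derive_holomorphic R (iter n cderive f)); move: (open_nbhs_nbhs (conj oA Az)).
by apply: filterS => w; exact: IH.
Qed.

(** Along the line, each iterated real derivative is a complex constant times an iterated complex
    derivative of [f], and all of these are again holomorphic on [A]. *)
Lemma smooth_at_holomorphic (f : C -> C) (A : set C) (a v : C) (t : R) : open A ->
  (forall z, A z -> derivable f z 1) -> A (a + (t%:C)%C * v) ->
  smooth_at (fun s : R => of_complex (f (a + (s%:C)%C * v)) : (R * R)%type) t.
Proof.
move=> oA df At.
set F := (fun s : R => _).
pose D n := iter n cderive f.
have clin : continuous (fun s : R => a + (s%:C)%C * v : C).
  move=> s B /nbhs_complexP[e e0 eB].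
  have K0 : 0 < normc v + 1 by rewrite ltr_wpDl ?normc_ge0.
  apply/nbhs_ballP; exists (e / (normc v + 1)); first exact: divr_gt0.
  move=> w; rewrite /ball /= ltr_pdivlMr // => hd; apply: eB.
  have -> : a + (s%:C)%C * v - (a + (w%:C)%C * v) = ((s - w)%:C)%C * v.
    by rewrite rmorphB /=; ring.
  rewrite normcM normc_real; apply: le_lt_trans hd.
  by rewrite ler_wpM2l // lerDl.
have nA y : A (a + (y%:C)%C * v) -> \forall s \near y, A (a + (s%:C)%C * v).
  by move=> Ay; exact: (clin y _ (open_nbhs_nbhs (conj oA Ay))).
have key (vs : seq R) : exists k : C, forall y, A (a + (y%:C)%C * v) ->
    iter_derive F vs y = of_complex (k * D (size vs) (a + (y%:C)%C * v)).
  elim: vs => [|w vs [k IH]] /=; first by exists 1 => y _; rewrite mul1r.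
  exists (k * ((w%:C)%C * v)) => y Ay.
  have /derivable_has_cderive Dk := @iter_derive_holomorphic f A (size vs) oA df _ Ay.
  have Dk' := has_cderiveM (has_cderive_cst k _) Dk.
  rewrite mulr0 addr0 in Dk'.
  have [_ E] := @affine_is_derive _ _ _ _ y w Dk'.
  transitivity ('D_w (fun s : R => of_complex (k * D (size vs) (a + (s%:C)%C * v)) : (R * R)%type) y).
    by apply: near_eq_derive; apply: filterS (nA _ Ay) => s; exact: IH.
  rewrite E; congr (of_complex _); by rewrite mulrAC.
apply: filterS (nA _ At) => y Ay vs.
have der w : derivable (iter_derive F vs) y w.
  have [k kE] := key vs.
  have /derivable_has_cderive Dk := @iter_derive_holomorphic f A (size vs) oA df _ Ay.
  have Dk' := has_cderiveM (has_cderive_cst k _) Dk.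
  have [E _] := @affine_is_derive _ _ _ _ y w Dk'.
  apply: near_eq_derivable E; apply: filterS (nA _ Ay) => s As.
  by rewrite kE.
split => //; apply: is_derive_continuous; apply: DeriveDef; [exact: der|reflexivity].
Qed.

(** An equality of difference quotients as functions of [h] transports both the existence and the
    value of a derivative. *)
Lemma difference_quotient_affine (W : normedModType R) (g : R -> W) (a b v y : R) :
  (fun h : R => h^-1 *: (((fun s => g (a * s + b)) \o shift y) (h *: v) - g (a * y + b))) =
  (fun h => h^-1 *: ((g \o shift (a * y + b)) (h *: (a * v)) - g (a * y + b))).
Proof.
apply/funext => h /=; congr (_ *: (g _ - _)).
by rewrite /GRing.scale /=; ring.
Qed.

Lemma iter_derive_affine (W : normedModType R) (f : R -> W) (a b : R) (vs : seq R) :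
  iter_derive (fun s => f (a * s + b)) vs =
  (fun s => iter_derive f (map (fun v => a * v) vs) (a * s + b)).
Proof.
elim: vs => // v vs IH; apply/funext => y /=; rewrite IH /derive.
by rewrite difference_quotient_affine.
Qed.

Lemma smooth_at_affine (W : normedModType R) (f : R -> W) (a b t : R) :
  smooth_at f (a * t + b) -> smooth_at (fun s => f (a * s + b)) t.
Proof.
have caff : continuous (fun s : R => a * s + b).
  move=> s; have h1 : {for s, continuous (fun s : R => a * s)} by exact: mulrl_continuous.
  exact: (cvgD h1 (cvg_cst b)).
move=> Hs.
have H0 : \forall y \near t, forall vs : seq R,
    {for (a * y + b), continuous (iter_derive f vs)} /\
    forall v : R, derivable (iter_derive f vs) (a * y + b) v by exact: (caff t _ Hs).
apply: filterS H0 => y H vs; rewrite iter_derive_affine.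
have [H1 H2] := H (map (fun v => a * v) vs); split.
  exact: (continuous_comp (caff y) H1).
by move=> v; have := H2 (a * v); rewrite /derivable difference_quotient_affine.
Qed.

End smooth_curves.

(** * Paths and homotopies *)

Section clamp.
Variable R : realType.

(** Paths are only meaningful on [[0, 1]]; composing with this retraction makes them continuous on
    the whole line, where they can be glued and reparametrized freely. *)
Definition clamp (t : R) : R := Num.max 0 (Num.min t 1).

Lemma clamp_in t : 0 <= clamp t <= 1.
Proof. by rewrite /clamp le_max ge_max !lexx ler01 ge_min lexx orbT. Qed.

Lemma clamp_id t : 0 <= t <= 1 -> clamp t = t.
Proof. by move=> /andP[t0 t1]; rewrite /clamp (min_idPl t1) (max_idPr t0). Qed.

Lemma clamp_continuous : continuous clamp.
Proof.
move=> t.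
have h1 : {for t, continuous ((fun s : R => s : R^o) \min (fun=> 1))}.
  by apply: continuous_min; [exact: cvg_id|exact: cvg_cst].
have h2 : {for t, continuous ((fun=> 0 : R^o) \max ((fun s : R => s : R^o) \min (fun=> 1)))}.
  by apply: continuous_max h1; exact: cvg_cst.
exact: h2.
Qed.

Lemma clamp_itv t : [set` `[0, 1]%R] (clamp t).
Proof. by rewrite /= in_itv /= clamp_in. Qed.

Lemma within_continuous_comp (T U W : topologicalType) (A : set U) (f : U -> W) (g : T -> U) :
  {within A, continuous f} -> continuous g -> (forall x, A (g x)) -> continuous (f \o g).
Proof.
move=> /subspace_continuousP cf cg Ag x S /(cf _ (Ag x)) H.
have H' : nbhs x [set y | A (g y) -> S (f (g y))] by exact: (cg x _ H).
by apply: filterS H' => y /= yS; exact: yS.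
Qed.

Lemma continuous_within (T U : topologicalType) (A : set T) (f g : T -> U) :
  continuous g -> (forall x, A x -> f x = g x) -> {within A, continuous f}.
Proof.
move=> cg fg; apply: (@subspace_eq_continuous _ _ _ (g : subspace A -> U)).
  by move=> x; rewrite inE => /fg /esym.
exact: continuous_subspaceT.
Qed.

Lemma continuous_glue (T U : topologicalType) (h : T -> R) (c : R) (f g : T -> U) :
  continuous h -> continuous f -> continuous g -> (forall x, h x = c -> f x = g x) ->
  continuous (fun x => if h x <= c then f x else g x).
Proof.
move=> ch cf cg fg x S /=.
have [xc|xc|xc] := ltgtP (h x) c => HS.
- have H1 : \forall y \near x, h y < c by apply: (cvgr_lt (h x)) => //; exact: ch.
  have H2 : \forall y \near x, S (f y) by exact: (cf x _ HS).
  by apply: filterS2 H2 H1 => y /= Sy yc; rewrite (ltW yc).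
- have H1 : \forall y \near x, c < h y by apply: (cvgr_gt (h x)) => //; exact: ch.
  have H2 : \forall y \near x, S (g y) by exact: (cg x _ HS).
  by apply: filterS2 H2 H1 => y /= Sy yc; rewrite leNgt yc.
- have HS' : nbhs (g x) S by rewrite -fg.
  have H1 : \forall y \near x, S (f y) by apply: (cf x _); rewrite fg.
  have H2 : \forall y \near x, S (g y) by exact: (cg x _ HS').
  by apply: filterS2 H1 H2 => y /= Sy Sy'; case: ifP.
Qed.

Lemma continuous_fcomp (T U W : topologicalType) (f : T -> U) (g : U -> W) :
  continuous f -> continuous g -> continuous (fun x => g (f x)).
Proof. by move=> cf cg x; apply: continuous_comp; [exact: cf|exact: cg]. Qed.

Lemma continuous_fpair (T U W : topologicalType) (f : T -> U) (g : T -> W) :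
  continuous f -> continuous g -> continuous (fun x => (f x, g x)).
Proof. by move=> cf cg x; exact: (cvg_pair (cf x) (cg x)). Qed.

Lemma fst_continuous (T U : topologicalType) : continuous (@fst T U).
Proof. by move=> p; exact: cvg_fst. Qed.

Lemma snd_continuous (T U : topologicalType) : continuous (@snd T U).
Proof. by move=> p; exact: cvg_snd. Qed.

Lemma onem_continuous : continuous (fun t : R => 1 - t).
Proof. by move=> t; exact: (cvgB (cvg_cst _) cvg_id). Qed.

Lemma affine_continuous (a b : R) : continuous (fun t : R => a * t + b).
Proof.
move=> s; have h1 : {for s, continuous (fun s : R => a * s)} by exact: mulrl_continuous.
exact: (cvgD h1 (cvg_cst b)).
Qed.

End clamp.

Section paths.
Variables (R : realType) (B : topologicalType).
Implicit Types (X Y : set B) (x y z w : B) (g : R -> B).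

Lemma path_clamp X x y g : is_path X x y g -> continuous (g \o @clamp R).
Proof.
move=> [cg _ _ _]; apply: within_continuous_comp cg (@clamp_continuous R) _ => t.
exact: clamp_itv.
Qed.

Lemma path_in X x y g t : is_path X x y g -> X (g (clamp t)).
Proof. by move=> [_ _ _]; apply; exists (clamp t) => //; exact: clamp_itv. Qed.

Lemma path_clamp0 X x y g : is_path X x y g -> g (clamp 0) = x.
Proof. by move=> [_ + _ _]; rewrite clamp_id // lexx ler01. Qed.

Lemma path_clamp1 X x y g : is_path X x y g -> g (clamp 1) = y.
Proof. by move=> [_ _ + _]; rewrite clamp_id // lexx ler01. Qed.

Lemma is_path_of X x y g (f : R -> B) : continuous f ->
  (forall t, 0 <= t <= 1 -> g t = f t) -> f 0 = x -> f 1 = y ->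
  (forall t, 0 <= t <= 1 -> X (f t)) -> is_path X x y g.
Proof.
move=> cf gf f0 f1 fX; split.
- by apply: (continuous_within cf) => t; rewrite /= in_itv /=; exact: gf.
- by rewrite gf // lexx ler01.
- by rewrite gf // lexx ler01.
- by move=> _ [t + <-]; rewrite /= in_itv /= => t01; rewrite gf //; exact: fX.
Qed.

Lemma is_path_subset X Y x y g : X `<=` Y -> is_path X x y g -> is_path Y x y g.
Proof. by move=> XY [? ? ? h]; split => //; exact: subset_trans XY. Qed.

(** Concatenation before rescaling, over [[0, 2]] and constant outside: groupoid laws become
    reparametrizations of one continuous map. *)
Definition glue2 (g1 g2 : R -> B) (t : R) : B :=
  if t <= 1 then g1 (clamp t) else g2 (clamp (t - 1)).

Lemma glue2_continuous X x y z g1 g2 : is_path X x y g1 -> is_path X y z g2 ->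
  continuous (glue2 g1 g2).
Proof.
move=> p1 p2; apply: (@continuous_glue _ _ _ id 1 (g1 \o @clamp R) (fun t => g2 (clamp (t - 1)))).
- by move=> t; exact: cvg_id.
- exact: path_clamp p1.
- have c : continuous (fun t : R => t - 1) by move=> t; exact: (cvgB cvg_id (cvg_cst _)).
  exact: continuous_fcomp c (path_clamp p2).
- by move=> t /= ->; rewrite subrr (path_clamp1 p1) (path_clamp0 p2).
Qed.

Lemma path_concatE g1 g2 t : 0 <= t <= 1 -> path_concat g1 g2 t = glue2 g1 g2 (2 * t).
Proof.
move=> t01; rewrite /path_concat /glue2.
have -> : (t <= 2^-1) = (2 * t <= 1) by rewrite mulrC -ler_pdivlMr ?mul1r.
by case: ifP => t2; rewrite clamp_id //; lra.
Qed.

Lemma glue2_in X x y z g1 g2 t : is_path X x y g1 -> is_path X y z g2 -> X (glue2 g1 g2 t).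
Proof. by move=> p1 p2; rewrite /glue2; case: ifP => _; [exact: path_in p1|exact: path_in p2]. Qed.

Lemma is_path_concat X x y z g1 g2 : is_path X x y g1 -> is_path X y z g2 ->
  is_path X x z (path_concat g1 g2).
Proof.
move=> p1 p2; apply: (@is_path_of _ _ _ _ (fun t => glue2 g1 g2 (2 * t))).
- exact: continuous_fcomp (@mulrl_continuous _ 2) (glue2_continuous p1 p2).
- exact: path_concatE.
- by rewrite mulr0 /glue2 ler01 (path_clamp0 p1).
- have n2 : (2 * 1 <= 1 :> R) = false by rewrite mulr1 leNgt ltr1n.
  have e1 : 2 * 1 - 1 = 1 :> R by lra.
  by rewrite /glue2 n2 e1 (path_clamp1 p2).
- by move=> t _; exact: glue2_in p1 p2.
Qed.

Lemma is_path_reverse X x y g : is_path X x y g -> is_path X y x (path_reverse g).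
Proof.
move=> p; apply: (@is_path_of _ _ _ _ (fun t => g (clamp (1 - t)))).
- exact: continuous_fcomp (@onem_continuous R) (path_clamp p).
- by move=> t t01; rewrite /path_reverse clamp_id //; lra.
- by rewrite subr0 (path_clamp1 p).
- by rewrite subrr (path_clamp0 p).
- by move=> t _; exact: path_in p.
Qed.

Definition subpath g (a b : R) : R -> B := fun t => g ((b - a) * t + a).

Lemma is_path_subpath X x y g a b : 0 <= a -> a <= b -> b <= 1 -> is_path X x y g ->
  is_path X (g a) (g b) (subpath g a b).
Proof.
move=> a0 ab b1 p; apply: (@is_path_of _ _ _ _ (fun t => g (clamp ((b - a) * t + a)))).
- exact: continuous_fcomp (@affine_continuous R _ _) (path_clamp p).
- by move=> t t01; rewrite /subpath clamp_id //; nra.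
- by rewrite mulr0 add0r clamp_id //; lra.
- by rewrite mulr1 subrK clamp_id //; lra.
- by move=> t _; exact: path_in p.
Qed.

Lemma homotopic_of X x y g1 g2 (H : R * R -> B) : continuous H ->
  (forall s t, 0 <= s <= 1 -> 0 <= t <= 1 -> X (H (s, t))) ->
  (forall t, 0 <= t <= 1 -> H (0, t) = g1 t /\ H (1, t) = g2 t) ->
  (forall s, 0 <= s <= 1 -> H (s, 0) = x /\ H (s, 1) = y) ->
  homotopic X x y g1 g2.
Proof.
move=> cH HX Ht Hs; exists H; split => //; first exact: continuous_subspaceT.
by move=> _ [[s t] [/= + +] <-]; rewrite !in_itv /=; exact: HX.
Qed.

Lemma homotopic_extend X x y g1 g2 : homotopic X x y g1 g2 -> exists H : R * R -> B,
  [/\ continuous H, forall p, X (H p),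
      forall t, H (0, t) = g1 (clamp t) /\ H (1, t) = g2 (clamp t) &
      forall s, H (s, 0) = x /\ H (s, 1) = y].
Proof.
move=> [H [cH HX Ht Hs]].
pose c2 (p : R * R) := (clamp p.1, clamp p.2).
have c2in p : ([set` `[0, 1]%R] `*` [set` `[0, 1]%R]) (c2 p).
  by split; exact: clamp_itv.
have cc2 : continuous c2.
  apply: continuous_fpair.
    exact: continuous_fcomp (@fst_continuous _ _) (@clamp_continuous R).
  exact: continuous_fcomp (@snd_continuous _ _) (@clamp_continuous R).
have c0 : clamp 0 = 0 :> R by rewrite clamp_id // lexx ler01.
have c1 : clamp 1 = 1 :> R by rewrite clamp_id // lexx ler01.
exists (H \o c2); split.
- exact: within_continuous_comp cH cc2 c2in.
- by move=> p; apply: HX; exists (c2 p).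
- by move=> t; rewrite /= /c2 /= c0 c1; apply: Ht; exact: clamp_in.
- by move=> s; rewrite /= /c2 /= c0 c1; apply: Hs; exact: clamp_in.
Qed.

Lemma homotopic_eq X x y g1 g2 h1 h2 : homotopic X x y g1 g2 ->
  (forall t, 0 <= t <= 1 -> g1 t = h1 t) -> (forall t, 0 <= t <= 1 -> g2 t = h2 t) ->
  homotopic X x y h1 h2.
Proof.
move=> [H [cH HX Ht Hs]] e1 e2; exists H; split => // t t01.
by rewrite -e1 // -e2 //; exact: Ht.
Qed.

Lemma homotopic_sym X x y g1 g2 : homotopic X x y g1 g2 -> homotopic X x y g2 g1.
Proof.
move=> /homotopic_extend[H [cH HX Ht Hs]].
apply: (@homotopic_of _ _ _ _ _ (fun p => H (1 - p.1, p.2))) => //=.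
- apply: (continuous_fcomp _ cH); apply: continuous_fpair; last exact: snd_continuous.
  exact: continuous_fcomp (@fst_continuous _ _) (@onem_continuous R).
- by move=> t t01; rewrite subr0 subrr; have [-> ->] := Ht t; rewrite clamp_id.
Qed.

Lemma homotopic_trans X x y g1 g2 g3 :
  homotopic X x y g1 g2 -> homotopic X x y g2 g3 -> homotopic X x y g1 g3.
Proof.
move=> /homotopic_extend[H [cH HX Ht Hs]] /homotopic_extend[K [cK KX Kt Ks]].
pose F p := if p.1 <= 2^-1 then H (2 * p.1, p.2) else K (2 * p.1 - 1, p.2).
have aff (b : R) : continuous (fun p : R * R => (2 * p.1 + b, p.2)).
  apply: continuous_fpair; last exact: snd_continuous.
  exact: continuous_fcomp (@fst_continuous _ _) (@affine_continuous R 2 b).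
apply: (@homotopic_of _ _ _ _ _ F).
- apply: (@continuous_glue _ _ _ fst).
  + by move=> p; exact: cvg_fst.
  + have -> : (fun p : R * R => H (2 * p.1, p.2)) = H \o (fun p => (2 * p.1 + 0, p.2)).
      by apply/funext => p /=; rewrite addr0.
    exact: continuous_fcomp (aff 0) cH.
  + exact: continuous_fcomp (aff (-1)) cK.
  + move=> [s t] /= ->; rewrite divff // subrr.
    by have [_ ->] := Ht t; have [-> _] := Kt t.
- by move=> s t _ _; rewrite /F; case: ifP.
- move=> t t01; rewrite /F /= invr_ge0 ler0n mulr0.
  have -> : (1 <= 2^-1 :> R) = false by rewrite leNgt invf_lt1 // ltr1n.
  have -> : 2 * 1 - 1 = 1 :> R by lra.
  by have [-> _] := Ht t; have [_ ->] := Kt t; rewrite clamp_id.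
- move=> s _; rewrite /F /=; have [h1 h2] := Hs (2 * s); have [k1 k2] := Ks (2 * s - 1).
  by case: ifP => _; split.
Qed.

Lemma homotopic_concat X x y z g1 g2 h1 h2 :
  homotopic X x y g1 h1 -> homotopic X y z g2 h2 ->
  homotopic X x z (path_concat g1 g2) (path_concat h1 h2).
Proof.
move=> /homotopic_extend[H [cH HX Ht Hs]] /homotopic_extend[K [cK KX Kt Ks]].
pose F p := if p.2 <= 2^-1 then H (p.1, 2 * p.2) else K (p.1, 2 * p.2 - 1).
have aff (b : R) : continuous (fun p : R * R => (p.1, 2 * p.2 + b)).
  apply: continuous_fpair; first exact: fst_continuous.
  exact: continuous_fcomp (@snd_continuous _ _) (@affine_continuous R 2 b).
apply: (@homotopic_of _ _ _ _ _ F).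
- apply: (@continuous_glue _ _ _ snd).
  + by move=> p; exact: cvg_snd.
  + have -> : (fun p : R * R => H (p.1, 2 * p.2)) = H \o (fun p => (p.1, 2 * p.2 + 0)).
      by apply/funext => p /=; rewrite addr0.
    exact: continuous_fcomp (aff 0) cH.
  + exact: continuous_fcomp (aff (-1)) cK.
  + move=> [s t] /= ->; rewrite divff // subrr.
    by have [_ ->] := Hs s; have [-> _] := Ks s.
- by move=> s t _ _; rewrite /F; case: ifP.
- move=> t t01; rewrite /F /path_concat /=; case: ifPn => t2.
    by have [-> ->] := Ht (2 * t); rewrite clamp_id //; lra.
  by have [-> ->] := Kt (2 * t - 1); rewrite clamp_id //; rewrite -ltNge in t2; lra.
- move=> s _; rewrite /F /= invr_ge0 ler0n mulr0.
  have -> : (1 <= 2^-1 :> R) = false by rewrite leNgt invf_lt1 // ltr1n.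
  have -> : 2 * 1 - 1 = 1 :> R by lra.
  by have [-> _] := Hs s; have [_ ->] := Ks s.
Qed.

End paths.

Section homotopies.
Variables (R : realType) (B : topologicalType).
Implicit Types (X Y : set B) (x y z w : B) (g : R -> B).

(** The straight-line homotopy in a convex set, pushed forward by [K]. With [D] the line it compares
    reparametrizations; with [D] a square and [K] an inverse chart it compares short paths. *)
Lemma homotopic_convex (V : normedModType R) (D : set V) (K : V -> B) X (a b : V)
    (phi psi : R -> V) :
  (forall v, D v -> {for v, continuous K}) ->
  (forall u v (s : R), D u -> D v -> 0 <= s <= 1 -> D (u + s *: (v - u))) ->
  (forall v, D v -> X (K v)) ->
  is_path D a b phi -> is_path D a b psi ->
  homotopic X (K a) (K b) (K \o phi) (K \o psi).
Proof.
move=> cK convD KX p q.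
pose G (st : R * R) := phi (clamp st.2) + clamp st.1 *: (psi (clamp st.2) - phi (clamp st.2)).
have DG st : D (G st).
  exact: convD (path_in st.2 p) (path_in st.2 q) (clamp_in _).
have cG : continuous G.
  move=> st; have cp := continuous_fcomp (@snd_continuous R R) (path_clamp p).
  have cq := continuous_fcomp (@snd_continuous R R) (path_clamp q).
  have cs := continuous_fcomp (@fst_continuous R R) (@clamp_continuous R).
  apply: cvgD (cp st) _; apply: cvgZ (cs st) _; exact: cvgB (cq st) (cp st).
apply: (@homotopic_of _ _ _ _ _ _ _ (K \o G)).
- by move=> st; apply: continuous_comp (cG st) _; exact: cK.
- by move=> s t _ _; apply: KX.
- move=> t t01; rewrite /G /= !(@clamp_id _ t) // !clamp_id ?lexx ?ler01 //.
  by rewrite scale0r addr0 scale1r subrKC.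
- move=> s _; rewrite /G /= (path_clamp0 p) (path_clamp0 q) (path_clamp1 p) (path_clamp1 q).
  by rewrite !subrr scaler0 !addr0.
Qed.

Lemma homotopic_factor X (K : R -> B) (a b : R) (phi psi : R -> R) :
  continuous K -> (forall t, X (K t)) -> continuous phi -> continuous psi ->
  phi 0 = a -> phi 1 = b -> psi 0 = a -> psi 1 = b ->
  homotopic X (K a) (K b) (K \o phi) (K \o psi).
Proof.
move=> cK XK cphi cpsi p0 p1 q0 q1.
apply: (@homotopic_convex R [set: R]) => //.
- by move=> v _; exact: cK.
- exact: (@is_path_of _ _ _ _ _ _ phi).
- exact: (@is_path_of _ _ _ _ _ _ psi).
Qed.

Lemma homotopic_refl X x y g : is_path X x y g -> homotopic X x y g g.
Proof.
move=> p; have id_c : continuous (fun t : R => t) by move=> t; exact: cvg_id.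
have := @homotopic_factor X (g \o @clamp R) 0 1 id id (path_clamp p) (fun t => path_in t p) id_c id_c.
rewrite /= (path_clamp0 p) (path_clamp1 p) => H.
by apply: homotopic_eq (H _ _ _ _) _ _ => // t t01 /=; rewrite clamp_id.
Qed.

End homotopies.

Section groupoid.
Variables (R : realType) (B : topologicalType).
Implicit Types (X Y : set B) (x y z w : B) (g : R -> B).

Lemma piecewise_affine_continuous (a b c d e : R) : a * e + b = c * e + d ->
  continuous (fun t : R => if t <= e then a * t + b else c * t + d).
Proof.
move=> E; have ci : continuous (fun t : R => t) by move=> t; exact: cvg_id.
apply: (continuous_glue ci (@affine_continuous R a b) (@affine_continuous R c d)).
by move=> t /= ->.
Qed.

Lemma half_lt1 : (1 <= 2^-1 :> R) = false.
Proof. by rewrite leNgt invf_lt1 // ltr1n. Qed.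

Lemma homotopic_assoc X x y z w g1 g2 g3 : is_path X x y g1 -> is_path X y z g2 ->
  is_path X z w g3 ->
  homotopic X x w (path_concat (path_concat g1 g2) g3) (path_concat g1 (path_concat g2 g3)).
Proof.
move=> p1 p2 p3.
(* All three paths over [[0, 3]]; the two bracketings are piecewise affine reparametrizations of
   [K]. *)
pose K t := if t <= 2 then glue2 g1 g2 t else g3 (clamp (t - 2)).
have cK : continuous K.
  apply: (@continuous_glue R R B id 2 (glue2 g1 g2) (fun t => g3 (clamp (t - 2)))).
  - by move=> t; exact: cvg_id.
  - exact: glue2_continuous p1 p2.
  - have c : continuous (fun t : R => t - 2) by move=> t; exact: (cvgB cvg_id (cvg_cst _)).
    exact: continuous_fcomp c (path_clamp p3).
  - move=> t /= ->; rewrite /glue2 subrr (path_clamp0 p3).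
    have -> : (2 <= 1 :> R) = false by rewrite leNgt ltr1n.
    by have -> : 2 - 1 = 1 :> R by [lra]; rewrite (path_clamp1 p2).
have KX t : X (K t).
  by rewrite /K; case: ifP => _; [exact: glue2_in p1 p2|exact: path_in p3].
have K0 : K 0 = x by rewrite /K /glue2 ler0n ler01 (path_clamp0 p1).
have K3 : K 3 = w.
  rewrite /K; have -> : (3 <= 2 :> R) = false by rewrite leNgt ltr_nat.
  by have -> : 3 - 2 = 1 :> R by [lra]; rewrite (path_clamp1 p3).
have := @homotopic_factor R B X K 0 3 (fun t => if t <= 2^-1 then 4 * t + 0 else 2 * t + 1)
  (fun t => if t <= 2^-1 then 2 * t + 0 else 4 * t + -1) cK KX.
rewrite K0 K3 => H; apply: homotopic_eq (H _ _ _ _ _ _) _ _.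
- by apply: piecewise_affine_continuous; lra.
- by apply: piecewise_affine_continuous; lra.
- by rewrite invr_ge0 ler0n mulr0 addr0.
- by rewrite half_lt1; lra.
- by rewrite invr_ge0 ler0n mulr0 addr0.
- by rewrite half_lt1; lra.
- move=> t t01 /=; rewrite [RHS]/path_concat; case: ifPn => t2.
    rewrite path_concatE; last lra.
    rewrite /K ifT; last lra.
    by congr glue2; lra.
  rewrite -ltNge in t2; rewrite /K ifF; last by apply/negbTE; rewrite -ltNge; lra.
  by congr g3; rewrite clamp_id; lra.
- move=> t t01 /=; rewrite [RHS]/path_concat; case: ifPn => t2.
    rewrite /K ifT; last lra.
    rewrite /glue2 ifT; last lra.
    by congr g1; rewrite clamp_id; lra.
  rewrite -ltNge in t2; rewrite /K.
  have e1 : (4 * t + -1 <= 2) = (2 * t - 1 <= 2^-1) by apply/idP/idP => ?; lra.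
  rewrite e1 /path_concat; case: ifPn => t3.
    rewrite /glue2 ifF; last by apply/negbTE; rewrite -ltNge; lra.
    by congr g2; rewrite clamp_id; lra.
  rewrite -ltNge in t3.
  by congr g3; rewrite clamp_id; lra.
Qed.

Lemma homotopic_cancelr X x y z g1 g2 : is_path X x y g1 -> is_path X y z g2 ->
  homotopic X x y (path_concat (path_concat g1 g2) (path_reverse g2)) g1.
Proof.
move=> p1 p2; have cK := glue2_continuous p1 p2.
have K0 : glue2 g1 g2 0 = x by rewrite /glue2 ler01 (path_clamp0 p1).
have K1 : glue2 g1 g2 1 = y by rewrite /glue2 lexx (path_clamp1 p1).
(* The parameter runs from 0 to 2 and back to 1, and is compared with the direct run from 0 to 1. *)
have := @homotopic_factor R B X (glue2 g1 g2) 0 1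
  (fun t => if t <= 2^-1 then 4 * t + 0 else - 2 * t + 3) id cK (fun t => glue2_in t p1 p2).
rewrite K0 K1 => H; apply: homotopic_eq (H _ _ _ _ _ _) _ _ => //.
- by apply: piecewise_affine_continuous; lra.
- by move=> t; exact: cvg_id.
- by rewrite invr_ge0 ler0n mulr0 addr0.
- by rewrite half_lt1; lra.
- move=> t t01 /=; rewrite [RHS]/path_concat; case: ifPn => t2.
    by rewrite path_concatE; [congr glue2; lra|lra].
  rewrite -ltNge in t2; rewrite /path_reverse /glue2.
  case: ifPn => t3.
    have t1 : t = 1 by lra.
    rewrite t1; have -> : 1 - (2 * 1 - 1) = 0 :> R by lra.
    have -> : - 2 * 1 + 3 = 1 :> R by lra.
    by rewrite (path_clamp1 p1) -(path_clamp0 p2) clamp_id // lexx ler01.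
  rewrite -ltNge in t3.
  by congr g2; rewrite clamp_id; lra.
- by move=> t t01 /=; rewrite /glue2; case/andP: (t01) => _ ->; rewrite clamp_id.
Qed.

Lemma homotopic_cancell X x y z g1 g2 : is_path X x y g1 -> is_path X x z g2 ->
  homotopic X x z (path_concat g1 (path_concat (path_reverse g1) g2)) g2.
Proof.
move=> p1 p2; have pr := is_path_reverse p1.
have cK := glue2_continuous pr p2.
have K1 : glue2 (path_reverse g1) g2 1 = x by rewrite /glue2 lexx (path_clamp1 pr).
have K2 : glue2 (path_reverse g1) g2 2 = z.
  rewrite /glue2; have -> : (2 <= 1 :> R) = false by rewrite leNgt ltr1n.
  by have -> : 2 - 1 = 1 :> R by [lra]; rewrite (path_clamp1 p2).
have := @homotopic_factor R B X (glue2 (path_reverse g1) g2) 1 2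
  (fun t => if t <= 2^-1 then - 2 * t + 1 else 4 * t + -2) (fun t => 1 * t + 1) cK (fun t => glue2_in t pr p2).
rewrite K1 K2 => H; apply: homotopic_eq (H _ _ _ _ _ _) _ _ => //.
- by apply: piecewise_affine_continuous; lra.
- exact: affine_continuous.
- by rewrite invr_ge0 ler0n mulr0 add0r.
- by rewrite half_lt1; lra.
- by lra.
- by lra.
- move=> t t01 /=; rewrite [RHS]/path_concat; case: ifPn => t2.
    rewrite /glue2 ifT; last lra.
    by rewrite /path_reverse clamp_id; [congr g1; lra|lra].
  rewrite -ltNge in t2.
  by rewrite path_concatE; [congr glue2; lra|lra].
- move=> t t01 /=; rewrite /glue2; case: ifPn => t3.
    have -> : t = 0 by lra.
    by rewrite mul1r add0r (path_clamp1 pr) -(path_clamp0 p2) clamp_id // lexx ler01.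
  by congr g2; rewrite clamp_id; lra.
Qed.

Lemma homotopic_subpath X x y g a b c : is_path X x y g ->
  0 <= a -> a <= b -> b <= c -> c <= 1 ->
  homotopic X (g a) (g c) (path_concat (subpath g a b) (subpath g b c)) (subpath g a c).
Proof.
move=> p a0 ab bc c1.
have := @homotopic_factor R B X (g \o @clamp R) a c
  (fun t => if t <= 2^-1 then (2 * (b - a)) * t + a else (2 * (c - b)) * t + (2 * b - c))
  (fun t => (c - a) * t + a) (path_clamp p) (fun t => path_in t p).
rewrite /= !clamp_id; try lra.
move=> H; apply: homotopic_eq (H _ _ _ _ _ _) _ _.
- by apply: piecewise_affine_continuous; lra.
- exact: affine_continuous.
- by rewrite invr_ge0 ler0n mulr0 add0r.
- by rewrite half_lt1; lra.
- by lra.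
- by lra.
- move=> t t01 /=; rewrite /path_concat /subpath; case: ifPn => t2.
    by congr g; rewrite clamp_id; [ring|nra].
  rewrite -ltNge in t2.
  by congr g; rewrite clamp_id; [ring|nra].
- by move=> t t01 /=; rewrite /subpath clamp_id //; nra.
Qed.

End groupoid.

Section induction.
Variable R : realType.

(** Cousin's lemma, proved with the supremum of the [t] such that [P 0 t]. The local hypothesis
    concerns only intervals having the tag as an end point, so the two sides of a tag can be treated
    separately. *)
Lemma interval_tagged_induction (T : R) (P : R -> R -> Prop) : 0 <= T ->
  (forall a b c, 0 <= a -> a <= b -> b <= c -> c <= T -> P a b -> P b c -> P a c) ->
  (forall t, 0 <= t <= T -> exists2 dl, 0 < dl &
    (forall a, 0 <= a -> a <= t -> t - dl < a -> P a t) /\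
    (forall b, t <= b -> b <= T -> b < t + dl -> P t b)) ->
  P 0 T.
Proof.
move=> T0 Padd Ploc.
pose S := [set t | 0 <= t <= T /\ P 0 t].
have S0 : S 0.
  split; first by rewrite lexx T0.
  have [|dl dl0 [H _]] := Ploc 0; first by rewrite lexx T0.
  by apply: H => //; lra.
have hS : has_sup S by split; [exists 0|exists T => t [/andP[]]].
set s := sup S.
have s0 : 0 <= s by apply: ub_le_sup; [case: hS|].
have s1 : s <= T by apply: ge_sup; [case: hS|move=> t [/andP[]]].
have [|dl dl0 [Hl Hr]] := Ploc s; first by rewrite s0.
have [a [/andP[a0 a1] Pa] sa] := sup_adherent dl0 hS.
have as_ : a <= s by apply: ub_le_sup; [case: hS|split => //; rewrite a0].
have Ps : P 0 s by apply: (Padd 0 a s) => //; exact: Hl.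
have [s_eq1|s_lt1] : s = T \/ s < T by move: s1; rewrite le_eqVlt => /predU1P; tauto.
  by rewrite -s_eq1.
pose b := Num.min T (s + dl / 2).
have b1 : b <= T by rewrite ge_min lexx.
have sb : s < b by rewrite lt_min s_lt1 /=; lra.
have bdl : b < s + dl by rewrite gt_min; apply/orP; right; lra.
have Pb : P 0 b by apply: (Padd 0 s b) => //; [exact: ltW|apply: Hr => //; exact: ltW].
have : b <= s by apply: ub_le_sup; [case: hS|split => //; rewrite b1 andbT; lra].
by rewrite leNgt sb.
Qed.

End induction.

(** * Charts *)

Section complex_chain.
Variable R : realType.
Notation C := (Cplx R).

Lemma has_cderive_comp (f g : C -> C) z l k :
  has_cderive f (g z) l -> has_cderive g z k -> has_cderive (f \o g) z (l * k).
Proof.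
move=> Df Dg e e0.
pose A := normc k + 1; pose L := normc l + 1.
have A0 : 0 < A by rewrite ltr_wpDl ?normc_ge0.
have L0 : 0 < L by rewrite ltr_wpDl ?normc_ge0.
have [d1 d10 H1] := Df _ (divr_gt0 e0 (mulr_gt0 (ltr0n R 2) A0)).
have [d2 d20 H2] := Dg _ (divr_gt0 e0 (mulr_gt0 (ltr0n R 2) L0)).
have [d3 d30 H3] := Dg _ ltr01.
exists (Num.min (Num.min d2 d3) (d1 / A)); first by rewrite !lt_min d20 d30 divr_gt0.
move=> h; rewrite !lt_min -andbA => /and3P[hd2 hd3 hd1].
set dg := g (z + h) - g z.
have nh := normc_ge0 h.
have ndg : normc dg <= A * normc h.
  have -> : dg = (dg - k * h) + k * h by rewrite subrK.
  apply: le_trans (le_normcD _ _) _; rewrite normcM /A mulrDl addrC lerD2l.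
  exact: H3.
have dgd : normc dg < d1.
  by apply: le_lt_trans ndg _; rewrite mulrC -ltr_pdivlMr.
have := H1 _ dgd; rewrite /dg subrKC -/dg => h1.
have h2 := H2 _ hd2.
have -> : (f \o g) (z + h) - (f \o g) z - l * k * h =
    (f (g (z + h)) - f (g z) - l * dg) + l * (dg - k * h) by rewrite /=; ring.
apply: le_trans (le_normcD _ _) _; rewrite normcM.
have h3 : e / (2 * A) * normc dg <= e / 2 * normc h.
  apply: le_trans (ler_wpM2l _ ndg) _; first by rewrite ltW // divr_gt0 // mulr_gt0.
  rewrite le_eqVlt; apply/orP; left; apply/eqP; field.
  exact: lt0r_neq0.
have h4 : normc l * normc (dg - k * h) <= e / 2 * normc h.
  apply: le_trans (ler_wpM2l (normc_ge0 _) h2) _.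
  apply: (@le_trans _ _ (L * (e / (2 * L) * normc h))).
    apply: ler_wpM2r; first by rewrite mulr_ge0 // ltW // divr_gt0 // mulr_gt0.
    by rewrite /L lerDl.
  rewrite le_eqVlt; apply/orP; left; apply/eqP; field.
  exact: lt0r_neq0.
by move: (le_trans h1 h3) => h5; lra.
Qed.

Lemma slope_atE (f : C -> C) (a z : C) : f z - f a = slope_at f a z * (z - a).
Proof.
rewrite /slope_at; case: eqP => [->|/sub_neq0 za]; first by rewrite !subrr mulr0.
by rewrite divfK.
Qed.

(** The chain rule in Caratheodory's form: the difference quotient is [slope_at] at the moving
    point, which is continuous, times the quotient of [phi]. *)
Lemma curve_chain (f : C -> C) (phi : R -> R * R) (t : R) (v : R * R) :
  is_derive t 1 phi v -> derivable f (to_complex (phi t)) 1 ->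
  is_derive t 1 (fun s => of_complex (f (to_complex (phi s))) : (R * R)%type)
    (of_complex ('D_1 f (to_complex (phi t)) * to_complex v)).
Proof.
move=> dphi df; have cphi := is_derive_continuous dphi.
set w := to_complex (phi t); set F := (fun s : R => _).
have L : h^-1 *: ((F \o shift t) (h *: 1) - F t) @[h --> (0:R)^'] -->
    of_complex ('D_1 f w * to_complex v).
  have -> : (fun h => h^-1 *: ((F \o shift t) (h *: 1) - F t)) =
     (fun h => of_complex (slope_at f w (to_complex (phi (h *: 1 + t))) *
        to_complex (h^-1 *: ((phi \o shift t) (h *: 1) - phi t)))).
    apply/funext => h /=; rewrite /F -of_complexB slope_atE -/w -to_complexB.
    rewrite /GRing.scale /=; set a := slope_at _ _ _; set b := (_ - _ : R * R).
    by case: a b => [a1 a2] [b1 b2]; rewrite /of_complex /to_complex /=; congr (_, _);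
      rewrite /GRing.scale /=; ring.
  have h1 : h^-1 *: ((phi \o shift t) (h *: 1) - phi t) @[h --> (0:R)^'] --> v.
    by have [d <-] := dphi; exact: d.
  have h2 : to_complex (h^-1 *: ((phi \o shift t) (h *: 1) - phi t)) @[h --> (0:R)^'] --> (to_complex v : C).
    by apply: continuous_cvg h1; exact: to_complex_continuous.
  have h3 : (h *: 1 + t) @[h --> (0:R)^'] --> t.
    have c : {for 0, continuous (fun h : R => h * 1 + t)}.
      have m : {for (0 : R), continuous (fun h : R => h * 1)} by exact: mulrr_continuous.
      exact: (cvgD m (cvg_cst t)).
    have e : (fun h : R => h * 1 + t) 0 = t by rewrite mul0r add0r.
    move: c; rewrite /prop_for /continuous_at e => c'.
    by apply: cvg_trans c'; apply: cvg_app; exact: nbhs_dnbhs.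
  have h4 : slope_at f w (to_complex (phi (h *: 1 + t))) @[h --> (0:R)^'] --> 'D_1 f w.
    have c : {for t, continuous (fun s => slope_at f w (to_complex (phi s)))}.
      have c1 := continuous_comp cphi (@to_complex_continuous R (phi t)).
      exact: (continuous_comp c1 (slope_continuous df)).
    have -> : 'D_1 f w = slope_at f w (to_complex (phi t)) by rewrite /slope_at eqxx.
    by move=> A HA; exact: (h3 _ (c A HA)).
  have h5 := @cvgM (complex R) R _ _ _ _ _ _ h4 h2.
  by move=> A HA; exact: (h5 _ _ (@of_complex_continuous R _ A HA)).
by apply: DeriveDef; [apply/cvg_ex; eexists; exact: L|exact: cvg_lim L].
Qed.

Lemma is_derive_fst (F : R -> R * R) (t : R) (l : R * R) :
  is_derive t 1 F l -> is_derive t 1 (fun s => (F s).1) l.1.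
Proof.
move=> [d <-].
have L : h^-1 *: (((fun s => (F s).1) \o shift t) (h *: 1) - (F t).1) @[h --> (0:R)^'] --> ('D_1 F t).1.
  by move=> A HA; exact: (d _ (@fst_continuous R R _ A HA)).
by apply: DeriveDef; [apply/cvg_ex; eexists; exact: L|exact: cvg_lim L].
Qed.

Lemma is_derive_snd (F : R -> R * R) (t : R) (l : R * R) :
  is_derive t 1 F l -> is_derive t 1 (fun s => (F s).2) l.2.
Proof.
move=> [d <-].
have L : h^-1 *: (((fun s => (F s).2) \o shift t) (h *: 1) - (F t).2) @[h --> (0:R)^'] --> ('D_1 F t).2.
  by move=> A HA; exact: (d _ (@snd_continuous R R _ A HA)).
by apply: DeriveDef; [apply/cvg_ex; eexists; exact: L|exact: cvg_lim L].
Qed.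

End complex_chain.

Section charts.
Variables (R : realType) (B : topologicalType) (M : riemann_surface R B).
Notation C := (Cplx R).
Implicit Types (p q x : B) (z : R * R).

(** Charts are read in [R * R], whose norm is the sup norm: its balls are squares, with sides along
    the coordinates. *)
Definition cinv q z : B := chart_inv M q (to_complex z).
Definition coord q x : R * R := of_complex (chart M q x).
Definition chart_image q : set (R * R) :=
  [set z | (chart M q @` chart_dom M q) (to_complex z)].

Lemma chart_image_open q : open (chart_image q).
Proof.
have := @chart_open R B M q; rewrite !openE => o z /o.
exact: (@to_complex_continuous R z).
Qed.

Lemma coordK q x : chart_dom M q x -> cinv q (coord q x) = x.
Proof. by move=> dx; rewrite /cinv /coord of_complexK chartK. Qed.

Lemma chart_image_coord q x : chart_dom M q x -> chart_image q (coord q x).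
Proof. by move=> dx; rewrite /chart_image /= of_complexK; exists x. Qed.

Lemma cinv_dom q z : chart_image q z -> chart_dom M q (cinv q z).
Proof. by move=> [x dx xz]; rewrite /cinv -xz chartK. Qed.

Lemma chart_cinv q z : chart_image q z -> chart M q (cinv q z) = to_complex z.
Proof. by move=> [x dx xz]; rewrite /cinv -xz chartK. Qed.

Lemma cinvK q z : chart_image q z -> coord q (cinv q z) = z.
Proof. by move=> iz; rewrite /coord chart_cinv // to_complexK. Qed.

Lemma cinv_continuous q z : chart_image q z -> {for z, continuous (cinv q)}.
Proof.
move=> iz; exact: (continuous_comp (@to_complex_continuous R z) (chart_inv_continuous iz)).
Qed.

Lemma coord_continuous q x : chart_dom M q x -> {for x, continuous (coord q)}.
Proof.
move=> dx; exact: (continuous_comp (chart_continuous dx) (@of_complex_continuous R _)).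
Qed.

Lemma open_nbhs_dom q x : chart_dom M q x -> nbhs x (chart_dom M q).
Proof. by move=> dx; apply: open_nbhs_nbhs; split => //; exact: chart_dom_open. Qed.

Definition transition p q : C -> C := chart M q \o chart_inv M p.
Definition transition_dom p q : set C := chart M p @` (chart_dom M p `&` chart_dom M q).

Lemma transition_dom_open p q : open (transition_dom p q).
Proof.
rewrite openE => z [x [px qx] xz].
have iz : (chart M p @` chart_dom M p) z by exists x.
have n1 : nbhs z (chart M p @` chart_dom M p) by apply: open_nbhs_nbhs; split => //; exact: chart_open.
have n2 : nbhs z [set w | chart_dom M q (chart_inv M p w)].
  by apply: (chart_inv_continuous iz); apply: open_nbhs_dom; rewrite -xz chartK.
apply: filterS2 n1 n2 => w [y py yw] /= qw; exists y => //; split => //.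
by move: qw; rewrite -yw chartK.
Qed.

Lemma transition_derivable p q (z : C) : transition_dom p q z -> derivable (transition p q) z 1.
Proof. exact: transition_holomorphic. Qed.

Lemma transition_dom_chart p q x : chart_dom M p x -> chart_dom M q x ->
  transition_dom p q (chart M p x).
Proof. by move=> px qx; exists x. Qed.

(** The two transitions are mutually inverse, so the product of their derivatives is 1. *)
Lemma transition_derive_neq0 p q x : chart_dom M p x -> chart_dom M q x ->
  'D_1 (transition p q) (chart M p x) != 0.
Proof.
move=> px qx; set w := chart M p x.
have Dw : has_cderive (transition p q) w ('D_1 (transition p q) w).
  by apply: derivable_has_cderive; apply: transition_derivable; exact: transition_dom_chart.
have E : transition p q w = chart M q x by rewrite /transition /= /w chartK.
have Dv : has_cderive (transition q p) (transition p q w) ('D_1 (transition q p) (transition p q w)).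
  by apply: derivable_has_cderive; rewrite E; apply: transition_derivable; exact: transition_dom_chart.
have D1 := has_cderive_comp Dv Dw.
have D2 : has_cderive (transition q p \o transition p q) w 1.
  apply: eq_has_cderive (has_cderive_id w).
  have : nbhs w (transition_dom p q).
    by apply: open_nbhs_nbhs; split; [exact: transition_dom_open|exact: transition_dom_chart].
  by apply: filterS => v [y [py qy] <-]; rewrite /transition /= chartK // chartK.
have := has_cderive_val D1; rewrite (has_cderive_val D2) => h.
by apply: contra (oner_neq0 C) => /eqP e; rewrite h e mulr0.
Qed.

Definition local_coord (gamma : R -> B) p (f : R -> R * R) (t : R) :=
  \forall s \near t, chart_dom M p (gamma s) /\ chart M p (gamma s) = to_complex (f s).

Lemma local_coord_self gamma p f t : local_coord gamma p f t ->
  chart_dom M p (gamma t) /\ chart M p (gamma t) = to_complex (f t).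
Proof. exact: nbhs_singleton. Qed.

Lemma local_coord_continuous gamma p f t : local_coord gamma p f t ->
  {for t, continuous f} -> {for t, continuous gamma}.
Proof.
move=> lc cf; have [dt et] := local_coord_self lc.
have it : chart_image p (f t) by exists (gamma t).
have e : gamma t = cinv p (f t) by rewrite /cinv -et chartK.
have c := continuous_comp cf (cinv_continuous it).
rewrite /prop_for /continuous_at e; apply: cvg_trans c.
apply: near_eq_cvg; apply: filterS lc => s [ds es].
by rewrite /= /cinv -es chartK.
Qed.

Lemma local_coord_change gamma p q f t v : local_coord gamma p f t ->
  is_derive t 1 f v -> chart_dom M q (gamma t) ->
  local_coord gamma q (coord q \o gamma) t /\
  is_derive t 1 (coord q \o gamma)
    (of_complex ('D_1 (transition p q) (to_complex (f t)) * to_complex v)).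
Proof.
move=> lc df qt; have cg := local_coord_continuous lc (is_derive_continuous df).
have [dt et] := local_coord_self lc.
have lq : \forall s \near t, chart_dom M q (gamma s).
  exact: (cg _ (open_nbhs_dom qt)).
split.
  by apply: filterS lq => s ds; rewrite /= /coord of_complexK.
have dT : derivable (transition p q) (to_complex (f t)) 1.
  by rewrite -et; apply: transition_derivable; exact: transition_dom_chart.
have D := curve_chain df dT.
apply: near_eq_is_derive D.
by apply: filterS lc => s [ds es]; rewrite /= /coord /transition -es /= chartK.
Qed.

(** [velocity] refers to the chart attached to [gamma t], which varies with [t]; this formula allows
    one chart to serve for a whole stretch of the curve. *)
Lemma velocity_chart gamma p f t v : local_coord gamma p f t -> is_derive t 1 f v ->
  velocity M gamma t =
    'D_1 (transition p (gamma t)) (to_complex (f t)) * to_complex v.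
Proof.
move=> lc df.
have [_ D] := local_coord_change lc df (chart_dom_self M (gamma t)).
have D1 := is_derive_fst D; have D2 := is_derive_snd D.
set X := _ * _ in D1 D2 *.
have XE : X = Complex (of_complex X).1 (of_complex X).2 by case: X {D D1 D2}.
rewrite XE /velocity !derive1E; congr Complex.
  by case: D1 => _; exact.
by case: D2 => _; exact.
Qed.

End charts.

Lemma near_norm_ball (R : numFieldType) (V : normedModType R) (x : V) (P : set V) :
  nbhs x P -> exists2 r : R, 0 < r & forall y, `|x - y| < r -> P y.
Proof.
move=> /(@nbhs_ballP R V)[r /= r0 H]; exists r => // y xy; apply: H.
by rewrite -ball_normE.
Qed.

(** * Small metric discs in charts *)

Section metric_chart.
Variables (R : realType) (B : topologicalType) (M : riemann_surface R B).
Variable d : riemannian_metric M.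
Notation C := (Cplx R).
Implicit Types (p q x : B) (z : R * R) (u v w : C).

(** The metric in the coordinates of the chart at [q], written exactly as in [metric_smooth], from
    which its continuity is read off. *)
Definition gchart q z u v : R :=
  let x := cinv M q z in
  let D := 'D_1 (transition M q x) (to_complex z) in
  metric d x (D * u) (D * v).

Lemma gchart_continuous q u v z : chart_image M q z ->
  {for z, continuous (fun y : R * R => gchart q y u v)}.
Proof.
move=> iz; have /nbhs_singleton H := metric_smooth d u v iz.
by have [] := H [::].
Qed.

Lemma metric0l x w : metric d x 0 w = 0.
Proof.
have := metric_linear d x 1 0 0 w; rewrite mulr0 addr0 mul1r => /eqP.
by rewrite -subr_eq0 opprD addrA subrr sub0r oppr_eq0 => /eqP.
Qed.

Lemma metric_linl x (a b : R) u v w :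
  metric d x (Complex a 0 * u + Complex b 0 * v) w = a * metric d x u w + b * metric d x v w.
Proof.
rewrite metric_linear; congr (_ + _).
by have := metric_linear d x b v 0 w; rewrite addr0 metric0l addr0.
Qed.

Lemma metric_quadratic x (a b : R) u v :
  let w := Complex a 0 * u + Complex b 0 * v in
  metric d x w w = a ^+ 2 * metric d x u u + 2 * a * b * metric d x u v + b ^+ 2 * metric d x v v.
Proof.
move=> w; rewrite {1}/w metric_linl.
rewrite (Defs.metric_sym d x u w) (Defs.metric_sym d x v w) /w !metric_linl.
by rewrite (Defs.metric_sym d x v u); ring.
Qed.

Lemma gchart_quadratic q z (c : R * R) : gchart q z (to_complex c) (to_complex c) =
  c.1 ^+ 2 * gchart q z 1 1 + 2 * c.1 * c.2 * gchart q z 1 (Complex 0 1)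
  + c.2 ^+ 2 * gchart q z (Complex 0 1) (Complex 0 1).
Proof.
rewrite /gchart -metric_quadratic; set D := derive _ _ _.
have -> // : D * to_complex c = Complex c.1 0 * (D * 1) + Complex c.2 0 * (D * Complex 0 1).
case: c D => [a b] [d1 d2]; apply/eqP; rewrite eq_complex /=.
by apply/andP; split; apply/eqP; ring.
Qed.

Lemma gchart_pos q z u : chart_image M q z -> u != 0 -> 0 < gchart q z u u.
Proof.
move=> iz u0; apply: metric_pos; rewrite mulf_neq0 //.
have dz := cinv_dom iz.
have := transition_derive_neq0 dz (chart_dom_self M (cinv M q z)).
by rewrite chart_cinv.
Qed.

(** Determinant over trace is a lower bound for the smaller eigenvalue of a positive symmetric
    matrix; after clearing the denominator the difference is a sum of two squares. *)
Lemma quadratic_pos (E F G : R) : 0 < E ->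
  (forall c : R * R, c != 0 -> 0 < c.1 ^+ 2 * E + 2 * c.1 * c.2 * F + c.2 ^+ 2 * G) ->
  exists2 mu, 0 < mu & forall c : R * R,
    mu * (c.1 ^+ 2 + c.2 ^+ 2) <= c.1 ^+ 2 * E + 2 * c.1 * c.2 * F + c.2 ^+ 2 * G.
Proof.
move=> E0 pos.
have G0 : 0 < G.
  have := pos (0, 1); rewrite /= expr0n mul0r add0r !mulr0 !mul0r add0r expr1n mul1r; apply.
  by apply/eqP => -[] /eqP; rewrite oner_eq0.
have det : 0 < E * G - F ^+ 2.
  have := pos (- F, E) => /= h.
  have {}h : 0 < E * (E * G - F ^+ 2).
    have -> : E * (E * G - F ^+ 2) = (- F) ^+ 2 * E + 2 * - F * E * F + E ^+ 2 * G by ring.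
    by apply: h; apply/eqP => -[_] e; move: E0; rewrite e ltxx.
  by move: h; rewrite pmulr_rgt0.
have EG : 0 < E + G by rewrite addr_gt0.
exists ((E * G - F ^+ 2) / (E + G)); first exact: divr_gt0.
move=> [a b] /=; rewrite mulrAC ler_pdivrMr // -subr_ge0.
have -> : (a ^+ 2 * E + 2 * a * b * F + b ^+ 2 * G) * (E + G) - (E * G - F ^+ 2) * (a ^+ 2 + b ^+ 2)
  = (a * E + b * F) ^+ 2 + (a * F + b * G) ^+ 2 by ring.
by rewrite addr_ge0 // sqr_ge0.
Qed.

Lemma continuous_near_le (T : topologicalType) (f : T -> R) (x : T) (e : R) :
  {for x, continuous f} -> 0 < e -> \forall y \near x, `|f y - f x| <= e.
Proof.
move=> /cvgrPdist_le cf e0; have := cf _ e0.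
by apply: filterS => y; rewrite distrC.
Qed.

(** At [z0] the form is at least [mu] times the squared Euclidean length. Letting its three
    coefficients vary by [mu / 4] loses at most half of this, by [2 |a| |b| <= a^2 + b^2]. *)
Lemma gchart_lower_bound q z0 : chart_image M q z0 -> exists m sg : R, [/\ 0 < m, 0 < sg &
  forall z, `|z0 - z| <= sg -> chart_image M q z /\
    forall c : R * R, m * `|c| <= Num.sqrt (gchart q z (to_complex c) (to_complex c))].
Proof.
move=> iz0.
have tc0 (c : R * R) : c != 0 -> to_complex c != 0.
  by case: c => a b; apply: contra => /eqP [-> ->].
have [||mu mu0 Hmu] := @quadratic_pos (gchart q z0 1 1) (gchart q z0 1 (Complex 0 1))
    (gchart q z0 (Complex 0 1) (Complex 0 1)).
- by apply: gchart_pos => //; exact: oner_neq0.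
- by move=> c c0; rewrite -gchart_quadratic; apply: gchart_pos => //; exact: tc0.
have mu4 : 0 < mu / 4 by rewrite divr_gt0.
have n1 := continuous_near_le (@gchart_continuous q 1 1 _ iz0) mu4.
have n2 := continuous_near_le (@gchart_continuous q 1 (Complex 0 1) _ iz0) mu4.
have n3 := continuous_near_le (@gchart_continuous q (Complex 0 1) (Complex 0 1) _ iz0) mu4.
have n4 : nbhs z0 (chart_image M q) by apply: open_nbhs_nbhs; split => //; exact: chart_image_open.
have [r r0 H] := near_norm_ball (filterI (filterI n1 n2) (filterI n3 n4)).
exists (Num.sqrt (mu / 2)), (r / 2); split; [by rewrite sqrtr_gt0 divr_gt0|by rewrite divr_gt0|].
move=> z zr; have [|[h1 h2] [h3 h4]] := H z.
  by lra.
split => // c.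
have n0 : 0 <= `|c| by [].
rewrite -[X in _ * X]ger0_norm // -sqrtr_sqr -sqrtrM ?divr_ge0 ?(ltW mu0) // ler_wsqrtr //.
have := Hmu c; rewrite gchart_quadratic.
have c12 : `|c| ^+ 2 <= c.1 ^+ 2 + c.2 ^+ 2.
  rewrite prod_normE /=; case: (leP `|c.1| `|c.2|) => _; rewrite -normrX ger0_norm ?sqr_ge0 //.
    by rewrite lerDr sqr_ge0.
  by rewrite lerDl sqr_ge0.
move: h1 h2 h3; set e1 := gchart q z 1 1; set e2 := gchart q z0 1 1.
set f1 := gchart q z 1 _; set f2 := gchart q z0 1 _.
set g1 := gchart q z (Complex 0 1) _; set g2 := gchart q z0 (Complex 0 1) _.
move: c12; set N := `|c| ^+ 2; case: c {n0} N => a b N /= c12.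
rewrite !ler_norml => /andP[h1 h1'] /andP[h2 h2'] /andP[h3 h3'] Q.
have a2 := sqr_ge0 a; have b2 := sqr_ge0 b.
have k1 : a ^+ 2 * (- (mu / 4)) <= a ^+ 2 * (e1 - e2) by rewrite ler_wpM2l.
have k3 : b ^+ 2 * (- (mu / 4)) <= b ^+ 2 * (g1 - g2) by rewrite ler_wpM2l.
have k2 : - (2 * (mu / 4)) * (`|a| * `|b|) <= 2 * a * b * (f1 - f2).
  have : `|2 * a * b * (f1 - f2)| <= 2 * (mu / 4) * (`|a| * `|b|).
    have hf : `|f1 - f2| <= mu / 4 by rewrite ler_norml h2 h2'.
    have ab0 : 0 <= `|a| * `|b| by rewrite mulr_ge0.
    by have := ler_wpM2l ab0 hf; rewrite !normrM normr_nat; lra.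
  by rewrite ler_norml mulNr => /andP[].
have k4 : 2 * (`|a| * `|b|) <= a ^+ 2 + b ^+ 2.
  rewrite -subr_ge0 -[a ^+ 2]ger0_norm // -[b ^+ 2]ger0_norm // !normrX.
  have -> : `|a| ^+ 2 + `|b| ^+ 2 - 2 * (`|a| * `|b|) = (`|a| - `|b|) ^+ 2 by ring.
  exact: sqr_ge0.
have k5 : mu * (2 * (`|a| * `|b|)) <= mu * (a ^+ 2 + b ^+ 2) by rewrite ler_pM2l.
have k6 : mu * N <= mu * (a ^+ 2 + b ^+ 2) by rewrite ler_pM2l.
lra.
Qed.

Definition speed (gamma : R -> B) (t : R) : R := metric_norm d (gamma t) (velocity M gamma t).

Lemma speed_chart gamma p (f : R -> R * R) t (v : R * R) : local_coord M gamma p f t ->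
  is_derive t 1 f v ->
  speed gamma t = Num.sqrt (gchart p (f t) (to_complex v) (to_complex v)).
Proof.
move=> lc df; rewrite /speed /metric_norm (velocity_chart lc df) /gchart.
have [dt et] := local_coord_self lc.
by rewrite /cinv -et chartK.
Qed.

End metric_chart.

(** * Bounding length from below by displacement *)

Section lower_integral.
Variable R : realType.
Notation mu := (@lebesgue_measure R).

(* No measurability is assumed: the integral of a nonnegative function is a
   supremum over the simple functions below it. *)
Lemma le_integral_nonneg (D : set R) (f g : R -> \bar R) :
  (forall x, D x -> 0 <= f x)%E -> (forall x, D x -> f x <= g x)%E ->
  (\int[mu]_(x in D) f x <= \int[mu]_(x in D) g x)%E.
Proof.
move=> f0 fg; have g0 x : D x -> (0 <= g x)%E.
  by move=> Dx; exact: le_trans (f0 _ Dx) (fg _ Dx).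
rewrite !ge0_integralE //; apply: le_ereal_sup => _ [h hf <-]; exists h => // x.
apply: le_trans (hf x) _; rewrite /patch; case: ifPn => //.
by rewrite inE => /fg.
Qed.

Lemma integral_step (a b c : R) : a <= b -> 0 <= c ->
  (\int[mu]_x (c * \1_(`]a, b[%classic) x)%:E = (c * (b - a))%:E)%E.
Proof.
move=> ab c0; transitivity (\int[mu]_(x in `]a, b[%classic) (cst c%:E x))%E.
  rewrite [RHS]integral_mkcond; apply: eq_integral => x _.
  by rewrite patchE indicE; case: ifPn => _; rewrite /= ?mulr1 ?mulr0.
rewrite integral_cst //= lebesgue_measure_itv /= lte_fin.
have [altb|blta|->] := ltgtP a b.
- by rewrite -EFinD -EFinM.
- by move: ab; rewrite leNgt blta.
- by rewrite mule0 subrr mulr0.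
Qed.

End lower_integral.

Section length.
Variables (R : realType) (B : topologicalType) (M : riemann_surface R B).
Variable d : riemannian_metric M.
Notation C := (Cplx R).
Notation mu := (@lebesgue_measure R).

Variables (gamma : R -> B) (q : B) (m : R) (prj : R * R -> R).
Hypothesis m0 : 0 < m.
Hypothesis prj_derive : forall (F : R -> R * R) (t : R) (l : R * R),
  is_derive t 1 F l -> is_derive t 1 (prj \o F) (prj l).
Hypothesis prj_le : forall c : R * R, `|prj c| <= `|c|.

Let u (s : R) : R := prj (coord M q (gamma s)).

Definition metric_at_least (x : B) : Prop := chart_dom M q x /\
  forall c : R * R, m * `|c| <=
    Num.sqrt (gchart d q (coord M q x) (to_complex c) (to_complex c)).

Lemma speed_ge0 s : 0 <= speed d gamma s.
Proof. exact: sqrtr_ge0. Qed.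

Lemma speed_lower_bound p (f : R -> R * R) s v : local_coord M gamma p f s ->
  is_derive s 1 f v -> metric_at_least (gamma s) ->
  exists2 k, is_derive s 1 u k & m * `|k| <= speed d gamma s.
Proof.
move=> lc df [dq mq].
have [lq dq'] := local_coord_change lc df dq.
exists (prj (of_complex ('D_1 (transition M p q) (to_complex (f s)) * to_complex v))).
  exact: prj_derive dq'.
rewrite (speed_chart d lq dq').
by apply: le_trans (mq _); rewrite ler_pM2l.
Qed.

Lemma chart_speed_continuous p (f : R -> R * R) t : smooth_at f t -> chart_image M p (f t) ->
  {for t, continuous (fun s => Num.sqrt (gchart d p (f s) (to_complex ('D_1 f s)) (to_complex ('D_1 f s))))}.
Proof.
move=> /nbhs_singleton sf ip.
have [cf _] := sf [::]; have [cdf _] := sf [:: 1].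
have c1 : {for t, continuous (fun s => ('D_1 f s).1)}.
  by apply: continuous_comp; [exact: cdf|exact: fst_continuous].
have c2 : {for t, continuous (fun s => ('D_1 f s).2)}.
  by apply: continuous_comp; [exact: cdf|exact: snd_continuous].
have cg y w : {for t, continuous (fun s => gchart d p (f s) y w)}.
  exact: (continuous_comp cf (@gchart_continuous _ _ _ d p y w _ ip)).
have cq : {for t, continuous (fun s => gchart d p (f s) (to_complex ('D_1 f s)) (to_complex ('D_1 f s)))}.
  have -> : (fun s => gchart d p (f s) (to_complex ('D_1 f s)) (to_complex ('D_1 f s))) =
    (fun s => ('D_1 f s).1 * ('D_1 f s).1 * gchart d p (f s) 1 1 +
       2 * ('D_1 f s).1 * ('D_1 f s).2 * gchart d p (f s) 1 (Complex 0 1) +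
       ('D_1 f s).2 * ('D_1 f s).2 * gchart d p (f s) (Complex 0 1) (Complex 0 1)).
    by apply/funext => s; rewrite gchart_quadratic !expr2.
  have cM (h k : R -> R) : {for t, continuous h} -> {for t, continuous k} ->
    {for t, continuous (fun s => h s * k s)} by move=> ch ck; exact: cvgM.
  have cD (h k : R -> R) : {for t, continuous h} -> {for t, continuous k} ->
    {for t, continuous (fun s => h s + k s)} by move=> ch ck; exact: cvgD.
  have c0 : {for t, continuous (fun=> 2 : R)} by exact: cvg_cst.
  exact: (cD _ _ (cD _ _ (cM _ _ (cM _ _ c1 c1) (cg _ _)) (cM _ _ (cM _ _ (cM _ _ c0 c1) c2) (cg _ _)))
    (cM _ _ (cM _ _ c2 c2) (cg _ _))).
exact: (continuous_comp cq (@sqrt_continuous R _)).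
Qed.

(* Stands for the inequality between length and displacement: a minorant of the
   speed suffices, so the speed need not be shown measurable. *)
Definition almost_length (e a b : R) : Prop := exists g : R -> R,
  [/\ measurable_fun [set: R] g,
      forall x, 0 <= g x,
      forall x, g x <= (if a < x < b then speed d gamma x else 0) &
      ((m * `|u b - u a| - 2 * e * (b - a))%:E <= \int[mu]_x (g x)%:E)%E].

Lemma almost_length_refl e a : almost_length e a a.
Proof.
exists (fun=> 0); split => //.
  by move=> x; case: ifP => // _; exact: speed_ge0.
by rewrite !subrr normr0 !mulr0 subr0 integral0.
Qed.

Lemma almost_length_add e a b c : a <= b -> b <= c ->
  almost_length e a b -> almost_length e b c -> almost_length e a c.
Proof.
move=> ab bc [g [mg g0 gs gi]] [h [mh h0 hs hi]].
exists (fun x => g x + h x); split.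
- exact: measurable_funD.
- by move=> x; rewrite addr_ge0.
- move=> x; have := gs x; have := hs x; have := g0 x; have := h0 x; have := speed_ge0 x.
  have [ax|ax] := ltP a x; have [xb|xb] := ltP x b; have [bx|bx] := ltP b x;
    have [xc|xc] := ltP x c => /=; lra.
- under eq_integral do rewrite EFinD.
  rewrite ge0_integralD //; first last.
  + exact/measurable_EFinP.
  + by move=> x _; rewrite lee_fin.
  + exact/measurable_EFinP.
  + by move=> x _; rewrite lee_fin.
  apply: le_trans (leeD gi hi); rewrite -EFinD lee_fin.
  have : m * `|u c - u a| <= m * (`|u b - u a| + `|u c - u b|).
    rewrite ler_pM2l //; have -> : u c - u a = (u b - u a) + (u c - u b) by ring.
    exact: ler_normD.
  lra.
Qed.

(** The speed stays within [e] of the constant [S]. By the mean value theorem [m] times the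
    displacement is at most [(S + e) * (b - a)], and the step function of height [S - e], or 0 if
    this is negative, lies below the speed; the gap is [2 * e * (b - a)]. *)
Lemma almost_length_smooth (e a b : R) p (f : R -> R * R) (S : R) :
  0 < e -> a < b -> {within `[a, b], continuous u} ->
  (forall s, a < s < b -> local_coord M gamma p f s /\ derivable f s 1) ->
  (forall s, a < s < b -> metric_at_least (gamma s)) ->
  (forall s, a < s < b ->
     `|Num.sqrt (gchart d p (f s) (to_complex ('D_1 f s)) (to_complex ('D_1 f s))) - S| <= e) ->
  almost_length e a b.
Proof.
move=> e0 ab cu lf mf Sf.
have der s : a < s < b -> exists2 k, is_derive s 1 u k & m * `|k| <= speed d gamma s.
  move=> sab; have [lc df] := lf _ sab.
  by apply: speed_lower_bound lc _ (mf _ sab); apply: DeriveDef => //; exact: df.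
have spE s : a < s < b -> `|speed d gamma s - S| <= e.
  move=> sab; have [lc df] := lf _ sab.
  have dv : is_derive s 1 f ('D_1 f s) by exact: DeriveDef.
  by rewrite (speed_chart d lc dv); exact: Sf.
have [k Hk] : exists k : R -> R, forall s, a < s < b -> is_derive s 1 u (k s) /\ m * `|k s| <= speed d gamma s.
  have : forall s, exists k, a < s < b -> is_derive s 1 u k /\ m * `|k| <= speed d gamma s.
    move=> s; have [sab|nsab] := pselect (a < s < b); last by exists 0.
    by have [k dk mk] := der _ sab; exists k.
  by move=> /choice[k Hk]; exists k.
have uk x : x \in `]a, b[ -> is_derive x 1 u (k x).
  by rewrite in_itv => xab; have [] := Hk x xab.
have [c cab uE] := MVT ab uk cu.
have cab' : a < c < b by move: cab; rewrite in_itv.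
have [_ mk] := Hk _ cab'.
have := spE _ cab'; rewrite ler_norml => /andP[s1 s2].
exists (fun x => Num.max 0 (S - e) * \1_(`]a, b[%classic) x); split.
- by apply: measurable_funM => //; exact: measurable_indic.
- by move=> x; rewrite mulr_ge0 // le_max lexx.
- move=> x; rewrite indicE; case: ifPn => xab.
    rewrite mem_set ?mulr1; last by rewrite /= in_itv.
    rewrite ge_max speed_ge0 /=.
    by have := spE _ xab; rewrite ler_norml => /andP[h1 h2]; lra.
  by rewrite memNset ?mulr0 //= in_itv; apply/negP.
- rewrite integral_step ?(ltW ab) ?le_max ?lexx // lee_fin uE normrM (gtr0_norm (_ : 0 < b - a)) ?subr_gt0 //.
  have ba : 0 < b - a by rewrite subr_gt0.
  have h : S - e <= Num.max 0 (S - e) by rewrite le_max lexx orbT.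
  have h1 : (S - e) * (b - a) <= Num.max 0 (S - e) * (b - a) by rewrite ler_pM2r.
  have h2 : m * `|k c| * (b - a) <= (S + e) * (b - a) by rewrite ler_pM2r //; lra.
  lra.
Qed.

End length.

Section length_lower_bound.
Variables (R : realType) (B : topologicalType) (M : riemann_surface R B).
Variable d : riemannian_metric M.
Notation C := (Cplx R).
Notation mu := (@lebesgue_measure R).

Lemma finite_set_isolated (F : set R) (t : R) : finite_set F ->
  exists2 r : R, 0 < r & forall s, F s -> s != t -> r <= `|t - s|.
Proof.
move=> finF; have cl : closed (F `\ t).
  have acc : accessible_space R by apply: hausdorff_accessible; exact: Rhausdorff.
  by move/accessible_finite_set_closed : acc; apply; exact: finite_setD.
have : nbhs t (~` (F `\ t)).
  by apply: open_nbhs_nbhs; split; [exact: closed_openC|move=> [_]; exact].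
move=> /(@near_norm_ball R R)[r r0 H]; exists r => // s Fs st.
rewrite leNgt; apply/negP => /H; apply; split => //.
by apply/eqP.
Qed.

Section one_coordinate.
Variables (gamma : R -> B) (q : B) (m : R) (prj : R * R -> R).
Hypothesis m0 : 0 < m.
Hypothesis prj_derive : forall (F : R -> R * R) (t : R) (l : R * R),
  is_derive t 1 F l -> is_derive t 1 (prj \o F) (prj l).
Hypothesis prj_continuous : continuous prj.
Hypothesis prj_le : forall c : R * R, `|prj c| <= `|c|.
Hypothesis gamma_continuous : continuous (gamma \o @clamp R).

Let u (s : R) : R := prj (coord M q (gamma s)).

(** The representative [f] is smooth on both sides of [t], so the speed computed from it is
    continuous at [t] even if [t] is an end of the smooth piece. *)
Lemma almost_length_near (e a1 b1 t : R) : 0 < e -> 0 <= a1 -> b1 <= 1 ->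
  smooth_path_on M gamma a1 b1 -> a1 <= t <= b1 ->
  exists2 dl, 0 < dl & forall a b, a1 <= a -> a < b -> b <= b1 -> t - dl < a -> b < t + dl ->
    (forall s, a <= s <= b -> metric_at_least d q m (gamma s)) ->
    almost_length d gamma q m prj e a b.
Proof.
move=> e0 a10 b11 sm tab; have [f [sf nf]] := sm t tab.
have [r1 r10 H1] := near_norm_ball nf.
have [r3 r30 H3] := near_norm_ball sf.
have it : chart_image M (gamma t) (f t).
  have [|d1 e1] := H1 t _ tab; first by rewrite subrr normr0.
  by exists (gamma t).
have cS := @chart_speed_continuous _ _ _ d _ _ _ sf it.
have [r2 r20 H2] := near_norm_ball (continuous_near_le cS e0).
exists (Num.min r1 (Num.min r2 r3)); first by rewrite !lt_min r10 r20 r30.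
move=> a b a1a ab bb1 ta bt reg.
have nt s : a < s < b -> `|t - s| < Num.min r1 (Num.min r2 r3).
  by move=> /andP[h1 h2]; rewrite ltr_norml; lra.
have L := almost_length_smooth m0 prj_derive prj_le (f := f) (p := gamma t)
  (S := Num.sqrt (gchart d (gamma t) (f t) (to_complex ('D_1 f t)) (to_complex ('D_1 f t)))) e0 ab.
apply: L.
- have cu s : a <= s <= b -> {for s, continuous (fun s => prj (coord M q (gamma (clamp s))))}.
    move=> sab; have e1 : gamma (clamp s) = gamma s by rewrite clamp_id //; lra.
    have [dq _] := reg s sab.
    have c1 : {for gamma (clamp s), continuous (coord M q)} by rewrite e1; exact: coord_continuous.
    have c2 := continuous_comp (@gamma_continuous s) c1.
    exact: (continuous_comp c2 (@prj_continuous _)).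
  apply: (@subspace_eq_continuous _ _ _ ((fun s => prj (coord M q (gamma (clamp s)))) : subspace _ -> R)).
    by move=> s; rewrite inE /= in_itv /= => sab; rewrite clamp_id //; lra.
  by apply: continuous_in_subspaceT => s; rewrite inE /= in_itv /=; exact: cu.
- move=> s sab; split.
    have oab : open_nbhs s (`]a, b[%classic : set R).
      by split; [exact: itv_open|rewrite /= in_itv].
    apply: filterS (open_nbhs_nbhs oab) => s'; rewrite /= in_itv /= => sab'.
    apply: H1; last by lra.
    by apply: lt_le_trans (nt _ sab') _; rewrite ge_min lexx.
  have : `|t - s| < r3.
    by apply: lt_le_trans (nt _ sab) _; rewrite !ge_min lexx !orbT.
  by move=> /H3/(_ [::])[_]; exact.
- by move=> s sab; apply: reg; lra.
- move=> s sab; apply: H2.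
  by apply: lt_le_trans (nt _ sab) _; rewrite !ge_min lexx !orbT.
Qed.

(** Local estimates are added up by tagged induction, then [e] tends to 0. Near [t] the only
    possible break point is [t] itself, so the curve is smooth up to [t] on each side. *)
Lemma length_ge_coordinate (tau : R) : 0 <= tau <= 1 -> piecewise_smooth M gamma ->
  (forall t, 0 <= t <= tau -> metric_at_least d q m (gamma t)) ->
  ((m * `|u tau - u 0|)%:E <= metric_length d gamma)%E.
Proof.
move=> /andP[tau0 tau1] [F [finF smF]] reg.
have al e : 0 < e -> almost_length d gamma q m prj e 0 tau.
  move=> e0; apply: interval_tagged_induction => //.
    move=> a b c a0 ab bc ct; exact: almost_length_add.
  move=> t tt; have [r r0 Fr] := finite_set_isolated t finF.
  have noF a b : t - r <= a -> b <= t + r -> (b <= t \/ t <= a) -> forall s, F s -> ~ (a < s < b).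
    move=> h1 h2 h3 s Fs /andP[h4 h5]; have st : s != t.
      by apply/eqP => st; move: h4 h5; rewrite st; case: h3; lra.
    have := Fr _ Fs st; rewrite leNgt; apply/negP; rewrite negbK ltr_norml; lra.
  have [dr dr0 Hr] : exists2 dl, 0 < dl & forall b, t <= b -> b <= tau -> b < t + dl ->
      almost_length d gamma q m prj e t b.
    have [t_lt|t_ge] := ltP t tau; last first.
      exists 1 => // b tb bt _; have -> : b = t by lra.
      exact: almost_length_refl.
    have [||||dl dl0 Hdl] := @almost_length_near e t (Num.min tau (t + r)) t e0.
    - by lra.
    - by rewrite ge_min tau1.
    - apply: smF; first lra.
      + by rewrite lt_min t_lt /=; lra.
      + by rewrite ge_min tau1.
      + by apply: noF; [lra|rewrite ge_min lexx orbT|right].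
    - by rewrite lexx le_min; lra.
    exists (Num.min dl r); first by rewrite lt_min dl0.
    move=> b; rewrite le_eqVlt => /predU1P[<- _ _|tb btau bdl]; first exact: almost_length_refl.
    have [h1 h2] : b < t + dl /\ b < t + r.
      by have := ge_min dl dl r; have := ge_min r dl r; rewrite !lexx ?orbT => /= k1 k2; split; lra.
    apply: Hdl => //; [by rewrite le_min btau ltW|by lra|].
    by move=> s sab; apply: reg; lra.
  have [dl' dl'0 Hl] : exists2 dl, 0 < dl & forall a, 0 <= a -> a <= t -> t - dl < a ->
      almost_length d gamma q m prj e a t.
    have [t_gt|t_le] := ltP 0 t; last first.
      exists 1 => // a a0 at_ _; have -> : a = t by lra.
      exact: almost_length_refl.
    have [||||dl dl0 Hdl] := @almost_length_near e (Num.max 0 (t - r)) t t e0.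
    - by rewrite le_max lexx.
    - by lra.
    - apply: smF; last 1 first.
      + by apply: noF; [rewrite le_max lexx orbT|lra|left].
      + by rewrite le_max lexx.
      + by rewrite gt_max t_gt /=; lra.
      + lra.
    - by rewrite lexx ge_max; lra.
    exists (Num.min dl r); first by rewrite lt_min dl0.
    move=> a a0; rewrite le_eqVlt => /predU1P[-> _|ta adl]; first exact: almost_length_refl.
    have [h1 h2] : t - dl < a /\ t - r < a.
      by have := ge_min dl dl r; have := ge_min r dl r; rewrite !lexx ?orbT => /= k1 k2; split; lra.
    apply: Hdl => //; [by rewrite ge_max a0 ltW|by lra|].
    by move=> s sab; apply: reg; lra.
  exists (Num.min dr dl'); first by rewrite lt_min dr0.
  have [k1 k2] : Num.min dr dl' <= dr /\ Num.min dr dl' <= dl'.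
    by rewrite !ge_min !lexx orbT.
  by split => [a a0 at_ ta|b tb bt tb']; [apply: Hl|apply: Hr] => //; lra.
have L0 : (0 <= metric_length d gamma)%E.
  by apply: integral_ge0 => x _; rewrite lee_fin; exact: speed_ge0.
apply/lee_addgt0Pr => e e0.
have e2 : 0 < e / 2 by rewrite divr_gt0.
have [g [mg g0 gs gi]] := al _ e2.
have gL : (\int[mu]_x (g x)%:E <= metric_length d gamma)%E.
  rewrite /metric_length /path_length [X in (_ <= X)%E]integral_mkcond.
  apply: (@le_integral_nonneg R [set: R] (fun x => (g x)%:E)) => x _; first by rewrite lee_fin.
  rewrite patchE; case: ifPn => xin.
    rewrite lee_fin; apply: le_trans (gs x) _; case: ifP => // _; exact: speed_ge0.
  rewrite lee_fin; apply: le_trans (gs x) _; rewrite ifF //; apply/negP => x0.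
  by move: xin; rewrite notin_setE /= in_itv /=; apply; lra.
have := le_trans gi gL; rewrite -/(u tau) -/(u 0) => H.
have : ((m * `|u tau - u 0| - 2 * (e / 2) * (tau - 0))%:E + e%:E <= metric_length d gamma + e%:E)%E.
  by rewrite leeD2r.
apply: le_trans; rewrite -EFinD lee_fin subr0.
have : e * tau <= e * 1 by rewrite ler_pM2l.
lra.
Qed.

End one_coordinate.

(** The sup norm of the displacement is attained by one of the two coordinates, each a real function
    to which the mean value theorem applies. *)
Lemma length_ge (gamma : R -> B) (q : B) (m tau : R) : 0 < m ->
  continuous (gamma \o @clamp R) -> 0 <= tau <= 1 -> piecewise_smooth M gamma ->
  (forall t, 0 <= t <= tau -> metric_at_least d q m (gamma t)) ->
  ((m * `|coord M q (gamma tau) - coord M q (gamma 0)|)%:E <= metric_length d gamma)%E.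
Proof.
move=> m0 cg tt ps reg.
have h1 := @length_ge_coordinate gamma q m fst m0 (@is_derive_fst R) (@fst_continuous R R) _ cg tau tt ps reg.
have h2 := @length_ge_coordinate gamma q m snd m0 (@is_derive_snd R) (@snd_continuous R R) _ cg tau tt ps reg.
rewrite prod_normE /=; case: (leP `|_| `|_|) => _; [apply: h2|apply: h1] => c;
  by rewrite prod_normE le_max lexx ?orbT.
Qed.

End length_lower_bound.

(** * Metric discs of small radius lie in small squares *)

Section metric_discs.
Variables (R : realType) (B : topologicalType) (M : riemann_surface R B).
Variable d : riemannian_metric M.

Lemma closed_square_compact (z : R * R) (r : R) : compact [set w | `|z - w| <= r].
Proof.
have -> : [set w : R * R | `|z - w| <= r] =
    (`[z.1 - r, z.1 + r]%classic `*` `[z.2 - r, z.2 + r]%classic).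
  apply/seteqP; split => w /=; rewrite prod_normE /= ge_max !ler_norml !in_itv /=.
    by move=> /andP[/andP[? ?] /andP[? ?]]; split; lra.
  by move=> [/andP[? ?] /andP[? ?]]; apply/andP; split; lra.
by apply: compact_setX; exact: segment_compact.
Qed.

Lemma cinv_square_closed q (z : R * R) (r : R) :
  (forall w, `|z - w| <= r -> chart_image M q w) ->
  closed (cinv M q @` [set w | `|z - w| <= r]).
Proof.
move=> sub; apply: compact_closed; first exact: rs_hausdorff M.
apply: continuous_compact; last exact: closed_square_compact.
by apply: continuous_in_subspaceT => w; rewrite inE => /sub; exact: cinv_continuous.
Qed.

(** Reaching the boundary of the square of half-side [si] from its centre [zeta] costs at least
    [m * si]. A point [y] of the disc is joined to the centre by a shorter curve, which therefore
    stays inside. *)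
Lemma metric_disc_local q z0 (tau : R) : chart_image M q z0 -> 0 < tau ->
  exists dl rho : R, [/\ 0 < dl, 0 < rho & forall zeta, `|z0 - zeta| < dl -> forall y,
    (metric_dist d (cinv M q zeta) y <= rho%:E)%E ->
    chart_dom M q y /\ `|zeta - coord M q y| <= tau].
Proof.
move=> iz0 tau0; have [m [sg [m0 sg0 Hsg]]] := gchart_lower_bound d iz0.
pose si := Num.min (sg / 2) tau.
have si0 : 0 < si by rewrite lt_min divr_gt0.
have si_sg : si <= sg / 2 by rewrite ge_min lexx.
have si_tau : si <= tau by rewrite ge_min lexx orbT.
exists (sg / 2), (m * si / 2); split; [by rewrite divr_gt0|by rewrite divr_gt0 ?mulr_gt0|].
move=> zeta zz y dist.
have : (metric_dist d (cinv M q zeta) y < (m * si)%:E)%E.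
  apply: le_lt_trans dist _; rewrite lte_fin ltr_pdivrMr // ltr_pMr ?mulr_gt0 //.
  by rewrite ltr1n.
move=> /ereal_inf_lt[_ [gam [pg sg'] <-] len].
have cg := path_clamp pg.
have [_ g0 g1 _] := pg.
have sub w : `|zeta - w| <= si -> `|z0 - w| <= sg.
  move=> h; have := ler_normD (z0 - zeta) (zeta - w).
  by rewrite addrA subrK; lra.
have subI w : `|zeta - w| <= si -> chart_image M q w by move=> /sub/Hsg[].
pose inV x := chart_dom M q x /\ `|zeta - coord M q x| < si.
have openV x : inV x -> \forall x' \near x, inV x'.
  move=> [dx cx]; have c1 := coord_continuous dx.
  have n1 : nbhs (coord M q x) [set w | `|zeta - w| < si].
    apply/(@nbhs_ballP R (R * R)%type); exists (si - `|zeta - coord M q x|) => /=; first by rewrite subr_gt0.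
    move=> w; rewrite -ball_normE /= => h.
    have := ler_normD (zeta - coord M q x) (coord M q x - w).
    by rewrite addrA subrK; lra.
  by apply: filterS2 (open_nbhs_dom dx) (c1 _ n1) => x' dx' /= cx'; split.
have z0I : chart_image M q zeta by apply: subI; rewrite subrr normr0 ltW.
have V0 : inV (gam 0) by rewrite g0; split; [exact: cinv_dom|rewrite cinvK // subrr normr0].
have clampE t : 0 <= t <= 1 -> gam (clamp t) = gam t by move=> h; rewrite clamp_id.
(* As an implication [P] is transitive. At a time outside the square an earlier outside time is
   found, which makes [P] vacuous nearby; without one, this would be a first exit, excluded by the
   length. *)
pose P a b := (forall s, 0 <= s <= a -> inV (gam s)) -> (forall s, 0 <= s <= b -> inV (gam s)).
suff : P 0 1.
  move=> H; have [dy cy] : inV (gam 1).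
    apply: H; last by rewrite lexx ler01.
    by move=> s /andP[s0 s1]; have -> : s = 0 by lra.
  by rewrite -g1; split => //; rewrite (le_trans (ltW cy)).
apply: interval_tagged_induction => //.
  by move=> a b c _ _ _ _ H1 H2 /H1/H2.
move=> t t01.
have [Vt|nVt] := pselect (inV (gam t)).
  have /(cg t) : nbhs (gam (clamp t)) inV by rewrite clampE //; exact: openV.
  move=> /(@near_norm_ball R R)[r r0 Hr]; exists r => //.
  have Hr' s : 0 <= s <= 1 -> t - r < s < t + r -> inV (gam s).
    by move=> h1 h2; rewrite -clampE //; apply: Hr; rewrite ltr_norml; lra.
  split=> [a a0 at_ ta H s /andP[s0 st]|b tb b1 btr H s /andP[s0 sb]].
    have [sa|sa] := leP s a; first by apply: H; rewrite s0.
    by apply: Hr'; lra.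
  have [sa|sa] := leP s t; first by apply: H; rewrite s0.
  by apply: Hr'; lra.
have t_gt0 : 0 < t.
  by rewrite lt_def; case/andP: (t01) => -> _; rewrite andbT; apply/eqP => t0; apply: nVt; rewrite t0.
have [a [a0 at_ nVa]] : exists a, [/\ 0 <= a, a < t & ~ inV (gam a)].
  apply: contrapT => /forallNP no.
  have allV s : 0 <= s -> s < t -> inV (gam s).
    by move=> s0 st; apply: contrapT => nV; apply: (no s).
  pose K := cinv M q @` [set w | `|zeta - w| <= si].
  have clK : closed K by exact: cinv_square_closed.
  have [w wsi wt] : K (gam t).
    apply: contrapT => nK.
    have oK : nbhs (gam (clamp t)) (~` K).
      by rewrite clampE //; apply: open_nbhs_nbhs; split => //; exact: closed_openC.
    have [r r0 Hr] := @near_norm_ball R R t _ (cg t _ oK).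
    pose s := Num.max 0 (t - r / 2).
    have s0 : 0 <= s by rewrite le_max lexx.
    have st : s < t by rewrite gt_max t_gt0 /=; lra.
    have sr : t - r / 2 <= s by rewrite le_max lexx orbT.
    have [ds cs] := allV s s0 st.
    apply: (Hr s); first by rewrite ltr_norml; lra.
    rewrite /= clampE; last lra.
    by exists (coord M q (gam s)); [exact: ltW|exact: coordK].
  have dt : chart_dom M q (gam t) by rewrite -wt; exact/cinv_dom/subI.
  have ct : coord M q (gam t) = w by rewrite -wt cinvK //; exact: subI.
  have nlt : si <= `|zeta - coord M q (gam t)|.
    by rewrite leNgt; apply/negP => h; apply: nVt.
  have reg s : 0 <= s <= t -> metric_at_least d q m (gam s).
    move=> /andP[s0]; rewrite le_eqVlt => /predU1P[->|st].
      by split => //; rewrite ct; have [_] := Hsg _ (sub _ wsi).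
    have [ds cs] := allV s s0 st; split => //.
    by have [_] := Hsg _ (sub _ (ltW cs)).
  have := length_ge m0 cg t01 sg' reg.
  rewrite g0 cinvK // distrC => h.
  have := le_lt_trans h len; rewrite lte_fin ltr_pM2l //.
  by rewrite ltNge nlt.
exists (t - a); first by rewrite subr_gt0.
have no b : a <= b -> ~ (forall s, 0 <= s <= b -> inV (gam s)).
  by move=> ab H; apply: nVa; apply: H; rewrite a0.
split=> [b _ _ tb H|b tb _ _ H].
  by case: (no b) => //; lra.
by case: (no t) => //; exact: ltW.
Qed.

(** The local radii become uniform over the closed square by compactness, the property being
    inherited by smaller radii. *)
Lemma metric_disc_square q z0 (r tau : R) :
  (forall w, `|z0 - w| <= r -> chart_image M q w) -> 0 < tau ->
  exists2 rho : R, 0 < rho & forall zeta, `|z0 - zeta| <= r -> forall y,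
    (metric_dist d (cinv M q zeta) y <= rho%:E)%E ->
    chart_dom M q y /\ `|zeta - coord M q y| <= tau.
Proof.
move=> sub tau0.
have /compact_near_coveringP nc := @closed_square_compact z0 r.
pose P (rho : R) (zeta : R * R) := forall y,
    (metric_dist d (cinv M q zeta) y <= rho%:E)%E ->
    chart_dom M q y /\ `|zeta - coord M q y| <= tau.
have : \forall rho \near 0^'+, [set w | `|z0 - w| <= r] `<=` P rho.
  apply: nc => w /sub iw; have [dl [rho [dl0 rho0 H]]] := metric_disc_local iw tau0.
  exists ([set zeta | `|w - zeta| < dl], [set s | s <= rho]); first split.
  - by apply/(@nbhs_ballP R (R * R)%type); exists dl => // v; rewrite -ball_normE.
  - exact: nbhs_right_le.
  move=> [v s] /= [vw sr] y h; apply: (H v vw).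
  by apply: le_trans h _; rewrite lee_fin.
move=> near0; have : \forall rho \near 0^'+, 0 < rho /\ [set w | `|z0 - w| <= r] `<=` P rho.
  by apply: filterS2 (nbhs_right_gt _) near0 => s s0 sP; split.
by move=> /filter_ex[rho [rho0 H]]; exists rho.
Qed.

End metric_discs.

(** * Levels clear of the obstacles *)

Section avoidance.
Variable R : realType.

(** By subadditivity of Lebesgue measure, intervals of total length less than [b - a] do not cover
    []a, b[]. *)
Lemma interval_avoidance (a b : R) (s : seq (R * R)) : a < b ->
  all (fun cr => 0 <= cr.2) s -> \sum_(cr <- s) (2 * cr.2) < b - a ->
  exists2 x, a < x < b & forall cr, cr \in s -> cr.2 <= `|x - cr.1|.
Proof.
move=> ab s0 sum_lt.
pose A (cr : R * R) : set R := `]cr.1 - cr.2, cr.1 + cr.2[%classic.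
pose U := \big[setU/set0]_(cr <- s) A cr.
have mU : measurable U by apply: bigsetU_measurable => cr _; exact: measurable_itv.
have muU : (lebesgue_measure U <= (\sum_(cr <- s) (2 * cr.2))%:E)%E.
  rewrite /U {mU U sum_lt}; elim: s s0 => [|cr s IH] /=; first by rewrite !big_nil measure0.
  move=> /andP[cr0 s0]; rewrite !big_cons EFinD.
  apply: le_trans (measureU2 _ _ _) _; first exact: measurable_itv.
    by apply: bigsetU_measurable => ? _; exact: measurable_itv.
  apply: leeD (IH s0); rewrite /A /= lebesgue_measure_itv /= lte_fin.
  case: ifP => _; last by rewrite lee_fin mulr_ge0.
  by rewrite -EFinD lee_fin; lra.
have [x xab xU] : exists2 x, a < x < b & ~ U x.
  apply: contrapT => no.
  have sub : `]a, b[%classic `<=` U.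
    by move=> x; rewrite /= in_itv /= => xab; apply: contrapT => nU; apply: no; exists x.
  have h := le_trans (le_measure (@lebesgue_measure R) (mem_set (measurable_itv _)) (mem_set mU) sub) muU.
  move: h; rewrite /= lebesgue_measure_itv /= lte_fin ab -EFinD lee_fin.
  by rewrite leNgt sum_lt.
exists x => // cr crs; rewrite leNgt; apply/negP => lt; apply: xU.
rewrite /U -bigcup_seq; exists cr => //; rewrite /A /= in_itv /=.
by move: lt; rewrite ltr_norml; lra.
Qed.

End avoidance.

Section clearance.
Variables (R : realType) (B : topologicalType) (M : riemann_surface R B).
Variable d : riemannian_metric M.

Definition obstacle (p : nat) (rho : R) (S : {fset B}) (z : 'I_p -> B) : set B :=
  [set` S] `|` \bigcup_j metric_disc d (z j) rho.

Lemma obstacle_le p (rho rho' : R) S (z : 'I_p -> B) : rho <= rho' ->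
  obstacle rho S z `<=` obstacle rho' S z.
Proof.
move=> rr x [Sx|[j _ jx]]; [by left|right; exists j => //].
by apply: le_trans jx _; rewrite lee_fin.
Qed.

Lemma clear_level p q z0 (r a b : R) (u : R * R -> R) : a < b ->
  (forall w, `|z0 - w| <= r -> chart_image M q w) ->
  (forall v w, `|u v - u w| <= `|v - w|) ->
  exists c rho : R, [/\ 0 < c, 0 < rho & forall (S : {fset B}) (z : 'I_p -> B),
    exists2 x, a < x < b & forall w, `|z0 - w| <= r -> obstacle rho S z (cinv M q w) ->
      c / (#|` S|%fset.+1)%:R <= `|u w - x|].
Proof.
move=> ab sub uL.
(* Points are fattened to radius [e <= c] and discs to [c + e]. The points cost at most [2 * c]
   together and the discs at most [4 * c * p], in all no more than half of [b - a]. *)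
pose c := (b - a) / (8 * p.+1%:R).
have p0 : 0 < p.+1%:R :> R by rewrite ltr0n.
have c0 : 0 < c by rewrite divr_gt0 ?subr_gt0 // mulr_gt0.
have [rho rho0 Hrho] := metric_disc_square d sub c0.
exists c, rho; split => // S z.
set e := c / _.
have n0 : 0 < (#|` S|%fset.+1)%:R :> R by rewrite ltr0n.
have e0 : 0 < e by rewrite divr_gt0.
pose s1 := [seq (u (coord M q x), e) | x <- enum_fset S].
(* For [z j] outside the chart domain this entry is meaningless but harmless: a disc that meets the
   square has its centre in the chart. *)
pose s2 := [seq (u (coord M q (z j)), c + e) | j <- enum 'I_p].
have [||x xab H] := @interval_avoidance R a b (s1 ++ s2) ab.
- rewrite all_cat; apply/andP; split; apply/allP => _ /mapP[y _ ->] /=.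
    exact: ltW.
  by rewrite addr_ge0 // ltW.
- rewrite big_cat /=.
  have -> : \sum_(cr <- s1) 2 * cr.2 = 2 * e * (#|` S|%fset)%:R.
    by rewrite /s1 big_map /= big_const_seq iter_addr_0 count_predT mulr_natr.
  have -> : \sum_(cr <- s2) 2 * cr.2 = 2 * (c + e) * p%:R.
    by rewrite /s2 big_map big_enum /= sumr_const card_ord mulr_natr.
  have E1 : 2 * e * (#|` S|%fset)%:R <= 2 * c.
    rewrite -mulrA ler_pM2l // /e mulrAC ler_pdivrMr // ler_pM2l //.
    by rewrite ler_nat leqnSn.
  have ec : e <= c by rewrite /e ler_pdivrMr // ler_peMr ?(ltW c0) // ler1n.
  have pc : c * p.+1%:R = (b - a) / 8.
    by rewrite /c; field; rewrite ?addn1 gt_eqF.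
  have E2 : 2 * (c + e) * p%:R <= 4 * c * p%:R.
    by apply: ler_wpM2r => //; lra.
  rewrite -natr1 mulrDr mulr1 in pc.
  have ba : 0 < b - a by rewrite subr_gt0.
  by lra.
exists x => // w wr [Sw|[j _ jw]].
  have in1 : (u (coord M q (cinv M q w)), e) \in s1 ++ s2.
    by rewrite mem_cat; apply/orP; left; apply: (map_f (fun x => (u (coord M q x), e))).
  have h : e <= `|x - u (coord M q (cinv M q w))| by exact: (H _ in1).
  by move: h; rewrite (cinvK (sub _ wr)) distrC.
(* The point of the square acts as centre and [z j] as the nearby point, the order in which
   [metric_disc] measures distance. *)
have [dz cz] := Hrho _ wr _ jw.
have in2 : (u (coord M q (z j)), c + e) \in s1 ++ s2.
  rewrite mem_cat; apply/orP; right.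
  by apply: (map_f (fun j => (u (coord M q (z j)), c + e))); rewrite mem_enum.
have h : c + e <= `|x - u (coord M q (z j))| by exact: (H _ in2).
have h2 := le_trans (uL w (coord M q (z j))) cz.
have := ler_normD (x - u w) (u w - u (coord M q (z j))).
rewrite addrA subrK (distrC x (u w)); lra.
Qed.

End clearance.

(** * Curves of bounded Kobayashi speed *)

Section tame_paths.
Variables (R : realType) (B : topologicalType) (M : riemann_surface R B).
Notation C := (Cplx R).
Implicit Types (X : set B) (x : B) (gamma : R -> B) (K : R).

(** A disc witnessing that the Kobayashi norm of [w] is at most [K]. Keeping the witness avoids
    handling the infimum when velocities are rescaled. *)
Definition disc_bound X K x (w : C) : Prop := exists (r : R) (h : C -> B),
  [/\ 0 < r, 2 / r <= K, holomorphic_disc M X r h, h 0 = x &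
      'D_1 (chart M x \o h) 0 = w].

Lemma disc_bound_le X K K' x w : K <= K' -> disc_bound X K x w -> disc_bound X K' x w.
Proof.
move=> KK [r [h [r0 rK hol h0 dh]]]; exists r, h; split => //.
exact: le_trans KK.
Qed.

Lemma kobayashi_ge0 X x w : 0 <= kobayashi M X x w.
Proof.
rewrite /kobayashi; set A := image _ _.
have [A0|/set0P A0] := eqVneq A set0; first by rewrite A0 inf0.
by apply: lb_le_inf => // _ [r [r0 _] <-]; rewrite divr_ge0 // ltW.
Qed.

Lemma kobayashi_le X K x w : disc_bound X K x w -> kobayashi M X x w <= K.
Proof.
move=> [r [h [r0 rK hol h0 dh]]]; apply: le_trans rK; apply: ge_inf.
  by exists 0 => _ [s [s0 _] <-]; rewrite divr_ge0 // ltW.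
by exists r => //; split => //; exists h.
Qed.

Lemma mul_has_cderive (k z : C) : has_cderive (fun w => k * w) z k.
Proof.
have := has_cderiveM (has_cderive_cst k z) (has_cderive_id z).
by rewrite mulr1 mulr0 addr0.
Qed.

Lemma disc_bound_scale X K x w (k : C) : k != 0 ->
  disc_bound X K x w -> disc_bound X (normc k * K) x (k * w).
Proof.
move=> k0 [r [h [r0 rK hol h0 dh]]].
have nk : 0 < normc k.
  by rewrite lt_def normc_ge0 andbT; apply: contra k0 => /eqP/eq0_normc ->.
have D z : has_cderive (fun w => k * w) z k := mul_has_cderive k z.
have k00 : k * 0 = 0 :> C := mulr0 k.
exists (r / normc k), (fun z => h (k * z)); split.
- exact: divr_gt0.
- have -> : 2 / (r / normc k) = normc k * (2 / r).
    by field; rewrite (lt0r_neq0 r0) (lt0r_neq0 nk).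
  by rewrite ler_pM2l.
- move=> z zr; have kz : `|k * z| < Complex r 0.
    move: zr; rewrite !norm_normc !(ltcR _ _) => zr.
    by rewrite normcM mulrC -ltr_pdivlMr.
  have [Xh ch dh'] := hol _ kz; split; first exact: Xh.
    exact: (continuous_comp (has_cderive_continuous (D z)) ch).
  have := has_cderive_comp (derivable_has_cderive dh') (D z).
  exact: has_cderive_derivable.
- exact: (etrans (congr1 h k00) h0).
- have z0 : `|(0 : C)| < Complex r 0 by rewrite normr0 (ltcR 0 r).
  have [_ _ dh'] := hol _ z0; rewrite h0 in dh'.
  have D0 : has_cderive (chart M x \o h) (k * 0) ('D_1 (chart M x \o h) 0).
    by rewrite k00; exact: derivable_has_cderive.
  have := has_cderive_val (has_cderive_comp D0 (D 0)).
  by rewrite dh mulrC.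
Qed.

Lemma local_coord_affine gamma p (f : R -> R * R) (k l t : R) v :
  local_coord M gamma p f (k * t + l) -> is_derive (k * t + l) 1 f v ->
  local_coord M (fun s => gamma (k * s + l)) p (fun s => f (k * s + l)) t /\
  is_derive t 1 (fun s => f (k * s + l)) (k *: v).
Proof.
move=> lc df; split.
  exact: (@affine_continuous R k l t _ lc).
have [d e] := df.
have dk : derivable f (k * t + l) k.
  by have := derivable1_diffP f (k * t + l); case=> H _; exact: diff_derivable (H d).
have e1 : 'D_k f (k * t + l) = k *: v.
  have /derivable1_diffP df' := d.
  by rewrite -e !deriveE // -linearZ /= /GRing.scale /= mulr1.
apply: DeriveDef.
  by rewrite /derivable difference_quotient_affine mulr1.
by rewrite /derive difference_quotient_affine mulr1.
Qed.

Lemma velocity_affine gamma p (f : R -> R * R) (k l t : R) v :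
  local_coord M gamma p f (k * t + l) -> is_derive (k * t + l) 1 f v ->
  velocity M (fun s => gamma (k * s + l)) t = (k%:C)%C * velocity M gamma (k * t + l).
Proof.
move=> lc df; have [lc' df'] := local_coord_affine lc df.
rewrite (velocity_chart lc' df') (velocity_chart lc df) mulrCA; congr (_ * _).
case: v {df df'} => a b; rewrite /to_complex /=.
by apply/eqP; rewrite eq_complex /= !mul0r subr0 addr0 !eqxx.
Qed.

(* Local coordinates are recorded because reparametrizing needs the derivative to exist. *)
Definition controlled X K gamma (t : R) : Prop := exists p f v,
  [/\ local_coord M gamma p f t, is_derive t 1 f v &
      disc_bound X K (gamma t) (velocity M gamma t)].

Lemma controlled_le X K K' gamma t : K <= K' -> controlled X K gamma t -> controlled X K' gamma t.
Proof. by move=> KK [p [f [v [? ? /(disc_bound_le KK) ?]]]]; exists p, f, v. Qed.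

Lemma near_eq_local_coord gamma gamma' p (f : R -> R * R) t :
  (\forall s \near t, gamma s = gamma' s) -> local_coord M gamma p f t -> local_coord M gamma' p f t.
Proof. by apply: filterS2 => s <-. Qed.

Lemma near_eq_velocity gamma gamma' t :
  (\forall s \near t, gamma s = gamma' s) -> velocity M gamma t = velocity M gamma' t.
Proof.
move=> eqg; have e := nbhs_singleton eqg.
rewrite /velocity !derive1E e; congr Complex; apply: near_eq_derive;
  by apply: filterS eqg => s /= ->.
Qed.

Lemma controlled_affine X K gamma gamma' (k l t : R) : k != 0 ->
  (\forall s \near t, gamma (k * s + l) = gamma' s) ->
  controlled X K gamma (k * t + l) -> controlled X (`|k| * K) gamma' t.
Proof.
move=> k0 eqg [p [f [v [lc df db]]]].
have [lc' df'] := local_coord_affine lc df.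
exists p, (fun s => f (k * s + l)), (k *: v); split => //.
  exact: near_eq_local_coord eqg lc'.
rewrite -(near_eq_velocity eqg) (velocity_affine lc df) -(nbhs_singleton eqg).
rewrite -normc_real; apply: disc_bound_scale => //.
by apply: contra k0; rewrite eq_complex /= => /andP[].
Qed.

Lemma smooth_path_on_affine gamma gamma' (k l a b a' b' : R) :
  (forall s, a <= s <= b -> a' <= k * s + l <= b' /\ gamma (k * s + l) = gamma' s) ->
  smooth_path_on M gamma a' b' -> smooth_path_on M gamma' a b.
Proof.
move=> H sm t tab; have [tab' e] := H t tab.
have [f [sf nf]] := sm _ tab'; exists (fun s => f (k * s + l)); split.
  exact: smooth_at_affine.
have nf' : \forall s \near t, a' <= k * s + l <= b' ->
   chart_dom M (gamma (k * t + l)) (gamma (k * s + l)) /\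
   chart M (gamma (k * t + l)) (gamma (k * s + l)) = to_complex (f (k * s + l)).
  exact: (@affine_continuous R k l t _ nf).
apply: filterS nf' => s Hs sab; have [sab' e'] := H s sab.
by rewrite -e -e'; exact: Hs.
Qed.

(** The parameter interval has length 1, so the speed bound [K] is also a bound of the length. *)
Definition tame X K gamma : Prop := exists F : set R, [/\ finite_set F,
  forall a b, 0 <= a -> a < b -> b <= 1 -> (forall t, F t -> ~ (a < t < b)) ->
    smooth_path_on M gamma a b,
  forall t, 0 < t < 1 -> ~ F t -> controlled X K gamma t &
  forall t, 0 <= t <= 1 -> X (gamma t)].

Lemma tame_in X K gamma t : tame X K gamma -> 0 <= t <= 1 -> X (gamma t).
Proof. by move=> [F [_ _ _ inX]]; exact: inX. Qed.

Lemma tame_piecewise_smooth X K gamma : tame X K gamma -> piecewise_smooth M gamma.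
Proof. by move=> [F [finF sm _]]; exists F. Qed.

Lemma tame_le X K K' gamma : K <= K' -> tame X K gamma -> tame X K' gamma.
Proof.
move=> KK [F [finF sm ct inX]]; exists F; split => // t tt Ft.
exact: controlled_le KK (ct t tt Ft).
Qed.

(** Each half is traversed at double speed, hence [2 * K]; the junction [2^-1] becomes an
    exceptional time. *)
Lemma tame_concat X K gamma gamma' : gamma 1 = gamma' 0 ->
  tame X K gamma -> tame X K gamma' -> tame X (2 * K) (path_concat gamma gamma').
Proof.
move=> e [F [finF sm ct inX]] [F' [finF' sm' ct' inX']].
exists ((fun s => s / 2) @` F `|` (fun s => (s + 1) / 2) @` F' `|` [set 2^-1]); split.
- by rewrite !finite_setU; do !split; [exact: finite_image|exact: finite_image|exact: finite_set1].
- move=> a b a0 ab b1 noF.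
  have [b2|b2] := leP b 2^-1.
    apply: (@smooth_path_on_affine gamma _ 2 0 a b (2 * a) (2 * b)).
      move=> s sab; split; first lra.
      by rewrite /path_concat addr0 ifT //; lra.
    apply: sm; [lra|lra|lra|] => t Ft tab; apply: (noF (t / 2)); last lra.
    by left; left; exists t.
  have a2 : 2^-1 <= a.
    by rewrite leNgt; apply/negP => a2; apply: (noF 2^-1); [right|rewrite a2].
  apply: (@smooth_path_on_affine gamma' _ 2 (-1) a b (2 * a - 1) (2 * b - 1)).
    move=> s sab; split; first lra.
    rewrite /path_concat; case: ifPn => // s2.
    have -> : s = 2^-1 by lra.
    by rewrite divff // subrr e.
  apply: sm'; [lra|lra|lra|] => t Ft tab; apply: (noF ((t + 1) / 2)); last lra.
  by left; right; exists t.
- move=> t t01 nF; have -> : 2 = `|2| :> R by rewrite normr_nat.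
  have [t2|t2|t2] := ltgtP t 2^-1.
  + apply: (@controlled_affine X K gamma _ 2 0) => //.
      have : \forall s \near t, s < 2^-1 by apply: lt_nbhsl.
      by apply: filterS => s s2; rewrite /path_concat addr0 (ltW s2).
    apply: ct; first by lra.
    by rewrite addr0 => Ft; apply: nF; left; left; exists (2 * t) => //; rewrite mulrC mulKf.
  + apply: (@controlled_affine X K gamma' _ 2 (-1)) => //.
      have : \forall s \near t, 2^-1 < s by apply: lt_nbhsr.
      by apply: filterS => s s2; rewrite /path_concat leNgt s2.
    apply: ct'; first by lra.
    move=> Ft; apply: nF; left; right; exists (2 * t + -1) => //.
    by rewrite subrK mulrC mulKf.
  + by case: nF; right.
- by move=> t t01; rewrite /path_concat; case: ifPn => t2; [apply: inX|apply: inX']; lra.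
Qed.

Lemma tame_reverse X K gamma : tame X K gamma -> tame X K (path_reverse gamma).
Proof.
move=> [F [finF sm ct inX]].
exists ((fun s => 1 - s) @` F); split; first exact: finite_image.
- move=> a b a0 ab b1 noF.
  apply: (@smooth_path_on_affine gamma _ (-1) 1 a b (1 - b) (1 - a)).
    by move=> s sab; split; [lra|rewrite /path_reverse mulN1r addrC].
  apply: sm; [lra|lra|lra|] => t Ft tab; apply: (noF (1 - t)); last lra.
  by exists t.
- move=> t t01 nF; have -> : K = `|-1| * K by rewrite normrN1 mul1r.
  apply: (@controlled_affine X K gamma _ (-1) 1); first by rewrite oppr_eq0 oner_eq0.
    by apply: (@filterE _ (nbhs t)) => s; rewrite /path_reverse mulN1r addrC.
  apply: ct; first by lra.
  by move=> Ft; apply: nF; exists (-1 * t + 1) => //; ring.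
- by move=> t t01; apply: inX; lra.
Qed.

(** The integrand is not known to be measurable. It is majorized by [g], which keeps its true value
    on the finite set [N] and equals [K] elsewhere; [g] is measurable and almost everywhere
    constant. *)
Lemma tame_length X K gamma : 0 <= K -> tame X K gamma ->
  (path_length M (kobayashi M X) gamma <= K%:E)%E.
Proof.
move=> K0 [F [finF _ ct _]]; rewrite /path_length.
pose N := F `|` [set 0; 1].
have finN : finite_set N by rewrite finite_setU; split => //; exact: finite_set2.
have mfin (A : set R) : finite_set A -> measurable A.
  move=> /finite_set_countable; apply: countable_measurable => t.
  exact: measurable_set1.
have mN : measurable N by exact: mfin.
pose g (t : R) : R := if t \in N then kobayashi M X (gamma t) (velocity M gamma t) else K.
have le_g : (\int[lebesgue_measure]_(t in `[0%R, 1%R])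
     (kobayashi M X (gamma t) (velocity M gamma t))%:E <=
     \int[lebesgue_measure]_(t in `[0%R, 1%R]) (g t)%:E)%E.
  apply: le_integral_nonneg => t; rewrite /= in_itv /= => t01.
    by rewrite lee_fin kobayashi_ge0.
  rewrite lee_fin /g; case: ifPn => // tN; apply: kobayashi_le.
  have nN : ~ N t by move: tN; rewrite notin_setE.
  have [|Ft|] := ct t; last by move=> p [f [v []]].
    rewrite !lt_def; apply/andP; split; apply/andP; split; try lra.
      by apply/eqP => t0; apply: nN; right; left.
    by apply/eqP => t0; apply: nN; right; right.
  by apply: nN; left.
apply: le_trans le_g _.
have mK : measurable_fun (`[0, 1]%classic : set (measurableTypeR R)) (EFin \o (fun=> K : R)).
  by apply/measurable_EFinP; exact: measurable_cst.
have aeq : ae_eq (@lebesgue_measure R) (`[0, 1]%classic : set R) (EFin \o g) (EFin \o (fun=> K : R)).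
  exists N; split => //.
    by apply: countable_lebesgue_measure0; exact: finite_set_countable.
  move=> t /=; rewrite /g; case: ifPn; first by rewrite inE.
  by move=> _ H; exfalso; apply: H.
have gN t : ~ N t -> g t = K by move=> nNt; rewrite /g memNset.
have mg : measurable_fun (`[0, 1]%classic : set (measurableTypeR R)) (EFin \o g).
  apply/measurable_EFinP => _ Y mY.
  have -> : `[0, 1]%classic `&` g @^-1` Y =
      (`[0, 1]%classic `&` g @^-1` Y `&` N) `|` ((`[0, 1]%classic `\` N) `&` (fun=> K) @^-1` Y).
    apply/seteqP; split => t.
      move=> [t01 Yt]; have [Nt|nNt] := pselect (N t); first by left.
      by right; split => //; move: Yt; rewrite /preimage /= gN //.
    by move=> [[[t01 Yt] Nt]|[[t01 nNt] YK]]; split => //; rewrite /preimage /= gN //.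
  apply: measurableU.
    by apply: mfin; apply: sub_finite_set finN => t [].
  apply: measurableI; first exact: measurableD.
  by have := @measurable_cst _ _ (measurableTypeR R) (measurableTypeR R) setT K measurableT Y mY; rewrite setTI.
rewrite (ge0_ae_eq_integral _ mg mK _ _ aeq) //.
  rewrite integral_cst //= lebesgue_measure_itv /= lte_fin ltr01 oppr0 adde0 mule1.
  by [].
by move=> t _; rewrite lee_fin /g; case: ifP => // _; exact: kobayashi_ge0.
Qed.

End tame_paths.

Section linear_paths.
Variables (R : realType) (B : topologicalType) (M : riemann_surface R B).
Notation C := (Cplx R).
Implicit Types (X Y : set B) (x q : B) (gamma : R -> B) (K : R) (z w : R * R).

Definition linear_path q z w : R -> B := fun t => cinv M q (z + t *: (w - z)).

Lemma to_complex_segment z w (t : R) :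
  to_complex (z + t *: (w - z)) = to_complex z + (t%:C)%C * to_complex (w - z).
Proof.
case: z w => [a b] [a' b']; apply/eqP; rewrite eq_complex /= /GRing.scale /=.
by rewrite !mul0r subr0 addr0 !eqxx.
Qed.

Lemma segment_is_derive z w (t : R) : is_derive t 1 (fun s => z + s *: (w - z)) (w - z).
Proof.
have := @affine_is_derive R id (to_complex z) (to_complex (w - z)) 1 t 1 (has_cderive_id _).
have -> : (fun s => of_complex (id (to_complex z + (s%:C)%C * to_complex (w - z))) : (R * R)%type) =
    (fun s => z + s *: (w - z)).
  by apply/funext => s; rewrite /= -to_complex_segment to_complexK.
by rewrite rmorph1 !mul1r to_complexK.
Qed.

Lemma segment_continuous z w : continuous (fun s : R => z + s *: (w - z)).
Proof. by move=> t; exact: is_derive_continuous (segment_is_derive z w t). Qed.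

Lemma linear_path0 q z w : linear_path q z w 0 = cinv M q z.
Proof. by rewrite /linear_path scale0r addr0. Qed.

Lemma linear_path1 q z w : linear_path q z w 1 = cinv M q w.
Proof. by rewrite /linear_path scale1r subrKC. Qed.

Lemma is_path_linear Y q z w :
  (forall t, 0 <= t <= 1 -> chart_image M q (z + t *: (w - z)) /\ Y (cinv M q (z + t *: (w - z)))) ->
  is_path Y (cinv M q z) (cinv M q w) (linear_path q z w).
Proof.
move=> H; apply: (@is_path_of _ _ _ _ _ _ (linear_path q z w \o @clamp R)).
- move=> t; have [iz _] := H _ (clamp_in t).
  have c1 := continuous_fcomp (@clamp_continuous R) (@segment_continuous z w).
  exact: (continuous_comp (c1 t) (cinv_continuous iz)).
- by move=> t tt /=; rewrite clamp_id.
- by rewrite /= clamp_id ?lexx ?ler01 // linear_path0.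
- by rewrite /= clamp_id ?lexx ?ler01 // linear_path1.
- by move=> t _; have [] := H _ (clamp_in t).
Qed.

(** Around each point of the segment the affine disc with derivative [w - z] and radius [e / D]
    stays within [e], so the Kobayashi speed is at most [2 * D / e]. A positive upper bound [D] of
    the length also covers [w = z]. *)
Lemma tame_linear X q z w (D e : R) : 0 < D -> 0 < e -> 2 * `|w - z| <= D ->
  (forall t, 0 <= t <= 1 -> forall v, `|z + t *: (w - z) - v| < e ->
     chart_image M q v /\ X (cinv M q v)) ->
  tame M X (2 * D / e) (linear_path q z w).
Proof.
move=> D0 e0 wzD H.
set Z := to_complex z; set W := to_complex (w - z).
have WD : normc W <= D := le_trans (normc_to_complex _) wzD.
have iz t : 0 <= t <= 1 -> chart_image M q (z + t *: (w - z)).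
  by move=> tt; have [] := H t tt (z + t *: (w - z)); rewrite ?subrr ?normr0.
exists set0; split;
  [exact: finite_set0| | |by move=> t tt; have [] := H t tt (z + t *: (w - z)); rewrite ?subrr ?normr0].
  move=> a b a0 ab b1 _ t tab; have tt : 0 <= t <= 1 by lra.
  set g := linear_path q z w.
  (* In the chart attached to [g t] the segment becomes its image under a transition map, smooth
     because that map is holomorphic. *)
  have At : transition_dom M q (g t) (Z + (t%:C)%C * W).
    rewrite -to_complex_segment -(chart_cinv (iz _ tt)).
    by apply: transition_dom_chart; [exact/cinv_dom/iz|exact: chart_dom_self].
  have oA := @transition_dom_open R B M q (g t).
  exists (fun s => of_complex (transition M q (g t) (Z + (s%:C)%C * W))); split.
    by apply: smooth_at_holomorphic oA _ At => v; exact: transition_derivable.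
  have c1 : {for t, continuous (fun s : R => to_complex (z + s *: (w - z)))}.
    exact: (continuous_comp (@segment_continuous z w t) (@to_complex_continuous R _)).
  have n1 : \forall s \near t, transition_dom M q (g t) (Z + (s%:C)%C * W).
    have : \forall s \near t, transition_dom M q (g t) (to_complex (z + s *: (w - z))).
      apply: c1; apply: open_nbhs_nbhs; split; first exact: oA.
      by rewrite to_complex_segment.
    by apply: filterS => s; rewrite to_complex_segment.
  apply: filterS n1 => s [x [dx gx] xs] _.
  have gs : g s = x by rewrite /g /linear_path /cinv to_complex_segment -/Z -/W -xs chartK.
  by rewrite gs; split => //; rewrite of_complexK /transition /= -xs chartK.
move=> t t01 _; have tt : 0 <= t <= 1 by lra.
set g := linear_path q z w; set zt := z + t *: (w - z).
have lc : local_coord M g q (fun s => z + s *: (w - z)) t.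
  have : \forall s \near t, chart_image M q (z + s *: (w - z)).
    apply: (@segment_continuous z w t); apply: open_nbhs_nbhs; split; first exact: chart_image_open.
    exact: iz.
  by apply: filterS => s is_; split; [exact: cinv_dom|exact: chart_cinv].
have ds := segment_is_derive z w t.
exists q, (fun s => z + s *: (w - z)), (w - z); split => //.
pose h (v : C) := chart_inv M q (to_complex zt + W * v).
have near_zt v : normc v < e / D -> `|zt - of_complex (to_complex zt + W * v)| < e.
  move=> vr; have -> : zt - of_complex (to_complex zt + W * v) = - of_complex (W * v).
    rewrite -{1}(to_complexK zt) -of_complexB opprD addrA subrr sub0r.
    by case: (W * v) => ? ?; rewrite /of_complex /=.
  rewrite normrN; apply: le_lt_trans (le_norm_of_complex _) _; rewrite normcM.
  apply: (@le_lt_trans _ _ (D * normc v)); first by rewrite ler_wpM2r ?normc_ge0.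
  by rewrite mulrC -ltr_pdivlMr.
have hE v : h v = cinv M q (of_complex (to_complex zt + W * v)).
  by rewrite /cinv of_complexK.
have good v : normc v < e / D -> chart_image M q (of_complex (to_complex zt + W * v)) /\
    X (h v).
  by move=> /near_zt; rewrite hE; exact: H.
have Daff v : has_cderive (fun v => to_complex zt + W * v) v W.
  have := has_cderiveB (mul_has_cderive W v) (has_cderive_cst (- to_complex zt) v).
  rewrite subr0; apply: eq_has_cderive; apply/nbhs_complexP; exists 1 => // y _.
  by rewrite opprK addrC.
have Dtr v x : normc v < e / D -> chart_dom M x (h v) ->
    has_cderive (chart M x \o h) v ('D_1 (transition M q x) (to_complex zt + W * v) * W).
  move=> vr dx; have [iv _] := good v vr.
  have Tv : transition_dom M q x (to_complex zt + W * v).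
    rewrite -[X in transition_dom _ _ _ X]of_complexK -(chart_cinv iv).
    by apply: transition_dom_chart; [exact: cinv_dom|rewrite -hE].
  have := @has_cderive_comp R (transition M q x) (fun v => to_complex zt + W * v) v _ W (derivable_has_cderive (transition_derivable Tv)) (Daff v).
  exact.
exists (e / D), h; split.
- exact: divr_gt0.
- by rewrite invf_div mulrA.
- move=> v; rewrite norm_normc (ltcR _ (e / D)) => vr.
  have [iv Xv] := good v vr; split; first exact: Xv.
    have ci : {for to_complex zt + W * v, continuous (chart_inv M q)}.
      by apply: chart_inv_continuous; move: iv; rewrite /chart_image /= of_complexK.
    exact: (continuous_comp (has_cderive_continuous (Daff v)) ci).
  exact: has_cderive_derivable (Dtr v (h v) vr (chart_dom_self _ _)).
- have W0 : W * 0 = 0 :> C := mulr0 W.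
  by rewrite /h W0 addr0.
- have W0 : W * 0 = 0 :> C := mulr0 W.
  have h0 : h 0 = g t by rewrite /h W0 addr0.
  have e0D : normc (0 : C) < e / D by rewrite normc0 divr_gt0.
  have dg : chart_dom M (g t) (h 0) by rewrite h0; exact: chart_dom_self.
  rewrite (has_cderive_val (Dtr 0 (g t) e0D dg)) (velocity_chart lc ds) W0 addr0.
  by [].
Qed.

(** Two ambient sets: speed is measured in [X], while confinement to [Y] serves to identify the
    homotopy class. *)
Definition join X K Y (P Q : B) : Prop := exists gamma, tame M X K gamma /\ is_path Y P Q gamma.

Lemma join_le X K K' Y P Q : K <= K' -> join X K Y P Q -> join X K' Y P Q.
Proof. by move=> KK [g [tg pg]]; exists g; split => //; exact: tame_le tg. Qed.

Lemma join_concat X K Y P Q S : join X K Y P Q -> join X K Y Q S -> join X (2 * K) Y P S.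
Proof.
move=> [g [tg pg]] [h [th ph]]; exists (path_concat g h); split; last exact: is_path_concat ph.
by apply: tame_concat => //; case: pg => _ _ -> _; case: ph => _ -> _ _.
Qed.

Lemma join_sym X K Y P Q : join X K Y P Q -> join X K Y Q P.
Proof.
by move=> [g [tg pg]]; exists (path_reverse g); split; [exact: tame_reverse|exact: is_path_reverse].
Qed.

Lemma join_linear X Y q z w (D e : R) : 0 < D -> 0 < e -> 2 * `|w - z| <= D ->
  (forall t, 0 <= t <= 1 -> Y (cinv M q (z + t *: (w - z)))) ->
  (forall t, 0 <= t <= 1 -> forall v, `|z + t *: (w - z) - v| < e ->
     chart_image M q v /\ X (cinv M q v)) ->
  join X (2 * D / e) Y (cinv M q z) (cinv M q w).
Proof.
move=> D0 e0 wzD HY H; exists (linear_path q z w); split; first exact: tame_linear.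
apply: is_path_linear => t tt; split; last exact: HY.
by have [] := H t tt (z + t *: (w - z)); rewrite ?subrr ?normr0.
Qed.

End linear_paths.

Section first_exit.
Variables (R : realType) (B : topologicalType).

Lemma first_exit (g : R -> B) (V K : set B) : continuous (g \o @clamp R) ->
  open V -> closed K -> V `<=` K -> V (g 0) -> ~ V (g 1) ->
  exists t, [/\ 0 < t <= 1, K (g t), ~ V (g t) & forall s, 0 <= s < t -> V (g s)].
Proof.
move=> cg oV cK VK V0 nV1.
have gE t : 0 <= t <= 1 -> g (clamp t) = g t by move=> tt; rewrite clamp_id.
pose S := [set t | 0 <= t <= 1 /\ forall s, 0 <= s <= t -> V (g s)].
have S0 : S 0.
  by split; [rewrite lexx ler01|move=> s ss; have -> : s = 0 by lra].
have hS : has_sup S by split; [exists 0|exists 1 => t [/andP[]]].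
set t := sup S.
have t0 : 0 <= t by apply: ub_le_sup; [case: hS|].
have t1 : t <= 1 by apply: ge_sup; [case: hS|move=> s [/andP[]]].
have below s : 0 <= s < t -> V (g s).
  move=> /andP[s0 st]; have e0 : 0 < t - s by rewrite subr_gt0.
  have [a [_ Va] sa] := sup_adherent e0 hS.
  by apply: Va; rewrite s0 /=; rewrite -/t in sa; lra.
have nVt : ~ V (g t).
  move=> Vt; have oVt : nbhs (g (clamp t)) V.
    by rewrite gE ?t0 //; exact: open_nbhs_nbhs.
  have [r r0 Hr] := @near_norm_ball R R t _ (cg t _ oVt).
  have near_V s : 0 <= s <= 1 -> t - r < s < t + r -> V (g s).
    by move=> h1 h2; rewrite -gE //; apply: Hr; rewrite ltr_norml; lra.
  have [t_eq1|t_lt1] : t = 1 \/ t < 1 by move: t1; rewrite le_eqVlt => /predU1P.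
    by apply: nV1; rewrite -t_eq1.
  pose b := Num.min 1 (t + r / 2).
  have tb : t < b by rewrite lt_min t_lt1 /=; lra.
  have b1 : b <= 1 by rewrite ge_min lexx.
  have br : b <= t + r / 2 by rewrite ge_min lexx orbT.
  have : b <= t.
    apply: ub_le_sup; first by case: hS.
    split; first by rewrite b1 andbT; lra.
    move=> s /andP[s0 sb]; have [st|st] := ltP s t; first by apply: below; rewrite s0.
    by apply: near_V; lra.
  by rewrite leNgt tb.
have t_gt0 : 0 < t.
  by rewrite lt_def t0 andbT; apply/eqP => te; apply: nVt; rewrite te.
exists t; split => //; first by rewrite t_gt0.
apply: contrapT => nK.
have oK : nbhs (g (clamp t)) (~` K).
  by rewrite gE ?t0 //; apply: open_nbhs_nbhs; split => //; exact: closed_openC.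
have [r r0 Hr] := @near_norm_ball R R t _ (cg t _ oK).
pose s := Num.max 0 (t - r / 2).
have s0 : 0 <= s by rewrite le_max lexx.
have st : s < t by rewrite gt_max t_gt0 /=; lra.
have sr : t - r / 2 <= s by rewrite le_max lexx orbT.
apply: (Hr s); first by rewrite ltr_norml; lra.
rewrite /= gE; last lra.
by apply: VK; apply: below; rewrite s0.
Qed.

End first_exit.

(** * Frames *)

Section frames.
Variables (R : realType) (B : topologicalType) (M : riemann_surface R B).
Implicit Types (X Y : set B) (q x : B) (z w P Q : R * R).

Definition chart_square q z (r : R) : set B := cinv M q @` [set w | `|z - w| < r].

Lemma chart_squareP q z r y : (forall w, `|z - w| < r -> chart_image M q w) ->
  chart_square q z r y <-> chart_dom M q y /\ `|z - coord M q y| < r.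
Proof.
move=> sub; split=> [[w wr <-]|[dy yr]]; last by exists (coord M q y) => //; exact: coordK.
by have iw := sub _ wr; split; [exact: cinv_dom|rewrite cinvK].
Qed.

Lemma norm_ball_open z (r : R) : open [set w | `|z - w| < r].
Proof.
rewrite openE => w /= wr; apply/(@nbhs_ballP R (R * R)%type).
exists (r - `|z - w|) => /=; first by rewrite subr_gt0.
move=> v; rewrite -ball_normE /= => h.
by have := ler_normD (z - w) (w - v); rewrite addrA subrK; lra.
Qed.

Lemma chart_square_open q z r : (forall w, `|z - w| < r -> chart_image M q w) ->
  open (chart_square q z r).
Proof.
move=> sub; rewrite openE => y /(chart_squareP _ sub)[dy yr].
have n1 := coord_continuous dy (open_nbhs_nbhs (conj (@norm_ball_open z r) yr)).
apply: filterS2 (open_nbhs_dom dy) n1 => y' dy' yr'.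
exact/(chart_squareP _ sub).
Qed.

Lemma frame_crossing q z r (g : R -> B) : continuous (g \o @clamp R) ->
  (forall w, `|z - w| <= r -> chart_image M q w) ->
  chart_square q z r (g 0) -> ~ chart_square q z r (g 1) ->
  exists t w, [/\ 0 <= t <= 1, `|z - w| = r & g t = cinv M q w].
Proof.
move=> cg sub V0 V1.
have sub' w : `|z - w| < r -> chart_image M q w by move=> /ltW/sub.
have VK : chart_square q z r `<=` cinv M q @` [set w | `|z - w| <= r].
  by move=> _ [w wr <-]; exists w => //; exact: ltW.
have [t [/andP[t0 t1] [w wr wt] nV _]] :=
  first_exit cg (chart_square_open sub') (cinv_square_closed sub) VK V0 V1.
exists t, w; split => //; first by rewrite (ltW t0).
apply/eqP; rewrite eq_le wr leNgt; apply/negP => lt; apply: nV.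
by exists w.
Qed.

Section arcs.
Variables (X Y : set B) (q : B) (z : R * R) (r e : R).
Hypotheses (e0 : 0 < e) (er : e <= r).
Hypothesis frame_in : forall w, `|z - w| <= 2 * r -> chart_image M q w.
Hypothesis frame_Y : forall w, `|z - w| <= r -> Y (cinv M q w).
Hypothesis frame_X : forall w, `| `|z - w| - r| < e -> X (cinv M q w).

Let r0 : 0 < r. Proof. exact: lt_le_trans e0 er. Qed.

Lemma frame_segment P Q :
  (forall t, 0 <= t <= 1 -> `|z - (P + t *: (Q - P))| = r) ->
  join M X (2 * (4 * r) / e) Y (cinv M q P) (cinv M q Q).
Proof.
move=> on_frame.
have zP : `|z - P| = r by rewrite -(on_frame 0) ?lexx ?ler01 // scale0r addr0.
have zQ : `|z - Q| = r by rewrite -(on_frame 1) ?lexx ?ler01 // scale1r subrKC.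
apply: join_linear => //.
- by rewrite mulr_gt0.
- have := ler_normD (z - P) (- (z - Q)).
  have -> : z - P + - (z - Q) = Q - P by rewrite opprB addrC addrA subrK.
  by rewrite normrN zP zQ; lra.
- by move=> t tt; apply: frame_Y; rewrite on_frame.
- move=> t tt v; set c := P + _ => cv.
  have zc : `|z - c| = r by exact: on_frame.
  have h1 := ler_normD (z - c) (c - v); rewrite addrA subrK zc in h1.
  have h2 := ler_normD (z - v) (- (c - v)).
  have e2 : z - v + - (c - v) = z - c by rewrite opprB addrA subrK.
  rewrite e2 normrN zc in h2.
  have er' := er; have cv' : `|c - v| < e by [].
  split; first by apply: frame_in; apply: (le_trans h1); lra.
  by apply: frame_X; rewrite ltr_norml; lra.
Qed.

Lemma frame_vertical P Q (s : R) : `|s| = 1 -> P.1 = z.1 + s * r -> Q.1 = z.1 + s * r ->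
  `|z.2 - P.2| <= r -> `|z.2 - Q.2| <= r ->
  join M X (2 * (4 * r) / e) Y (cinv M q P) (cinv M q Q).
Proof.
move=> s1 P1 Q1 P2 Q2; apply: frame_segment => t tt; rewrite prod_normE /= P1 Q1.
have -> : z.1 - (z.1 + s * r + t *: (z.1 + s * r - (z.1 + s * r))) = - (s * r).
  by rewrite subrr scaler0; ring.
rewrite normrN normrM s1 mul1r (gtr0_norm r0); apply/max_idPl.
move: P2 Q2; rewrite /GRing.scale /= !ler_norml => /andP[a1 a2] /andP[b1 b2].
by apply/andP; split; nra.
Qed.

Lemma frame_horizontal P Q (s : R) : `|s| = 1 -> P.2 = z.2 + s * r -> Q.2 = z.2 + s * r ->
  `|z.1 - P.1| <= r -> `|z.1 - Q.1| <= r ->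
  join M X (2 * (4 * r) / e) Y (cinv M q P) (cinv M q Q).
Proof.
move=> s1 P1 Q1 P2 Q2; apply: frame_segment => t tt; rewrite prod_normE /= P1 Q1.
have -> : z.2 - (z.2 + s * r + t *: (z.2 + s * r - (z.2 + s * r))) = - (s * r).
  by rewrite subrr scaler0; ring.
rewrite normrN normrM s1 mul1r (gtr0_norm r0); apply/max_idPr.
move: P2 Q2; rewrite /GRing.scale /= !ler_norml => /andP[a1 a2] /andP[b1 b2].
by apply/andP; split; nra.
Qed.

Definition corner (s t : R) : R * R := (z.1 + s * r, z.2 + t * r).

Let corner_le (a s : R) : `|s| = 1 -> `|a - (a + s * r)| <= r.
Proof.
move=> s1; have -> : a - (a + s * r) = - (s * r) by ring.
by rewrite normrN normrM s1 mul1r gtr0_norm.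
Qed.

Lemma frame_to_corner P : `|z - P| = r -> exists s t, [/\ `|s| = 1, `|t| = 1 &
  join M X (2 * (4 * r) / e) Y (cinv M q P) (cinv M q (corner s t))].
Proof.
move=> zP; have := zP; rewrite prod_normE /=.
have sgn (a b : R) : `|a - b| = r -> exists2 s : R, `|s| = 1 & b = a + s * r.
  have [ab|ab] := leP 0 (a - b) => abr.
    by exists (-1); [exact: normrN1|move: abr; rewrite ger0_norm //; lra].
  by exists 1; [exact: normr1|move: abr; rewrite ltr0_norm //; lra].
case: (leP `|z.1 - P.1| `|z.2 - P.2|) => h zPr.
  have [t t1 Pt] := sgn _ _ zPr.
  exists 1, t; split; [exact: normr1|exact: t1|].
  apply: (frame_horizontal t1) => //=; first by rewrite -zPr.
  by apply: corner_le; exact: normr1.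
have [s s1 Ps] := sgn _ _ zPr.
exists s, 1; split; [exact: s1|exact: normr1|].
apply: (frame_vertical s1) => //=; first by rewrite -zPr ltW.
by apply: corner_le; exact: normr1.
Qed.

Lemma frame_corners s t s' t' : `|s| = 1 -> `|t| = 1 -> `|s'| = 1 -> `|t'| = 1 ->
  join M X (2 * (2 * (4 * r) / e)) Y (cinv M q (corner s t)) (cinv M q (corner s' t')).
Proof.
move=> s1 t1 s1' t1'; apply: (@join_concat _ _ _ _ _ _ _ (cinv M q (corner s' t))).
  by apply: (frame_horizontal t1) => //=; exact: corner_le.
by apply: (frame_vertical s1') => //=; exact: corner_le.
Qed.

(** From [P] to a corner, along two sides to a corner next to [Q], then to [Q]: each stretch has
    speed at most [8 * r / e], and three nested concatenations double this three times. *)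
Lemma frame_join P Q : `|z - P| = r -> `|z - Q| = r ->
  join M X (64 * r / e) Y (cinv M q P) (cinv M q Q).
Proof.
move=> /frame_to_corner[s [t [s1 t1 j1]]] /frame_to_corner[s' [t' [s1' t1' j2]]].
have j3 := frame_corners s1 t1 s1' t1'.
have K0 : 0 <= 2 * (4 * r) / e by rewrite divr_ge0 ?(ltW e0) // !mulr_ge0 ?(ltW r0).
have K1 : 2 * (4 * r) / e <= 2 * (2 * (4 * r) / e) by lra.
have j4 := join_concat (join_le K1 j1) j3.
have K2 : 2 * (4 * r) / e <= 2 * (2 * (2 * (4 * r) / e)) by lra.
have := join_concat j4 (join_le K2 (join_sym j2)).
have -> // : 2 * (2 * (2 * (2 * (4 * r) / e))) = 64 * r / e.
by field; exact: lt0r_neq0.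
Qed.

End arcs.
End frames.

Section spokes.
Variables (R : realType) (B : topologicalType) (M : riemann_surface R B).
Variables (d : riemannian_metric M) (p : nat) (B0 : set B).
Implicit Types (X Y O : set B) (q x : B) (z w P Q H : R * R).

(** The discs may have any radius up to [rho], so requirements coming from several constructions are
    met together by the smallest of their radii. *)
Definition obstacle_at_most (O : set B) (n : nat) (rho : R) : Prop :=
  exists (S : {fset B}) (z : 'I_p -> B) (rho' : R),
    [/\ rho' <= rho, O = obstacle d rho' S z & n = #|` S|%fset].

Lemma obstacle_at_most_le O n (rho rho' : R) : rho <= rho' ->
  obstacle_at_most O n rho -> obstacle_at_most O n rho'.
Proof.
move=> rr [S [z [s [sr OE nE]]]]; exists S, z, s; split => //.
exact: le_trans rr.
Qed.

Lemma clear_level_obstacle q z0 (r a b : R) (u : R * R -> R) : a < b ->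
  (forall w, `|z0 - w| <= r -> chart_image M q w) ->
  (forall v w, `|u v - u w| <= `|v - w|) ->
  exists c rho : R, [/\ 0 < c, 0 < rho & forall O n, obstacle_at_most O n rho ->
    exists2 x, a < x < b & forall w, `|z0 - w| <= r -> O (cinv M q w) ->
      c / n.+1%:R <= `|u w - x|].
Proof.
move=> ab sub uL; have [c [rho [c0 rho0 H]]] := clear_level d p ab sub uL.
exists c, rho; split => // _ _ [S [z [s [sr -> ->]]]].
have [x xab Hx] := H S z; exists x => // w wr Ow.
exact: Hx wr (obstacle_le sr Ow).
Qed.

Definition center q : R * R := coord M q q.

Lemma cinv_center q : cinv M q (center q) = q.
Proof. by rewrite /center coordK //; exact: chart_dom_self. Qed.

Lemma chart_image_center q : chart_image M q (center q).
Proof. by apply: chart_image_coord; exact: chart_dom_self. Qed.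

(** Clearance is measured by the distance to the centre, the 1-Lipschitz function for which a clear
    level is found; if [e <= r], points within [e] of the frame are then outside [O]. *)
Definition clear_frame q O (r e : R) : Prop := forall w,
  `|center q - w| <= 2 * r -> O (cinv M q w) -> e <= `| `|center q - w| - r|.

Lemma clear_frame_le q O (r e e' : R) : e' <= e -> clear_frame q O r e -> clear_frame q O r e'.
Proof. by move=> ee H w wr Ow; apply: le_trans ee (H w wr Ow). Qed.

Lemma dist_lipschitz z v w : `| `|z - v| - `|z - w| | <= `|v - w|.
Proof.
apply: le_trans (ler_dist_dist _ _) _.
by have -> : z - v - (z - w) = - (v - w) by [rewrite !opprB addrC addrA subrK]; rewrite normrN.
Qed.

Lemma snd_lipschitz v w : `|v.2 - w.2| <= `|v - w|.
Proof. by rewrite prod_normE /= le_max lexx orbT. Qed.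

Lemma box_bound (a b : R * R) (r s y : R) : 0 < r -> `|a.1 - b.1| < r -> `|a.2 - b.2| < r ->
  `|y - b.2| <= r -> 0 <= s <= 6 * r -> `|a - (b.1 + s, y)| <= 7 * r.
Proof.
move=> r0 /ltr_normlP [k1 k2] /ltr_normlP [k3 k4] /ler_normlP [k5 k6] /andP[s0 s1].
rewrite prod_normE /= ge_max; apply/andP; split; apply/ler_normlP; split; lra.
Qed.

Lemma box_bound0 (a b : R * R) (r y : R) : 0 < r -> `|a.1 - b.1| < r -> `|a.2 - b.2| < r ->
  `|y - b.2| <= r -> `|a - (b.1, y)| < 2 * r.
Proof.
move=> r0 /ltr_normlP [k1 k2] /ltr_normlP [k3 k4] /ler_normlP [k5 k6].
rewrite prod_normE /= gt_max; apply/andP; split; apply/ltr_normlP; split; lra.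
Qed.

Lemma box_far (a b : R * R) (r y : R) : `|a.1 - b.1| < r -> 5 * r < `|a - (b.1 + 6 * r, y)|.
Proof.
move=> /ltr_normlP [k1 k2]; rewrite prod_normE /= lt_max; apply/orP; left.
rewrite -normrN; apply: lt_le_trans (ler_norm _); lra.
Qed.

Lemma convex01 (t a b : R) : 0 <= t <= 1 -> 0 <= a <= 1 -> 0 <= b <= 1 -> 0 <= a + t * (b - a) <= 1.
Proof. by move=> /andP[? ?] /andP[? ?] /andP[? ?]; apply/andP; split; nra. Qed.

Lemma nbhs_ball_lt (V : normedModType R) (v : V) (e : R) : 0 < e -> \forall w \near v, `|v - w| < e.
Proof.
move=> e0; apply/(@nbhs_ballP R V); exists e => // w.
by rewrite -ball_normE.
Qed.

(* A clear horizontal line in the chart at [q] runs from the frame around [x] to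
   the larger frame around [q]; the three pieces are joined where they cross. *)
Lemma spoke q (ro : R) x : 0 < ro ->
  (forall w, `|center q - w| <= 8 * ro -> chart_image M q w /\ B0 (cinv M q w)) ->
  chart_dom M q x -> `|center q - coord M q x| < ro ->
  exists eta : R, [/\ 0 < eta,
    forall w, `|center x - w| <= 2 * eta -> chart_image M x w /\ chart_square M q (center q) (8 * ro) (cinv M x w) &
    forall lo c : R, 0 < lo < eta -> 0 < c -> exists L rho : R, [/\ 0 < L, 0 < rho &
      forall O n, obstacle_at_most O n rho -> forall r h, lo < r < eta ->
        clear_frame x O r (c / n.+1%:R) -> 2 * ro < h < 3 * ro ->
        (forall w, `|center q - w| <= 8 * ro -> O (cinv M q w) ->
           c / n.+1%:R <= `| `|center q - w| - h|) ->
        forall P H, `|center x - P| = r -> `|center q - H| = h ->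
          join M (B0 `\` O) (L * n.+1%:R) (chart_square M q (center q) (8 * ro)) (cinv M x P) (cinv M q H)]].
Proof.
move=> ro0 hub; set Y := chart_square M q (center q) (8 * ro).
have Y_B0 : Y `<=` B0 by move=> _ [w wr <-]; have [] := hub _ (ltW wr).
move=> dx; have [A eqA] : exists A, coord M q x = A by exists (coord M q x).
rewrite eqA => zA.
have cx : {for center x, continuous (cinv M x)} by apply: cinv_continuous; exact: chart_image_center.
have nx : \forall w \near center x, chart_image M x w /\
    (chart_dom M q (cinv M x w) /\ `|A - coord M q (cinv M x w)| < ro).
  have n1 : \forall w \near center x, chart_image M x w.
    exact: (open_nbhs_nbhs (conj (@chart_image_open _ _ M x) (chart_image_center x))).
  have dxc0 : chart_dom M q (cinv M x (center x)) by rewrite cinv_center.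
  have n2 : \forall w \near center x, chart_dom M q (cinv M x w).
    exact: (cx _ (open_nbhs_dom dxc0)).
  have n3 : \forall w \near center x, `|A - coord M q (cinv M x w)| < ro.
    have cc := continuous_comp cx (coord_continuous dxc0).
    have nA : nbhs ((coord M q \o cinv M x) (center x)) [set w | `|A - w| < ro].
      have e : (coord M q \o cinv M x) (center x) = A by rewrite /= cinv_center eqA.
      by rewrite e; exact: (@nbhs_ball_lt (R * R)%type A ro ro0).
    exact: (cc _ nA).
  by apply: filterS2 n1 (filterI n2 n3) => w h1 [h2 h3].
have [s0 s00 Hs0] := near_norm_ball nx.
exists (s0 / 4); split; first by rewrite divr_gt0.
  move=> w wr; have [|iw [dw cw]] := Hs0 w; first by lra.
  split => //; exists (coord M q (cinv M x w)); last exact: coordK.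
  rewrite /=; have := ler_normD (center q - A) (A - coord M q (cinv M x w)).
  by rewrite addrA subrK; have := ro0; lra.
have etaY w : `|center x - w| <= 2 * (s0 / 4) -> Y (cinv M x w).
  move=> wr; have [|iw [dw cw]] := Hs0 w; first by lra.
  exists (coord M q (cinv M x w)); last exact: coordK.
  rewrite /=; have := ler_normD (center q - A) (A - coord M q (cinv M x w)).
  by rewrite addrA subrK; have := ro0; lra.
move=> lo c /andP[lo0 loeta] c0.
have A8 : `|center q - A| <= 8 * ro by move: zA ro0; clear -d p B0; lra.
have iA : chart_image M q A by have [] := hub _ A8.
have cA : {for A, continuous (cinv M q)} by exact: cinv_continuous.
have eA : cinv M q A = x by rewrite -eqA; exact: coordK.
have nA : \forall v \near A, chart_dom M x (cinv M q v) /\ `|center x - coord M x (cinv M q v)| < lo.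
  have dA : chart_dom M x (cinv M q A) by rewrite eA; exact: chart_dom_self.
  have n2 : \forall v \near A, chart_dom M x (cinv M q v) by exact: (cA _ (open_nbhs_dom dA)).
  have n3 : \forall v \near A, `|center x - coord M x (cinv M q v)| < lo.
    have cc := continuous_comp cA (coord_continuous dA).
    have nc : nbhs ((coord M x \o cinv M q) A) [set w | `|center x - w| < lo].
      have e : (coord M x \o cinv M q) A = center x by rewrite /= eA.
      by rewrite e; exact: (@nbhs_ball_lt (R * R)%type _ lo lo0).
    exact: (cc _ nc).
  by apply: filterS2 n2 n3 => v.
have [d0 d00 Hd0] := near_norm_ball nA.
(* For [y] within [dl] of [A.2] the line starts inside the square of half-side [lo] at [x], hence
   inside every frame of radius [r > lo]. *)
pose dl := Num.min d0 ro / 2.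
have m0 : 0 < Num.min d0 ro by rewrite lt_min d00.
have [md mr] : Num.min d0 ro <= d0 /\ Num.min d0 ro <= ro by rewrite !ge_min !lexx orbT.
have dl0 : 0 < dl by rewrite divr_gt0.
have dl_d0 : dl < d0 by rewrite /dl; lra.
have dl_ro : dl < ro by rewrite /dl; lra.
have ab : A.2 - dl < A.2 + dl by lra.
have [c1 [rho1 [c10 rho10 Hlev]]] :=
  clear_level_obstacle ab (fun w wr => (hub _ wr).1) (fun v w => snd_lipschitz v w).
(* One clearance for all three pieces, kept below [lo] and [ro] so as not to exceed the half-side of
   either frame. *)
pose c3 := Num.min (Num.min c c1) (Num.min lo ro).
have c30 : 0 < c3 by rewrite !lt_min c0 c10 lo0 ro0.
(* In [L] below, [16 * s0] dominates [64 * r], and [200 * ro] dominates [64 * h] and [32 * ro]; the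
   factor 4 comes from two concatenations. *)
have [c3c c3c1 c3lo c3ro] : [/\ c3 <= c, c3 <= c1, c3 <= lo & c3 <= ro].
  by rewrite /c3 !ge_min !lexx ?orbT.
pose L := 4 * (16 * s0 + 200 * ro) / c3.
have K0 : 0 < 16 * s0 + 200 * ro by move: s00 ro0; clear -d p B0; lra.
exists L, rho1; split => //; first by rewrite divr_gt0 // (mulr_gt0 _ K0).
move=> O n envO r h /andP[lor reta] clx /andP[h2 h3] clh P H xP qH.
have n0 : 0 < n.+1%:R :> R by rewrite ltr0n.
have n1 : 1 <= n.+1%:R :> R by rewrite ler1n.
pose e := c3 / n.+1%:R.
have e0 : 0 < e by rewrite divr_gt0.
have ele (k : R) : 0 < k -> c3 <= k -> e <= k.
  by move=> k0 ck; apply: le_trans ck; rewrite ler_pdivrMr // ler_peMr // ltW.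
have ediv (k : R) : c3 <= k -> e <= k / n.+1%:R by move=> ck; rewrite ler_pM2r // invr_gt0.
have [y /andP[y1 y2] Hy] := Hlev O n envO.
have [zA1 zA2] : `|(center q).1 - A.1| < ro /\ `|(center q).2 - A.2| < ro.
  by move: zA; rewrite prod_normE /= gt_max => /andP[].
(* The offset [6 * ro] takes the line out of both frames, as [h < 3 * ro], yet it stays within
   [7 * ro] of the centre, leaving a margin [ro] for discs. *)
pose z1 : R * R := (A.1, y); pose z2 : R * R := (A.1 + 6 * ro, y).
have segE t : z1 + t *: (z2 - z1) = (A.1 + t * (6 * ro), y).
  rewrite /z1 /z2; apply/pair_equal_spec; split; rewrite /= /GRing.scale /=; ring.
have seg_norm t : 0 <= t <= 1 -> `|center q - (A.1 + t * (6 * ro), y)| <= 7 * ro.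
  move=> tt; have r6 : 0 <= 6 * ro by rewrite mulr_ge0 // ltW.
  apply: (box_bound ro0 zA1 zA2).
    by rewrite ler_norml; apply/andP; move: dl_ro y1 y2; clear -d p B0; split; lra.
  by case/andP: tt => t0 t1; rewrite mulr_ge0 //= -[leRHS]mul1r ler_wpM2r.
pose g := linear_path M q z1 z2.
have ro78 : 7 * ro <= 8 * ro by move: ro0; clear -d p B0; lra.
have ro78' : 7 * ro < 8 * ro by move: ro0; clear -d p B0; lra.
have gpath : is_path Y (cinv M q z1) (cinv M q z2) g.
  apply: is_path_linear => t tt; rewrite segE; have nt := seg_norm t tt.
  split; first by have [] := hub _ (le_trans nt ro78).
  by exists (A.1 + t * (6 * ro), y) => //=; exact: le_lt_trans nt ro78'.
have cg := path_clamp gpath.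
have gE t : g t = cinv M q (A.1 + t * (6 * ro), y) by rewrite /g /linear_path segE.
have Az1 : `|A - z1| < d0.
  rewrite prod_normE /= subrr normr0 gt_max d00 /= ltr_norml; move: dl_d0 y1 y2; clear -d p B0; lra.
have xsub w : `|center x - w| <= r -> chart_image M x w.
  by move=> wr; have [|iw _] := Hs0 w; first by move: wr reta s00; clear -d p B0; lra.
have [t1 [w1 [tt1 xw1 gw1]]] : exists t w, [/\ 0 <= t <= 1, `|center x - w| = r & g t = cinv M x w].
  apply: frame_crossing => //.
    rewrite /g linear_path0; have [dz cz] := Hd0 _ Az1.
    by exists (coord M x (cinv M q z1)); [exact: lt_trans cz lor|exact: coordK].
  rewrite /g linear_path1 => -[w wr wz].
  have [|iw [dw cw]] := Hs0 w; first by rewrite /= in wr; move: wr reta s00; clear -d p B0; lra.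
  move: cw; rewrite wz cinvK; last first.
    by have := seg_norm 1; rewrite mul1r lexx ler01 => /(_ isT) h1; have [] := hub _ (le_trans h1 ro78).
  rewrite prod_normE /= gt_max => /andP[+ _]; rewrite ltr_norml => /andP[+ _].
  by move: ro0; clear -d p B0; lra.
have hsub w : `|center q - w| <= h -> chart_image M q w.
  by move=> wh; have [|iw _] := hub w; first by move: wh h3 ro0; clear -d p B0; lra.
have [t2 [w2 [tt2 qw2 gw2]]] : exists t w, [/\ 0 <= t <= 1, `|center q - w| = h & g t = cinv M q w].
  apply: frame_crossing => //.
    rewrite /g linear_path0; exists z1 => //=; apply: lt_trans h2.
    apply: (box_bound0 ro0 zA1 zA2).
    by rewrite ler_norml; move: dl_ro y1 y2; clear -d p B0; lra.
  rewrite /g linear_path1 => -[w wr wz].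
  have iz2 : chart_image M q z2.
    by have := seg_norm 1; rewrite mul1r lexx ler01 => /(_ isT) h1; have [] := hub _ (le_trans h1 ro78).
  have wE : w = z2 by rewrite -(cinvK (hsub _ (ltW wr))) wz cinvK.
  have {}wr : `|center q - z2| < h by rewrite -wE.
  have far : 5 * ro < `|center q - z2| := box_far y zA1.
  by move: far wr h3 ro0; clear -d p B0; lra.
have r0 : 0 < r by exact: lt_trans lo0 lor.
have j1 : join M (B0 `\` O) (64 * r / e) Y (cinv M x P) (cinv M x w1).
  apply: (@frame_join _ _ _ _ _ _ (center x)) => //.
  - by apply: ele => //; move: c3lo lor; clear -d p B0; lra.
  - by move=> w wr; have [|iw _] := Hs0 w; first by move: wr reta s00; clear -d p B0; lra.
  - by move=> w wr; apply: etaY; move: wr reta r0; clear -d p B0; lra.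
  - move=> w we; have er : e <= r by apply: ele => //; move: c3lo lor; clear -d p B0; lra.
    have wr : `|center x - w| <= 2 * r by move: we er r0; rewrite ltr_norml; clear -d p B0; lra.
    split; first by apply: Y_B0; apply: etaY; move: wr reta; clear -d p B0; lra.
    by move=> Ow; move: (le_lt_trans (le_trans (ediv _ c3c) (clx w wr Ow)) we); rewrite ltxx.
(* The two crossings may occur in either order along the line. *)
have j2 : join M (B0 `\` O) (2 * (16 * ro) / e) Y (g t1) (g t2).
  rewrite !gE; apply: join_linear => //.
  - by rewrite mulr_gt0.
  - have -> : (A.1 + t2 * (6 * ro), y) - (A.1 + t1 * (6 * ro), y) = ((t2 - t1) * (6 * ro), 0 : R).
      by apply/pair_equal_spec; split; rewrite /=; ring.
    rewrite prod_normE /= normr0 (max_idPl _) // normrM (gtr0_norm (_ : 0 < 6 * ro)) ?mulr_gt0 //.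
    have : `|t2 - t1| <= 1 by rewrite ler_norml; move: tt1 tt2; clear -d p B0; lra.
    have r6 : 0 <= 6 * ro by rewrite mulr_ge0 // ltW.
    by move=> /(ler_wpM2r r6); move: ro0; clear -d p B0; lra.
  - move=> t tt; have -> : (A.1 + t1 * (6 * ro), y) + t *: ((A.1 + t2 * (6 * ro), y) - (A.1 + t1 * (6 * ro), y))
      = (A.1 + (t1 + t * (t2 - t1)) * (6 * ro), y).
      by apply/pair_equal_spec; split; rewrite /= /GRing.scale /=; ring.
    have tt' := convex01 tt tt1 tt2.
    exists (A.1 + (t1 + t * (t2 - t1)) * (6 * ro), y) => //=.
    exact: le_lt_trans (seg_norm _ tt') ro78'.
  - move=> t tt v; have -> : (A.1 + t1 * (6 * ro), y) + t *: ((A.1 + t2 * (6 * ro), y) - (A.1 + t1 * (6 * ro), y))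
      = (A.1 + (t1 + t * (t2 - t1)) * (6 * ro), y).
      by apply/pair_equal_spec; split; rewrite /= /GRing.scale /=; ring.
    have tt' := convex01 tt tt1 tt2.
    set b := (_, _) => bv.
    have nb : `|center q - b| <= 7 * ro := seg_norm _ tt'.
    have v8 : `|center q - v| <= 8 * ro.
      have := ler_normD (center q - b) (b - v); rewrite addrA subrK.
      by have := ele _ ro0 c3ro; move: nb bv; clear -d p B0; lra.
    have [iv B0v] := hub _ v8; split => //; split => // Ov.
    have := le_trans (le_trans (ediv _ c3c1) (Hy v v8 Ov)) (snd_lipschitz v b).
    by rewrite (distrC v) leNgt bv.
have j3 : join M (B0 `\` O) (64 * h / e) Y (cinv M q w2) (cinv M q H).
  apply: (@frame_join _ _ _ _ _ _ (center q)) => //.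
  - by apply: ele; by move: c3ro h2 ro0; clear -d p B0; lra.
  - by move=> w wr; have [|iw _] := hub w; first by move: wr h3 ro0; clear -d p B0; lra.
  - by move=> w wr; exists w => //=; move: wr h3 ro0; clear -d p B0; lra.
  - move=> w we; have er : e <= h by apply: ele; move: c3ro h2 ro0; clear -d p B0; lra.
    have wr : `|center q - w| <= 8 * ro by move: we er h3 ro0; rewrite ltr_norml; clear -d p B0; lra.
    split; first by have [] := hub _ wr.
    by move=> Ow; move: (le_lt_trans (le_trans (ediv _ c3c) (clh w wr Ow)) we); rewrite ltxx.
pose K := (16 * s0 + 200 * ro) / e.
have Kle (k : R) : k <= 16 * s0 + 200 * ro -> k / e <= K by move=> kk; rewrite ler_pM2r // invr_gt0.
rewrite gw1 gw2 in j2.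
have j1' := join_le (Kle (64 * r) _) j1.
have j2' := join_le (Kle (2 * (16 * ro)) _) j2.
have j3' := join_le (Kle (64 * h) _) j3.
have j12 := join_concat (j1' _) (j2' _).
have KK : K <= 2 * K by have := divr_gt0 K0 e0; rewrite -/K; clear -d p B0; lra.
have -> : L * n.+1%:R = 2 * (2 * K).
  rewrite /L /K /e; field; rewrite ?(lt0r_neq0 c30) /=.
  by rewrite addrC natr1 lt0r_neq0.
apply: join_concat (j12 _ _) (join_le KK (j3' _)); move: reta h3 s00 ro0; clear -d p B0; lra.
Qed.

End spokes.

(** * Corridors *)

Section corridors.
Variables (R : realType) (B : topologicalType) (M : riemann_surface R B).
Variables (d : riemannian_metric M) (p : nat) (B0 : set B).
Implicit Types (X Y O : set B) (q x y : B) (z w P Q H : R * R) (beta gamma : R -> B).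

Lemma homotopic_chart_square q z (r : R) X x y beta gamma :
  (forall w, `|z - w| < r -> chart_image M q w /\ X (cinv M q w)) ->
  is_path (chart_square M q z r) x y beta -> is_path (chart_square M q z r) x y gamma ->
  homotopic X x y beta gamma.
Proof.
move=> sub; pose D := [set w | `|z - w| < r].
have lift g : is_path (chart_square M q z r) x y g ->
    [/\ is_path D (coord M q x) (coord M q y) (coord M q \o (g \o @clamp R)),
      cinv M q (coord M q x) = x, cinv M q (coord M q y) = y &
      forall t, cinv M q (coord M q (g (clamp t))) = g (clamp t)].
  move=> pg; have sq t : chart_dom M q (g (clamp t)) /\ D (coord M q (g (clamp t))).
    have [w wr <-] := path_in t pg; have [iw _] := sub w wr.
    by split; [exact: cinv_dom|rewrite cinvK].
  have K t : cinv M q (coord M q (g (clamp t))) = g (clamp t).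
    by apply: coordK; have [] := sq t.
  split => //.
  - apply: (@is_path_of _ _ _ _ _ _ (coord M q \o (g \o @clamp R))) => //.
    + move=> t; have [dg _] := sq t.
      have cg := path_clamp pg; exact: (continuous_comp (cg t) (coord_continuous dg)).
    + by rewrite /= (path_clamp0 pg).
    + by rewrite /= (path_clamp1 pg).
    + by move=> t _; have [] := sq t.
  - by have := K 0; rewrite (path_clamp0 pg).
  - by have := K 1; rewrite (path_clamp1 pg).
move=> /lift[p1 ex ey K1] /lift[p2 _ _ K2].
have H : homotopic X (cinv M q (coord M q x)) (cinv M q (coord M q y))
    (cinv M q \o (coord M q \o (beta \o @clamp R))) (cinv M q \o (coord M q \o (gamma \o @clamp R))).
  apply: (@homotopic_convex R B _ D (cinv M q)) => //.
  - by move=> v Dv; apply: cinv_continuous; have [] := sub v Dv.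
  - move=> u v s Du Dv /andP[s0 s1]; rewrite /D /=.
    have -> : z - (u + s *: (v - u)) = (1 - s) *: (z - u) + s *: (z - v).
      by rewrite !scalerBr !scalerBl !scale1r; apply/pair_equal_spec; split; rewrite /=; ring.
    apply: (le_lt_trans (ler_normD _ _)); rewrite !normrZ !ger0_norm ?subr_ge0 //.
    apply: (@le_lt_trans _ _ (Num.max `|z - u| `|z - v|)); last by rewrite gt_max Du Dv.
    set m := Num.max _ _; have -> : m = (1 - s) * m + s * m by ring.
    by apply: lerD; apply: ler_wpM2l; rewrite ?subr_ge0 // /m le_max lexx ?orbT.
  - by move=> v Dv; have [] := sub v Dv.
move: H; rewrite ex ey => H.
by apply: homotopic_eq H _ _ => t t01 /=; rewrite ?K1 ?K2 clamp_id.
Qed.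

Definition roomy x (eta : R) := forall w, `|center M x - w| <= 2 * eta ->
  chart_image M x w /\ B0 (cinv M x w).

Lemma roomy_le x (eta eta' : R) : eta <= eta' -> roomy x eta' -> roomy x eta.
Proof. by move=> le H w we; apply: H; apply: le_trans we _; rewrite ler_pM2l. Qed.

Definition ray x P := linear_path M x (center M x) P.

Lemma is_path_ray Y x (eta r : R) P : 0 <= r <= 2 * eta -> `|center M x - P| = r ->
  (forall w, `|center M x - w| <= 2 * eta -> chart_image M x w /\ Y (cinv M x w)) ->
  is_path Y x (cinv M x P) (ray x P).
Proof.
move=> /andP[r0 reta] Pr sub; rewrite -{1}(cinv_center M x); apply: is_path_linear => t /andP[t0 t1].
apply: sub; rewrite opprD addrA subrr add0r normrN normrZ (ger0_norm t0) distrC Pr.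
by apply: le_trans reta; rewrite ler_piMl.
Qed.

(* The constants depend on the clearance [c] asked for on the two frames but not
   on the frames themselves, which are only known to lie between [lo] and [eta].
   So a clear frame at an intermediate vertex may be chosen after [O]. *)
Definition corridor beta x y := exists eta : R, [/\ 0 < eta, roomy x eta, roomy y eta &
  forall lo c : R, 0 < lo < eta -> 0 < c -> exists L rho : R, [/\ 0 < L, 0 < rho &
    forall O n, obstacle_at_most d p O n rho ->
    forall rx ry, lo < rx < eta -> lo < ry < eta ->
    clear_frame M x O rx (c / n.+1%:R) -> clear_frame M y O ry (c / n.+1%:R) ->
    forall P Q, `|center M x - P| = rx -> `|center M y - Q| = ry ->
    exists gamma, [/\ tame M (B0 `\` O) (L * n.+1%:R) gamma,
      is_path B0 (cinv M x P) (cinv M y Q) gamma &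
      homotopic B0 x (cinv M y Q) (path_concat (ray x P) gamma) (path_concat beta (ray y Q))]]].

Lemma is_path_ray_roomy x (eta r : R) P : 0 < r < eta -> `|center M x - P| = r -> roomy x eta ->
  is_path B0 x (cinv M x P) (ray x P).
Proof. by move=> /andP[r0 re] xP H; apply: (is_path_ray _ xP H); lra. Qed.

Lemma corridor_homotopic beta beta' x y :
  homotopic B0 x y beta beta' -> corridor beta x y -> corridor beta' x y.
Proof.
move=> hb [eta [eta0 rx ry H]]; exists eta; split => // lo c lo0 c0.
have [L [rho [L0 rho0 {}H]]] := H lo c lo0 c0; exists L, rho; split => //.
move=> O n envO r r' hr hr' cx cy P Q xP yQ.
have [gamma [tg pg hg]] := H O n envO r r' hr hr' cx cy P Q xP yQ.
exists gamma; split => //; apply: homotopic_trans hg _.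
apply: homotopic_concat hb (homotopic_refl _).
by apply: is_path_ray_roomy yQ ry; case/andP: hr' => + ->; case/andP: lo0 => + _; rewrite andbT; exact: lt_trans.
Qed.

(** Once [O] is known, a clear frame at [y] is chosen with radius admissible for both corridors, and
    both are made to end at the same point [T] of it. The ray to [T] then cancels in the
    homotopy. *)
Lemma corridor_concat beta beta' x y (z : B) : is_path B0 x y beta -> is_path B0 y z beta' ->
  corridor beta x y -> corridor beta' y z -> corridor (path_concat beta beta') x z.
Proof.
move=> pb pb' [e1 [e10 rx1 ry1 H1]] [e2 [e20 ry2 rz2 H2]].
pose eta := Num.min e1 e2.
have eta0 : 0 < eta by rewrite lt_min e10.
have [le1 le2] : eta <= e1 /\ eta <= e2 by rewrite !ge_min !lexx orbT.
exists eta; split => //; [exact: roomy_le rx1|exact: roomy_le rz2|].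
move=> lo c /andP[lo0 loeta] c0.
have ry := roomy_le le1 ry1.
have [cm [rm [cm0 rm0 Hm]]] := clear_level_obstacle d p loeta (fun w wr => (ry w wr).1)
  (fun v w => dist_lipschitz (center M y) v w).
(* The clearance asked of both corridors: no more than is given at the outer ends, nor than can be
   ensured at [y]. *)
pose c' := Num.min c cm.
have c'0 : 0 < c' by rewrite lt_min c0.
have [c'c c'm] : c' <= c /\ c' <= cm by rewrite !ge_min !lexx orbT.
have [|L1 [rho1 [L10 rho10 {}H1]]] := H1 lo c' _ c'0; first by rewrite lo0 (lt_le_trans loeta le1).
have [|L2 [rho2 [L20 rho20 {}H2]]] := H2 lo c' _ c'0; first by rewrite lo0 (lt_le_trans loeta le2).
pose rho := Num.min rm (Num.min rho1 rho2).
have rho0 : 0 < rho by rewrite !lt_min rm0 rho10.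
have [lem lr1 lr2] : [/\ rho <= rm, rho <= rho1 & rho <= rho2] by rewrite /rho !ge_min !lexx !orbT.
exists (2 * (L1 + L2)), rho; split => //; first by rewrite mulr_gt0 // addr_gt0.
move=> O n envO r r' /andP[lor reta] /andP[lor' reta'] cx cz P Q xP zQ.
have div_le (a b : R) : a <= b -> a / n.+1%:R <= b / n.+1%:R.
  by move=> ab; rewrite ler_pM2r // invr_gt0 ltr0n.
have [s /andP[los seta] Hs] := Hm O n (obstacle_at_most_le lem envO).
have s0 : 0 < s by exact: lt_trans los.
have cy : clear_frame M y O s (c' / n.+1%:R).
  move=> w ws Ow; apply: le_trans (div_le _ _ c'm) _; apply: Hs Ow.
  by apply: le_trans ws _; rewrite ler_pM2l // ltW.
pose T := center M y + (s, 0).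
have yT : `|center M y - T| = s.
  by rewrite /T opprD addrA subrr add0r normrN prod_normE /= normr0 (gtr0_norm s0) (max_idPl _) // ltW.
have i1 : lo < r < e1 by rewrite lor (lt_le_trans reta le1).
have i2 : lo < s < e1 by rewrite los (lt_le_trans seta le1).
have i3 : lo < s < e2 by rewrite los (lt_le_trans seta le2).
have i4 : lo < r' < e2 by rewrite lor' (lt_le_trans reta' le2).
have [g1 [t1 p1 h1]] := H1 O n (obstacle_at_most_le lr1 envO) r s i1 i2
  (clear_frame_le (div_le _ _ c'c) cx) cy P T xP yT.
have [g2 [t2 p2 h2]] := H2 O n (obstacle_at_most_le lr2 envO) s r' i3 i4 cy
  (clear_frame_le (div_le _ _ c'c) cz) T Q yT zQ.
have n0 : 0 <= n.+1%:R :> R by [].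
exists (path_concat g1 g2); split.
- rewrite -mulrA; apply: tame_concat.
  + by have [_ _ -> _] := p1; have [_ -> _ _] := p2.
  + by apply: tame_le t1; rewrite ler_wpM2r // lerDl ltW.
  + by apply: tame_le t2; rewrite ler_wpM2r // lerDr ltW.
- exact: is_path_concat p1 p2.
- have pP : is_path B0 x (cinv M x P) (ray x P).
    by apply: is_path_ray_roomy xP rx1; rewrite (lt_trans lo0 lor); case/andP: i1.
  have pT : is_path B0 y (cinv M y T) (ray y T).
    by apply: is_path_ray_roomy yT ry1; rewrite s0; case/andP: i2.
  have pQ : is_path B0 z (cinv M z Q) (ray z Q).
    by apply: is_path_ray_roomy zQ rz2; rewrite (lt_trans lo0 lor'); case/andP: i4.
  apply: homotopic_trans (homotopic_sym (homotopic_assoc pP p1 p2)) _.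
  apply: homotopic_trans (homotopic_concat h1 (homotopic_refl p2)) _.
  apply: homotopic_trans (homotopic_assoc pb pT p2) _.
  apply: homotopic_trans (homotopic_concat (homotopic_refl pb) h2) _.
  exact: homotopic_sym (homotopic_assoc pb pb' pQ).
Qed.

(** Spokes from [x] and from [y] meet at a point [T] of one clear frame around [q]. Everything stays
    in the square of half-side [8 * ro], so the homotopy comes from convexity. *)
Lemma corridor_short q (ro : R) x y beta : 0 < ro ->
  (forall w, `|center M q - w| <= 8 * ro -> chart_image M q w /\ B0 (cinv M q w)) ->
  is_path (chart_square M q (center M q) ro) x y beta -> corridor beta x y.
Proof.
move=> ro0 hub pb.
have endp v t : beta (clamp t) = v -> chart_dom M q v /\ `|center M q - coord M q v| < ro.
  move=> <-; have [w wr <-] := path_in t pb.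
  have wr' : `|center M q - w| < ro by [].
  have [iw _] : chart_image M q w /\ B0 (cinv M q w) by apply: hub; lra.
  by rewrite cinvK //; split => //; exact: cinv_dom.
have [dx ax] := endp x 0 (path_clamp0 pb).
have [dy ay] := endp y 1 (path_clamp1 pb).
have [e1 [e10 rx Sx]] := spoke d p ro0 hub dx ax.
have [e2 [e20 ry Sy]] := spoke d p ro0 hub dy ay.
set Y := chart_square M q (center M q) (8 * ro) in rx Sx ry Sy.
have hubY w : `|center M q - w| < 8 * ro -> chart_image M q w /\ B0 (cinv M q w).
  by move=> /ltW; exact: hub.
have YB0 : Y `<=` B0 by move=> _ [w wr <-]; have [] := hubY w wr.
pose eta := Num.min e1 e2.
have eta0 : 0 < eta by rewrite lt_min e10.
have [le1 le2] : eta <= e1 /\ eta <= e2 by rewrite !ge_min !lexx orbT.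
exists eta; split => //.
- by apply: (roomy_le le1) => w /rx[? /YB0].
- by apply: (roomy_le le2) => w /ry[? /YB0].
move=> lo c /andP[lo0 loeta] c0.
have r23 : 2 * ro < 3 * ro by lra.
have [cm [rm [cm0 rm0 Hm]]] := clear_level_obstacle d p r23 (fun w wr => (hub w wr).1)
  (fun v w => dist_lipschitz (center M q) v w).
pose c' := Num.min c cm.
have c'0 : 0 < c' by rewrite lt_min c0.
have [c'c c'm] : c' <= c /\ c' <= cm by rewrite !ge_min !lexx orbT.
have [|L1 [rho1 [L10 rho10 {}Sx]]] := Sx lo c' _ c'0; first by rewrite lo0 (lt_le_trans loeta le1).
have [|L2 [rho2 [L20 rho20 {}Sy]]] := Sy lo c' _ c'0; first by rewrite lo0 (lt_le_trans loeta le2).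
pose rho := Num.min rm (Num.min rho1 rho2).
have rho0 : 0 < rho by rewrite !lt_min rm0 rho10.
have [lem lr1 lr2] : [/\ rho <= rm, rho <= rho1 & rho <= rho2] by rewrite /rho !ge_min !lexx !orbT.
exists (2 * (L1 + L2)), rho; split => //; first by rewrite mulr_gt0 // addr_gt0.
move=> O n envO r r' /andP[lor reta] /andP[lor' reta'] cx cy P Q xP yQ.
have div_le (a b : R) : a <= b -> a / n.+1%:R <= b / n.+1%:R.
  by move=> ab; rewrite ler_pM2r // invr_gt0 ltr0n.
have [h h23 Hh] := Hm O n (obstacle_at_most_le lem envO).
have Hh' w : `|center M q - w| <= 8 * ro -> O (cinv M q w) ->
    c' / n.+1%:R <= `| `|center M q - w| - h|.
  by move=> wr Ow; apply: le_trans (div_le _ _ c'm) _; exact: Hh.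
have h0 : 0 < h by case/andP: h23; lra.
pose T := center M q + (h, 0).
have qT : `|center M q - T| = h.
  by rewrite /T opprD addrA subrr add0r normrN prod_normE /= normr0 (gtr0_norm h0) (max_idPl _) // ltW.
have i1 : lo < r < e1 by rewrite lor (lt_le_trans reta le1).
have i2 : lo < r' < e2 by rewrite lor' (lt_le_trans reta' le2).
have j1 := Sx O n (obstacle_at_most_le lr1 envO) r h i1
  (clear_frame_le (div_le _ _ c'c) cx) h23 Hh' P T xP qT.
have j2 := Sy O n (obstacle_at_most_le lr2 envO) r' h i2
  (clear_frame_le (div_le _ _ c'c) cy) h23 Hh' Q T yQ qT.
have n0 : 0 <= n.+1%:R :> R by [].
have k1 : L1 * n.+1%:R <= (L1 + L2) * n.+1%:R by rewrite ler_wpM2r // lerDl ltW.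
have k2 : L2 * n.+1%:R <= (L1 + L2) * n.+1%:R by rewrite ler_wpM2r // lerDr ltW.
have [gamma [tg pg]] := join_concat (join_le k1 j1) (join_sym (join_le k2 j2)).
exists gamma; split; [by rewrite -mulrA|exact: is_path_subset pg|].
apply: (homotopic_chart_square hubY).
- apply: is_path_concat pg; apply: (@is_path_ray _ x e1 r) => //.
  by move: i1 lo0 e10; clear -d p B0; lra.
- apply: (@is_path_concat _ _ _ _ y).
    apply: is_path_subset pb => _ [w wr <-]; exists w => //.
    by have wr' : `|center M q - w| < ro by []; rewrite /=; lra.
  apply: (@is_path_ray _ y e2 r') => //.
  by move: i2 lo0 e20; clear -d p B0; lra.
Qed.

End corridors.

(** * Completeness of the plane and Baire's theorem *)

HB.instance Definition _ (R : realType) := isPointed.Build (R * R)%type (0, 0).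
Lemma prod_complete (R : realType) (F : set_system (R * R)) : ProperFilter F -> cauchy F -> cvg F.
Proof.
move=> PF cF.
have cauchy_image (f : R * R -> R^o) : (forall v w, `|f v - f w| <= `|v - w|) -> cvg (f @ F).
  move=> fL; apply/cauchy_cvgP; apply/cauchy_ballP => e e0.
  move/cauchy_ballP : cF => /(_ e e0) [[P Q] /= [FP FQ] PQ].
  exists (f @` P, f @` Q) => /=; first by split; apply: filterS (@preimage_image _ _ f _) _.
  move=> [_ _] [[v Pv <-] [w Qw <-]]; have := PQ (v, w) (conj Pv Qw).
  by rewrite /= -!ball_normE /=; exact: le_lt_trans (fL v w).
have c1 := cauchy_image fst; have c2 := cauchy_image snd.
have n1 (v w : R * R) : `|v.1 - w.1| <= `|v - w| by rewrite prod_normE /= le_max lexx.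
have n2 (v w : R * R) : `|v.2 - w.2| <= `|v - w| by rewrite prod_normE /= le_max lexx orbT.
have := cvg_pair (c1 n1) (c2 n2).
have -> : (fun x : R * R => (x.1, x.2)) @ F = F.
  by rewrite eqEsubset; split => A; rewrite /fmap /=; apply: filterS => -[].
move=> h; apply: (@cvgP (R * R)%type F (lim (fst @ F : set_system R^o), lim (snd @ F : set_system R^o))).
move=> P nP; exact: (h _ _ _ P nP).
Qed.
HB.instance Definition _ (R : realType) := Uniform_isComplete.Build (R * R)%type (@prod_complete R).

(** If the closure of [A n] in [D] had empty interior for every [n], Baire's theorem would give a
    point of [D] in no [A n]. So some closure contains an open set, which in turn contains points of
    that [A n]. *)
Lemma countable_cover_dense (R : realType) (A : nat -> set (R * R)) (D : set (R * R)) :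
  open D -> D !=set0 -> (forall w, D w -> exists n, A n w) ->
  exists n w (s : R), [/\ 0 < s, A n w, D w & forall v, `|w - v| < s ->
    D v /\ forall e : R, 0 < e -> exists u, [/\ A n u, D u & `|v - u| < e]].
Proof.
move=> oD D0 cov; pose F n : set (R * R)%type := ~` closure (A n `&` D).
have oF n : open (F n) by apply: closed_openC; exact: closed_closure.
have [dF|/existsNP[n /denseNE[V [[w [oV Vw]] VF]]]] := pselect (forall n, dense (F n)).
  have [w [Dw Fw]] := @Baire R (R * R)%type F (fun n => conj (oF n) (dF n)) D D0 oD.
  have [n Anw] := cov w Dw; exfalso; apply: (Fw n I); apply: subset_closure.
  by split.
have VC v : V v -> closure (A n `&` D) v.
  by move=> Vv; apply: contrapT => nc; have : (V `&` F n) v by []; rewrite VF.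
have [u [[Au Du] Vu]] := VC w Vw V (open_nbhs_nbhs (conj oV Vw)).
have nu : \forall v \near u, V v /\ D v.
  by apply: filterI; apply: open_nbhs_nbhs.
have [s s0 Hs] := near_norm_ball nu.
exists n, u, s; split => // v vs; have [Vv Dv] := Hs v vs; split => // e e0.
have [u' [[Au' Du'] ve]] := VC v Vv _ (@nbhs_ball_lt R (R * R)%type v e e0).
by exists u'.
Qed.

Lemma closed_disc_closed (R : realType) (B : topologicalType) (D : set B) :
  hausdorff_space B -> closed_disc R D -> closed D.
Proof.
move=> hB [e [ce _ ->]]; apply: compact_closed => //; apply: continuous_compact => //.
pose E := [set w : R * R | w.1 ^+ 2 + w.2 ^+ 2 <= 1].
have EE : [set z : Cplx R | `|z| <= 1] = (@to_complex R) @` E.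
  have H (w : R * R) : (`|to_complex w : Cplx R| <= 1) = (w.1 ^+ 2 + w.2 ^+ 2 <= 1).
    rewrite norm_normc -[X in _ <= X]/((1 : R)%:C)%C lecR /to_complex /=.
    by rewrite -{1}sqrtr1 ler_sqrt.
  apply/seteqP; split => [z /= z1|_ [w /= w1 <-]]; last by rewrite /= H.
  exists (of_complex z); last exact: of_complexK.
  by have := H (of_complex z); rewrite of_complexK z1 => /esym.
rewrite EE; apply: continuous_compact.
  by apply: continuous_subspaceT; exact: to_complex_continuous.
apply: (subclosed_compact _ (@closed_square_compact R (0, 0) 1)).
  have cf : continuous (fun w : R * R => w.1 ^+ 2 + w.2 ^+ 2 : R).
    by move=> w; apply: cvgD; apply: cvgM; (exact: cvg_fst || exact: cvg_snd).
  have -> : E = (fun w : R * R => w.1 ^+ 2 + w.2 ^+ 2 : R) @^-1` [set x | x <= 1] by [].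
  by apply: preimage_closed; [move=> w _; exact: cf|exact: closed_le].
move=> w w1; have {}w1 : w.1 ^+ 2 + w.2 ^+ 2 <= 1 := w1.
rewrite /= prod_normE /= !sub0r !normrN ge_max.
have s1 := sqr_ge0 w.1; have s2 := sqr_ge0 w.2.
by apply/andP; split; rewrite -(@expr_le1 _ 2) // real_normK ?num_real //; lra.
Qed.

Lemma near_center (R : realType) (B : topologicalType) (M : riemann_surface R B) x (V : set B) :
  open V -> V x -> exists2 s : R, 0 < s &
  forall w, `|center M x - w| < s -> chart_image M x w /\ V (cinv M x w).
Proof.
move=> oV Vx.
have ci : {for center M x, continuous (cinv M x)} by apply: cinv_continuous; exact: chart_image_center.
have n1 : \forall w \near center M x, chart_image M x w.
  exact: (open_nbhs_nbhs (conj (@chart_image_open _ _ M x) (chart_image_center M x))).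
have n2 : \forall w \near center M x, V (cinv M x w).
  by apply: (ci V); rewrite cinv_center; exact: (open_nbhs_nbhs (conj oV Vx)).
exact: near_norm_ball (filterI n1 n2).
Qed.

Section corridor_paths.
Variables (R : realType) (B : topologicalType) (M : riemann_surface R B).
Variables (d : riemannian_metric M) (p : nat) (B0 : set B).
Hypothesis B0_open : open B0.

(** Tagged induction cuts [beta] into pieces lying in chart squares around their tags; their
    corridors are concatenated. *)
Lemma corridor_path x y (beta : R -> B) : is_path B0 x y beta -> corridor d p B0 beta x y.
Proof.
move=> pb; have cb := path_clamp pb.
pose P (a b : R) := corridor d p B0 (subpath beta a b) (beta a) (beta b).
have : P 0 1.
  apply: interval_tagged_induction => //.
    move=> a b c a0 ab bc c1 Pab Pbc.
    have b1 : b <= 1 by exact: le_trans c1.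
    have b0 : 0 <= b by exact: le_trans ab.
    apply: corridor_homotopic (homotopic_subpath pb a0 ab bc c1) _.
    by apply: (corridor_concat _ _ Pab Pbc); [exact: (is_path_subpath a0 ab b1 pb)|exact: (is_path_subpath b0 bc c1 pb)].
  move=> t t01; pose q := beta t.
  have B0q : B0 q by rewrite /q -(clamp_id t01); exact: path_in pb.
  have [s s0 Hs] := near_center M B0_open B0q.
  pose ro := s / 16; have ro0 : 0 < ro by rewrite divr_gt0.
  have hub w : `|center M q - w| <= 8 * ro -> chart_image M q w /\ B0 (cinv M q w).
    by move=> wr; apply: Hs; move: wr s0; rewrite /ro; clear -d p; lra.
  have sub w : `|center M q - w| < ro -> chart_image M q w.
    by move=> wr; have [|//] := hub w; move: wr ro0; clear -d p; lra.
  have sq : chart_square M q (center M q) ro (beta (clamp t)).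
    by rewrite clamp_id // -/q; exists (center M q); [rewrite /= subrr normr0|exact: cinv_center].
  have nt : \forall u \near t, chart_square M q (center M q) ro (beta (clamp u)).
    exact: (cb t _ (open_nbhs_nbhs (conj (chart_square_open sub) sq))).
  have [dl dl0 Hdl] := near_norm_ball nt.
  have small a b : 0 <= a -> a <= b -> b <= 1 ->
      (forall u, a <= u <= b -> `|t - u| < dl) -> P a b.
    move=> a0 ab b1 H; apply: (corridor_short d p ro0 hub).
    have [c e0 e1 _] := is_path_subpath a0 ab b1 pb; split => // _ [u /= + <-].
    rewrite in_itv /= => /andP[u0 u1]; rewrite /subpath.
    have u2 : a <= (b - a) * u + a <= b by apply/andP; split; nra.
    rewrite -[X in beta X]clamp_id; first exact: Hdl (H _ u2).
    by move: u2; clear -a0 b1; lra.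
  case/andP: t01 => t0 t1; exists dl => //; split => [a a0 at_ da|b tb b1 db].
    by apply: small => // u /andP[au ut]; rewrite ger0_norm ?subr_ge0 //; lra.
  by apply: small => // u /andP[au ut]; rewrite distrC ger0_norm ?subr_ge0 //; lra.
rewrite /P; have [_ -> -> _] := pb; apply: corridor_homotopic.
apply: homotopic_eq (homotopic_refl pb) _ _ => // u _.
by rewrite /subpath subr0 mul1r addr0.
Qed.

End corridor_paths.

(** * Choice of the base point *)

Section fundamental_group.
Variables (R : realType) (B : topologicalType).
Implicit Types (X : set B) (x y : B) (g h : R -> B).

Lemma homotopic_class X x g h : homotopic X x x g h -> pi1_class X x g = pi1_class X x h.
Proof.
move=> gh; apply/seteqP; split => f /= H; last exact: homotopic_trans gh H.
exact: homotopic_trans (homotopic_sym gh) H.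
Qed.

Lemma class_homotopic X x g h : is_loop X x h -> pi1_class X x g = pi1_class X x h ->
  homotopic X x x g h.
Proof.
move=> ph e; suff : pi1_class X x g h by [].
by rewrite e /pi1_class /=; exact: homotopic_refl.
Qed.

Lemma path_reverseK g : path_reverse (path_reverse g) = g.
Proof. by apply/funext => t; rewrite /path_reverse subKr. Qed.

(** Words form a countable type, which is how countability of the fundamental group enters. If the
    last generator was omitted from [alpha], it is put back. *)
Lemma generating_words X x m (alpha : seq (set (R -> B))) : canonical_generators X x m alpha ->
  exists al : seq (set (R -> B)), forall a, pi1 X x a -> exists w : word, a = pi1_eval X x al w.
Proof.
case=> g [[_ _ gen _]|[_ [c [_ _ gen _]]]]; [exists alpha|exists (rcons alpha c)];
  by move=> a /gen[w _ ->]; exists w.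
Qed.

(** Up to homotopy, [cz = c1 sigma] and [sigma gamma = c1^-1 a c1 sigma], so [cz gamma = a cz]. *)
Lemma tether_conjugate X x y z (c1 cz a sigma gamma : R -> B) :
  is_path X x y c1 -> is_path X x z cz -> is_path X x x a ->
  is_path X y z sigma -> is_path X z z gamma ->
  homotopic X x z cz (path_concat c1 sigma) ->
  homotopic X y z (path_concat sigma gamma)
    (path_concat (path_concat (path_concat (path_reverse c1) a) c1) sigma) ->
  homotopic X x x (path_concat (path_concat cz gamma) (path_reverse cz)) a.
Proof.
move=> p1 pz pa ps pg hz hg; have r1 := is_path_reverse p1; have ra := is_path_concat r1 pa.
have p1s := is_path_concat p1 ps; have rz := homotopic_refl (is_path_reverse pz).
suff H : homotopic X x z (path_concat cz gamma) (path_concat a cz).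
  exact: homotopic_trans (homotopic_concat H rz) (homotopic_cancelr pa pz).
apply: homotopic_trans (homotopic_concat hz (homotopic_refl pg)) _.
apply: homotopic_trans (homotopic_assoc p1 ps pg) _.
apply: homotopic_trans (homotopic_concat (homotopic_refl p1) hg) _.
apply: homotopic_trans (homotopic_concat (homotopic_refl p1) (homotopic_assoc ra p1 ps)) _.
apply: homotopic_trans (homotopic_concat (homotopic_refl p1) (homotopic_assoc r1 pa p1s)) _.
apply: homotopic_trans (homotopic_cancell p1 (is_path_concat pa p1s)) _.
exact: homotopic_concat (homotopic_refl pa) (homotopic_sym hz).
Qed.

End fundamental_group.

Lemma sum_upper_bound (R : realType) k (f : 'I_k -> R) i : (forall j, 0 <= f j) -> f i <= \sum_j f j.
Proof. by move=> f0; rewrite (bigD1 i) //= lerDl sumr_ge0. Qed.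

(** The inverse of one plus the sum of the inverses also covers [k = 0]. *)
Lemma finite_lower_bound (R : realType) k (f : 'I_k -> R) : (forall i, 0 < f i) ->
  exists2 e, 0 < e & forall i, e <= f i.
Proof.
move=> f0; have f0' i : 0 <= (f i)^-1 by rewrite invr_ge0 ltW.
have s0 : 0 < 1 + \sum_i (f i)^-1 by rewrite ltr_pwDl // sumr_ge0.
exists (1 + \sum_i (f i)^-1)^-1; first by rewrite invr_gt0.
move=> i; rewrite -[leRHS]invrK lef_pV2 ?posrE ?invr_gt0 //.
by apply: le_trans (sum_upper_bound i f0') _; rewrite lerDr.
Qed.

Section tethers.
Variables (R : realType) (B : topologicalType) (M : riemann_surface R B).
Variables (B0 : set B) (b0 : B) (al : seq (set (R -> B))) (c : B -> R -> B).
Hypothesis B0_open : open B0.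
Hypothesis b0_B0 : B0 b0.
Hypothesis gen : forall a : set (R -> B), pi1 B0 b0 a -> exists w : word, a = pi1_eval B0 b0 al w.
Hypothesis c_path : forall b, B0 b -> is_path B0 b0 b (c b).

(* [pi_1] is countable, so by Baire some class of loops
   [c b . ray^-1] occurs for a somewhere dense set of points [b]. *)
Lemma dense_tethers : exists (r s : R) (A : set (R * R)) (w1 : R * R),
  [/\ 0 < s, `|center M b0 - w1| < r,
    forall w, `|center M b0 - w| < r -> chart_image M b0 w /\ B0 (cinv M b0 w),
    forall v, `|w1 - v| < s -> `|center M b0 - v| < r /\
      forall e : R, 0 < e -> exists u, [/\ A u, `|center M b0 - u| < r & `|v - u| < e] &
    forall u sigma, A u -> `|center M b0 - u| < r ->
      is_path (chart_square M b0 (center M b0) r) (cinv M b0 w1) (cinv M b0 u) sigma ->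
      homotopic B0 b0 (cinv M b0 u) (c (cinv M b0 u)) (path_concat (c (cinv M b0 w1)) sigma)].
Proof.
have [r r0 Hr] := near_center M B0_open b0_B0.
set z0 := center M b0 in Hr *.
pose D : set (R * R) := [set w | `|z0 - w| < r]; set Y := chart_square M b0 z0 r.
have YB0 : Y `<=` B0 by move=> _ [w wr <-]; have [] := Hr w wr.
have pray w : D w -> is_path Y b0 (cinv M b0 w) (ray M b0 w).
  move=> wr; rewrite -{1}(cinv_center M b0); apply: is_path_linear => t /andP[t0 t1].
  have tr : `|z0 - (z0 + t *: (w - z0))| < r.
    rewrite opprD addrA subrr add0r normrN normrZ (ger0_norm t0) distrC.
    by apply: le_lt_trans wr; rewrite ler_piMl.
  by split; [have [] := Hr _ tr|exists (z0 + t *: (w - z0))].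
pose ell w := path_concat (c (cinv M b0 w)) (path_reverse (ray M b0 w)).
have pc w : D w -> is_path B0 b0 (cinv M b0 w) (c (cinv M b0 w)).
  by move=> wr; apply: c_path; have [] := Hr w wr.
have pell w : D w -> is_loop B0 b0 (ell w).
  move=> wr; apply: is_path_concat (pc w wr) _; apply: is_path_reverse.
  exact: is_path_subset (pray w wr).
(* Words are coded by integers, and any two points of one [A n] have homotopic loops [ell]. *)
pose A (n : nat) (w : R * R) := exists wd : seq (nat * bool), choice.unpickle n = Some wd /\ pi1_class B0 b0 (ell w) = pi1_eval B0 b0 al wd.
have cov w : D w -> exists n, A n w.
  move=> wr; have [|wd e] := gen (a := pi1_class B0 b0 (ell w)); first by exists (ell w) => //; exact: pell.
  by exists (choice.pickle (wd : seq (nat * bool))), wd; rewrite choice.pickleK.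
have D0 : D !=set0 by exists z0; rewrite /D /= subrr normr0.
have [n [w1 [s [s0 Aw1 Dw1 Hs]]]] := countable_cover_dense (@norm_ball_open R z0 r) D0 cov.
exists r, s, (A n), w1; split => // u sigma Au Du psig.
have ru := is_path_subset YB0 (pray u Du); have r1 := is_path_subset YB0 (pray w1 Dw1).
have rr1 := is_path_reverse r1.
have ell_eq : homotopic B0 b0 b0 (ell u) (ell w1).
  apply: class_homotopic; first exact: pell.
  by have [wd [e1 ->]] := Au; have [wd' [e2 ->]] := Aw1; move: e2; rewrite e1 => -[->].
(* The path [c] to [u] is [ell u] followed by the ray to [u]. After replacing [ell u] by [ell w1],
   the two remaining rays are deformed to [sigma] in the square. *)
have h1 := homotopic_cancelr (pc u Du) (is_path_reverse ru).
rewrite path_reverseK in h1.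
apply: homotopic_trans (homotopic_sym h1) _.
apply: homotopic_trans (homotopic_concat ell_eq (homotopic_refl ru)) _.
apply: homotopic_trans (homotopic_assoc (pc w1 Dw1) rr1 ru) _.
apply: homotopic_concat (homotopic_refl (pc w1 Dw1)) _.
apply: (homotopic_chart_square (z := z0) (r := r) Hr) psig.
exact: is_path_concat (is_path_reverse (pray w1 Dw1)) (pray u Du).
Qed.

End tethers.

Theorem theorem5p2 (R : realType) (B : topologicalType)
    (M : riemann_surface R B)
    (B_compact : compact [set: B]) (B_connected : connected [set: B])
    (d : riemannian_metric M)
    (m : nat) (U : 'I_m -> set B)
    (U_disc : forall j, closed_disc R (U j)) (U_disjoint : trivIset setT U)
    (B0 : set B) (B0E : B0 = ~` \bigcup_j U j)
    (b0 : B) (b0B0 : B0 b0)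
    (k : nat) (alpha : k.-tuple (set (R -> B)))
    (alpha_base : simple_base M B0 b0 m alpha)
    (c : B -> R -> B)
    (c_path : forall b, B0 b -> is_path B0 b0 b (c b))
    (c_smooth : forall b, B0 b -> smooth_path_on M (c b) 0 1)
    (c_bounded : exists K : R, forall b, B0 b ->
       (metric_length d (c b) <= K%:E)%E)
    (p : nat) (p_gt0 : (0 < p)%N) :
  exists L rho : R, [/\ 0 < L, 0 < rho &
    forall S : {fset B}, [set` S] `<=` B0 ->
    forall z : 'I_p -> B,
    let Z := \bigcup_j metric_disc d (z j) rho in
    let X := B0 `\` ([set` S] `|` Z) in
    exists b : B, X b /\
    exists gamma : 'I_k -> R -> B, forall i : 'I_k,
      [/\ is_loop X b (gamma i),
          piecewise_smooth M (gamma i),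
          pi1_class B0 b0
            (path_concat (path_concat (c b) (gamma i)) (path_reverse (c b)))
            = tnth alpha i &
          (path_length M (kobayashi M X) (gamma i)
             <= (L * (#|` S|%fset.+1)%:R)%:E)%E]].
Proof.
have oB0 : open B0.
  rewrite B0E; apply: closed_openC; apply: closed_bigcup; first exact: finite_finset.
  by move=> j _; apply: closed_disc_closed (U_disc j); exact: rs_hausdorff M.
have [al gen] := generating_words alpha_base.1.
have [r [s [A [w1 [s0 w1r Hr Hs tether]]]]] := dense_tethers M oB0 b0B0 gen c_path.
set Y := chart_square M b0 (center M b0) r in tether.
have [iw1 B0b1] := Hr w1 w1r.
set b1 := cinv M b0 w1 in B0b1 tether.
have pc1 := c_path b1 B0b1.
have loops i : exists a, is_loop B0 b0 a /\ tnth alpha i = pi1_class B0 b0 a.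
  have [|a [_ [la _ _] e]] := alpha_base.2 i; first by rewrite size_tuple.
  by exists a; rewrite (tnth_nth (pi1_one B0 b0)).
have {loops} [a loop_a] := choice loops.
(* These loops at [b1] do not depend on [b], so their corridors have constants fixed before [S] and
   [Z]. *)
pose beta i := path_concat (path_concat (path_reverse (c b1)) (a i)) (c b1).
have pbeta i : is_path B0 b1 b1 (beta i).
  exact: is_path_concat (is_path_concat (is_path_reverse pc1) (loop_a i).1) pc1.
have [eta0 Heta0] := choice (fun i => corridor_path d p oB0 (pbeta i)).
have [e1 e10 e1_le] : exists2 e, 0 < e & forall i, e <= eta0 i.
  by apply: finite_lower_bound => i; have [] := Heta0 i.
have sub_s w : `|w1 - w| < s -> chart_image M b0 w by move=> /Hs[/Hr[]].
have b1s : chart_square M b0 w1 s b1 by exists w1; rewrite //= subrr normr0.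
have [s1 s10 Hs1] := near_center M (chart_square_open sub_s) b1s.
(* The bound [s1 / 4] keeps the square of half-side [2 * eta] at [b1] inside the region around [w1]
   where [A] is dense. *)
pose eta := Num.min e1 (s1 / 4).
have eta_gt0 : 0 < eta by rewrite lt_min e10 divr_gt0.
have [eta_e1 eta_s1] : eta <= e1 /\ eta <= s1 / 4 by rewrite !ge_min !lexx orbT.
have room v : `|center M b1 - v| <= 2 * eta ->
    chart_image M b1 v /\ chart_square M b0 w1 s (cinv M b1 v).
  by move=> vr; apply: Hs1; lra.
pose lo := eta / 2.
have lo0 : 0 < lo by rewrite divr_gt0.
have loeta : lo < eta by rewrite /lo; lra.
have [k0 [rho0 [k00 rho00 Hlev]]] := clear_level_obstacle d p loeta (fun v vr => (room v vr).1)
  (fun v w => dist_lipschitz (center M b1) v w).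
(* The corridors are asked for clearance [k0 / 2] only: the other half pays for moving the frame.
   Taking the same frame and the same point [P] at both ends makes them loops. *)
have corr i : exists Lr : R * R, [/\ 0 < Lr.1, 0 < Lr.2 &
    forall O n, obstacle_at_most d p O n Lr.2 ->
    forall rx, lo < rx < eta -> clear_frame M b1 O rx (k0 / 2 / n.+1%:R) ->
    forall P, `|center M b1 - P| = rx ->
    exists gamma, [/\ tame M (B0 `\` O) (Lr.1 * n.+1%:R) gamma,
      is_path B0 (cinv M b1 P) (cinv M b1 P) gamma &
      homotopic B0 b1 (cinv M b1 P) (path_concat (ray M b1 P) gamma)
        (path_concat (beta i) (ray M b1 P))]].
  have [_ _ _ H] := Heta0 i; have le_i := le_trans eta_e1 (e1_le i).
  have lo_i : 0 < lo < eta0 i by rewrite lo0 (lt_le_trans loeta le_i).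
  have k20 : 0 < k0 / 2 by exact: divr_gt0.
  have [L [rho [L0 rho_gt0 HL]]] := H lo (k0 / 2) lo_i k20.
  exists (L, rho); split => // O n envO rx /andP[lorx rxeta] cl P xP.
  have rx_i : lo < rx < eta0 i by rewrite lorx (lt_le_trans rxeta le_i).
  exact: (HL O n envO rx rx rx_i rx_i cl cl P P xP xP).
have [Lr HLr] := choice corr.
have [rho1 rho10 rho1_le] : exists2 e, 0 < e & forall i, e <= (Lr i).2.
  by apply: finite_lower_bound => i; have [] := HLr i.
pose rho := Num.min rho0 rho1.
have rho_gt0 : 0 < rho by rewrite lt_min rho00.
have [rho_le0 rho_le1] : rho <= rho0 /\ rho <= rho1 by rewrite !ge_min !lexx orbT.
have L_ge0 i : 0 <= (Lr i).1 by have [/ltW] := HLr i.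
(* The summand 1 keeps [L] positive when [k = 0]. *)
pose L := 1 + \sum_i (Lr i).1.
have L_gt0 : 0 < L by rewrite ltr_pwDl // sumr_ge0.
exists L, rho; split => // S SB0 z Z X.
pose O := obstacle d rho S z; set n := #|` S|%fset.
have XE : X = B0 `\` O by [].
have envO : obstacle_at_most d p O n rho by exists S, z, rho.
have n0 : 0 < n.+1%:R :> R by rewrite ltr0n.
have [rr /andP[lorr rreta] clr] := Hlev O n (obstacle_at_most_le rho_le0 envO).
have rr0 : 0 < rr by exact: lt_trans lorr.
pose v0 := center M b1 + (rr, 0).
have v0r : `|center M b1 - v0| = rr.
  by rewrite /v0 opprD addrA subrr add0r normrN prod_normE /= normr0 (gtr0_norm rr0) (max_idPl _) // ltW.
have [iv0 [u0 u0s u0v0]] : chart_image M b1 v0 /\ chart_square M b0 w1 s (cinv M b1 v0).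
  by apply: room; rewrite v0r; lra.
pose kn := k0 / 2 / n.+1%:R.
have kn0 : 0 < kn by rewrite !divr_gt0.
(* A change of radius below [e] uses up at most half of the clearance and keeps the radius between
   [lo] and [eta]. *)
pose e := Num.min kn (Num.min (rr - lo) (eta - rr)).
have e0 : 0 < e by rewrite !lt_min kn0 !subr_gt0 lorr.
have [e_kn e_lo e_eta] : [/\ e <= kn, e <= rr - lo & e <= eta - rr].
  by rewrite /e !ge_min !lexx !orbT.
have iu0 : chart_image M b0 u0 := sub_s u0 u0s.
have du0 : chart_dom M b1 (cinv M b0 u0) by rewrite u0v0; exact: cinv_dom.
have c0 : {for u0, continuous (cinv M b0)} := cinv_continuous iu0.
have nu0 : \forall u \near u0, chart_dom M b1 (cinv M b0 u) /\
    `|v0 - coord M b1 (cinv M b0 u)| < e.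
  have n1 : \forall u \near u0, chart_dom M b1 (cinv M b0 u) by exact: (c0 _ (open_nbhs_dom du0)).
  have cc := continuous_comp c0 (coord_continuous du0).
  have nA : nbhs ((coord M b1 \o cinv M b0) u0) [set w | `|v0 - w| < e].
    have -> : (coord M b1 \o cinv M b0) u0 = v0 by rewrite /= u0v0 cinvK.
    exact: (@nbhs_ball_lt R (R * R)%type v0 e e0).
  have n2 : \forall u \near u0, `|v0 - coord M b1 (cinv M b0 u)| < e by exact: (cc _ nA).
  exact: filterI n1 n2.
have [dl dl0 Hdl] := near_norm_ball nu0.
(* [u0] is the point [v0] of the clear frame seen in the chart at [b0]; density supplies a point [u]
   of [A] so close that the frame through it is still clear. *)
have [_ /(_ dl dl0)[u [Au ur u0u]]] := Hs u0 u0s.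
have [dub vu] := Hdl u u0u.
set b := cinv M b0 u in dub vu.
pose V := coord M b1 b.
have bV : cinv M b1 V = b by exact: coordK.
pose rx := `|center M b1 - V|.
have rrx : `|rr - rx| < e by rewrite -v0r; apply: le_lt_trans (dist_lipschitz _ _ _) vu.
have [rx_lo rx_eta] : lo < rx /\ rx < eta.
  by move: rrx e_lo e_eta; rewrite ltr_norml; clear; lra.
have clx : clear_frame M b1 O rx kn.
  move=> w wr Ow.
  have h1 : k0 / n.+1%:R <= `| `|center M b1 - w| - rr| by apply: clr Ow; lra.
  have h2 : k0 / n.+1%:R = kn + kn by rewrite /kn; field; rewrite addrC natr1 lt0r_neq0.
  have h3 := ler_normD (`|center M b1 - w| - rx) (rx - rr); rewrite addrA subrK (distrC rx) in h3.
  by rewrite h2 in h1; move: h1 h3 rrx e_kn; clear; lra.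
have rx0 : 0 < rx by exact: lt_trans rx_lo.
have room_V : `|center M b1 - V| <= 2 * eta by rewrite -/rx; lra.
have B0b : B0 b by have [] := Hr u ur.
(* [b] lies on its own frame, so its distance to that level is 0, less than the clearance. *)
have Ob : ~ O b.
  have hV : `|center M b1 - V| <= 2 * rx by rewrite -/rx; move: rx0; clear; lra.
  rewrite -bV => OV; have : kn <= `|rx - rx| := clx V hV OV.
  by rewrite subrr normr0 leNgt kn0.
exists b; split; first by rewrite XE.
have pray : is_path Y b1 b (ray M b1 V).
  rewrite -bV; apply: (@is_path_ray _ _ _ _ _ eta rx) => //; first by lra.
  move=> v /room[iv [w wr <-]]; split => //; exists w => //.
  by have [] := Hs w wr.
have YB0 : Y `<=` B0 by move=> _ [w wr <-]; have [] := Hr w wr.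
have hc := tether u (ray M b1 V) Au ur pray.
have [gamma Hgamma] := choice (fun i => let: And3 _ _ H := HLr i in
  H O n (obstacle_at_most_le (le_trans rho_le1 (rho1_le i)) envO) rx
    (introT andP (conj rx_lo rx_eta)) clx V erefl).
exists gamma => i; have [tg pg hg] := Hgamma i.
rewrite bV in pg hg; split.
- rewrite XE; have [cg g0 g1 _] := pg; split => // _ [t /= + <-].
  by rewrite in_itv /= => tt; exact: tame_in tg tt.
- exact: tame_piecewise_smooth tg.
- rewrite (loop_a i).2; apply: homotopic_class.
  exact: (tether_conjugate pc1 (c_path b B0b) (loop_a i).1 (is_path_subset YB0 pray) pg hc hg).
- rewrite XE; apply: le_trans (tame_length _ tg) _; first by rewrite mulr_ge0.
  rewrite lee_fin ler_wpM2r // /L; apply: le_trans (sum_upper_bound i L_ge0) _.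
  by rewrite lerDr.
Qed.
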